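(* Let $\mathcal{P}=He_1\oplus He_2$ be the free left $H$-module of rank two with basis $e_1,e_2$, equipped with an $H$-pseudoalgebra structure such that $$e_{1}\ast e_{1}=t\otimes1 \otimes_{H}e_{1}, \quad e_{2}\ast e_{2}=1\otimes s \otimes_{H}e_{2}$$ for some nonzero $s\in\delta$ and nonzero $t\in\mathbf{k}$ (and $e_1\ast e_2$, $e_2\ast e_1$ are arbitrary elements of $(H\otimes H)\otimes_H\mathcal{P}$). Then $\mathcal{P}$ is a left pre-Lie $H$-pseudoalgebra if and only if it is of one of the following types: (1) $e_{1}\ast e_{2}=0$, $e_{2}\ast e_{1}=0$; (2) $e_{1}\ast e_{2}=0$, $e_{2}\ast e_{1}=1\otimes s\otimes_{H}e_{1}$; (3) $e_{1}\ast e_{2}=t\otimes1\otimes_{H}e_{2}$, $e_{2}\ast e_{1}=1\otimes s\otimes_{H}e_{1}+t\otimes1\otimes_{H}e_{2}$; (4) $e_{1}\ast e_{2}=1\otimes s\otimes_{H}e_{1}$, $e_{2}\ast e_{1}=(1\otimes s+s\otimes1)\otimes_{H}e_{1}$.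
   Context: $\mathbf{k}$ is an algebraically closed field of characteristic $0$, $\delta$ is a finite-dimensional Lie algebra over $\mathbf{k}$, and $H=U(\delta)$ is its universal enveloping algebra with the standard cocommutative Hopf structure ($\Delta(x)=x\otimes1+1\otimes x$ for $x\in\delta$). We regard $\mathbf{k},\delta\subset H$. $H^{\otimes n}$ is a right $H$-module via the iterated coproduct, e.g. $(f\otimes g)\cdot h=(f\otimes g)\Delta(h)$. An $H$-pseudoalgebra is a left $H$-module $A$ with a map $\ast:A\otimes A\to(H\otimes H)\otimes_H A$ that is $H$-bilinear: $hx\ast gy=(h\otimes g\otimes_H1)(x\ast y)$ for $x,y\in A$, $h,g\in H$. For $\beta\in H\otimes H$ and $x\ast y=\sum_i\alpha_i\otimes_Hc_i$ one sets, in $H^{\otimes3}\otimes_HA$, $(\beta\otimes_Hx)\ast y=\sum_i(\beta\otimes1)(\Delta\otimes\mathrm{id})(\alpha_i)\otimes_Hc_i$ and $x\ast(\beta\otimes_Hy)=\sum_i(1\otimes\beta)(\mathrm{id}\otimes\Delta)(\alpha_i)\otimes_Hc_i$. $A$ is left pre-Lie if for all $x,y,z\in A$ $$(x\ast y)\ast z-x\ast(y\ast z)=((12)\otimes_H\mathrm{id})[(y\ast x)\ast z-y\ast(x\ast z)],$$ where $(12)(f\otimes h\otimes g)=h\otimes f\otimes g$. Conventions: $f\otimes g\otimes_He$ means $(f\otimes g)\otimes_He$. By $H$-bilinearity a pseudoproduct on a free module is determined by its values on basis elements. *)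

(* Defs.v *)
From HB Require Import structures.
From mathcomp Require Import all_boot all_algebra.
From mathcomp Require Import boolp classical_sets.

Set Implicit Arguments.
Unset Strict Implicit.
Unset Printing Implicit Defensive.

Import GRing.Theory.

Local Open Scope ring_scope.
Local Open Scope quotient_scope.


HB.mixin Record Lmodule_isLieAlgebra (K : fieldType) (L : Type)
    of GRing.Lmodule K L := {
  lie : L -> L -> L;
  lieDl : forall x y z, lie (x + y) z = lie x z + lie y z;
  lieDr : forall x y z, lie x (y + z) = lie x y + lie x z;
  lieZl : forall (a : K) x y, lie (a *: x) y = a *: lie x y;
  lieZr : forall (a : K) x y, lie x (a *: y) = a *: lie x y;
  liexx : forall x, lie x x = 0;
  lie_jacobi : forall x y z,
    lie x (lie y z) + lie y (lie z x) + lie z (lie x y) = 0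
}.

#[short(type="lieAlgType")]
HB.structure Definition LieAlgebra (K : fieldType) :=
  { L of GRing.Lmodule K L & Lmodule_isLieAlgebra K L }.

#[short(type="finDimLieAlgType")]
HB.structure Definition FinDimLieAlgebra (K : fieldType) :=
  { L of Vector K L & Lmodule_isLieAlgebra K L }.

(* Balanced tensor products: [tensor ra la] is M (x)_R N, for the right action *)
(* [ra] of R on M and the left action [la] of R on N.  It is the abelian group *)
(* generated by the symbols m (x) n subject to biadditivity and balancedness,  *)
(* built as a quotient of formal expressions.                                  *)

Section BalancedTensor.
Variables (R : Type) (M N : zmodType) (ra : M -> R -> M) (la : R -> N -> N).

Inductive tterm : Type :=
  | TZero
  | TAdd of tterm & tterm
  | TOpp of tterm
  | TPure of M & N.

Inductive teq : tterm -> tterm -> Prop :=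
  | teq_refl x : teq x x
  | teq_sym x y : teq x y -> teq y x
  | teq_trans x y z : teq x y -> teq y z -> teq x z
  | teq_congD x x' y y' : teq x x' -> teq y y' -> teq (TAdd x y) (TAdd x' y')
  | teq_congN x x' : teq x x' -> teq (TOpp x) (TOpp x')
  | teq_addA x y z : teq (TAdd x (TAdd y z)) (TAdd (TAdd x y) z)
  | teq_addC x y : teq (TAdd x y) (TAdd y x)
  | teq_add0 x : teq (TAdd TZero x) x
  | teq_addN x : teq (TAdd (TOpp x) x) TZero
  | teq_pureDl m m' n : teq (TPure (m + m') n) (TAdd (TPure m n) (TPure m' n))
  | teq_pureDr m n n' : teq (TPure m (n + n')) (TAdd (TPure m n) (TPure m n'))
  | teq_balanced m r n : teq (TPure (ra m r) n) (TPure m (la r n)).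

HB.instance Definition _ := gen_eqMixin tterm.
HB.instance Definition _ := gen_choiceMixin tterm.

Definition teqb : rel tterm := fun x y => `[< teq x y >].

Fact teqb_refl : reflexive teqb.
Proof. by move=> x; apply/asboolP/teq_refl. Qed.
Fact teqb_sym : symmetric teqb.
Proof. by move=> x y; apply/asboolP/asboolP => /teq_sym. Qed.
Fact teqb_trans : transitive teqb.
Proof.
by move=> y x z /asboolP xy /asboolP yz; apply/asboolP/(teq_trans xy yz).
Qed.

Canonical teqb_equiv := EquivRel teqb teqb_refl teqb_sym teqb_trans.

Definition tensor : Type := {eq_quot teqb_equiv}.

HB.instance Definition _ := Choice.on tensor.
HB.instance Definition _ := EqQuotient.on tensor.

Lemma teqP x y : reflect (\pi_tensor x = \pi_tensor y) `[< teq x y >].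
Proof. exact: (@eqquotP _ _ tensor). Qed.

Lemma teq_repr x : teq (repr (\pi_tensor x)) x.
Proof. by apply/asboolP/teqP; rewrite reprK. Qed.

Definition tens0 : tensor := \pi_tensor TZero.
Definition tens_add (x y : tensor) : tensor := \pi_tensor (TAdd (repr x) (repr y)).
Definition tens_opp (x : tensor) : tensor := \pi_tensor (TOpp (repr x)).
Definition pure (m : M) (n : N) : tensor := \pi_tensor (TPure m n).

Lemma tens_addE x y : tens_add (\pi_tensor x) (\pi_tensor y) = \pi_tensor (TAdd x y).
Proof. by apply/teqP/asboolP/teq_congD; exact: teq_repr. Qed.

Lemma tens_oppE x : tens_opp (\pi_tensor x) = \pi_tensor (TOpp x).
Proof. by apply/teqP/asboolP/teq_congN; exact: teq_repr. Qed.

Fact tens_addA : associative tens_add.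
Proof.
elim/quotW=> x; elim/quotW=> y; elim/quotW=> z.
rewrite (tens_addE y) (tens_addE x y) (tens_addE x) (tens_addE (TAdd x y)).
exact/teqP/asboolP/teq_addA.
Qed.
Fact tens_addC : commutative tens_add.
Proof.
elim/quotW=> x; elim/quotW=> y; rewrite (tens_addE x) (tens_addE y).
exact/teqP/asboolP/teq_addC.
Qed.
Fact tens_add0 : left_id tens0 tens_add.
Proof. by elim/quotW=> x; rewrite tens_addE; exact/teqP/asboolP/teq_add0. Qed.
Fact tens_addN : left_inverse tens0 tens_opp tens_add.
Proof.
elim/quotW=> x; rewrite (tens_oppE x) (tens_addE (TOpp x)).
exact/teqP/asboolP/teq_addN.
Qed.

HB.instance Definition _ :=
  GRing.isZmodule.Build tensor tens_addA tens_addC tens_add0 tens_addN.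

Lemma pureDl m m' n : pure (m + m') n = pure m n + pure m' n.
Proof. by rewrite [RHS]tens_addE; exact/teqP/asboolP/teq_pureDl. Qed.
Lemma pureDr m n n' : pure m (n + n') = pure m n + pure m n'.
Proof. by rewrite [RHS]tens_addE; exact/teqP/asboolP/teq_pureDr. Qed.
Lemma pure_balanced m r n : pure (ra m r) n = pure m (la r n).
Proof. exact/teqP/asboolP/teq_balanced. Qed.
Lemma pure0l n : pure 0 n = 0.
Proof. by apply: (@addrI _ (pure 0 n)); rewrite -pureDl !addr0. Qed.
Lemma pure0r m : pure m 0 = 0.
Proof. by apply: (@addrI _ (pure m 0)); rewrite -pureDr !addr0. Qed.
Lemma pureNl m n : pure (- m) n = - pure m n.
Proof. by apply: (@addrI _ (pure m n)); rewrite -pureDl !subrr pure0l. Qed.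
Lemma pureNr m n : pure m (- n) = - pure m n.
Proof. by apply: (@addrI _ (pure m n)); rewrite -pureDr !subrr pure0r. Qed.

Lemma tensor_ind (P : tensor -> Prop) :
  P 0 -> (forall x y, P x -> P y -> P (x + y)) -> (forall m n, P (pure m n)) ->
  forall x, P x.
Proof.
move=> P0 PD Pp x; rewrite -[x]reprK.
suff [] : P (\pi_tensor (repr x)) /\ P (- \pi_tensor (repr x)) by [].
elim: (repr x) => [|y [Py Ny] z [Pz Nz]|y [Py Ny]|m n].
- by rewrite oppr0.
- have -> : \pi_tensor (TAdd y z) = \pi_tensor y + \pi_tensor z.
    by rewrite [RHS]tens_addE.
  by rewrite opprD; split; exact: PD.
- have -> : \pi_tensor (TOpp y) = - \pi_tensor y by rewrite [RHS]tens_oppE.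
  by rewrite opprK.
- by rewrite -[\pi_tensor _]/(pure m n) -pureNl.
Qed.

(* The universal property.  [tlift f] is defined for every f, but it is only   *)
(* meaningful when f is biadditive and balanced, see [tlift_pure].             *)
Section Lift.
Variables (Z : zmodType) (f : M -> N -> Z).

Definition balanced_biadditive : Prop :=
  [/\ forall m m' n, f (m + m') n = f m n + f m' n,
      forall m n n', f m (n + n') = f m n + f m n'
    & forall m r n, f (ra m r) n = f m (la r n)].

Fixpoint teval (x : tterm) : Z :=
  match x with
  | TZero => 0
  | TAdd x y => teval x + teval y
  | TOpp x => - teval x
  | TPure m n => f m n
  end.

Definition tlift (x : tensor) : Z := teval (repr x).

Hypothesis fP : balanced_biadditive.

Lemma teval_teq x y : teq x y -> teval x = teval y.
Proof.
case: fP => fDl fDr fB; elim=> //=.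
- by move=> ? ? ? _ -> _ ->.
- by move=> ? ? ? ? _ -> _ ->.
- by move=> ? ? _ ->.
- by move=> *; rewrite addrA.
- by move=> *; rewrite addrC.
- by move=> *; rewrite add0r.
- by move=> *; rewrite addNr.
Qed.

Lemma tlift_pi x : tlift (\pi_tensor x) = teval x.
Proof. by apply: teval_teq; exact: teq_repr. Qed.

Lemma tlift_pure m n : tlift (pure m n) = f m n.
Proof. exact: tlift_pi. Qed.

Lemma tliftD x y : tlift (x + y) = tlift x + tlift y.
Proof.
by rewrite -[x]reprK -[y]reprK [X in tlift X]tens_addE !tlift_pi.
Qed.

Lemma tlift0 : tlift 0 = 0.
Proof. exact: tlift_pi. Qed.

Lemma tliftN x : tlift (- x) = - tlift x.
Proof. by apply: (@addrI _ (tlift x)); rewrite -tliftD !subrr tlift0. Qed.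

End Lift.

Lemma tensor_ext (Z : zmodType) (f g : tensor -> Z) :
  {morph f : x y / x + y} -> {morph g : x y / x + y} ->
  (forall m n, f (pure m n) = g (pure m n)) -> f =1 g.
Proof.
move=> fD gD fg; apply: tensor_ind => [|x y fgx fgy|//].
- have e (h : tensor -> Z) : {morph h : x y / x + y} -> h 0 = 0.
    by move=> hD; apply: (@addrI _ (h 0)); rewrite -hD !addr0.
  by rewrite !e.
- by rewrite fD gD fgx fgy.
Qed.

End BalancedTensor.

(* Tensor products over the field K.                                           *)

Lemma functional_eq1 (K : fieldType) (V : lmodType K) (v : V) :
  v != 0 ->
  exists f : V -> K, (forall a x y, f (a *: x + y) = a * f x + f y) /\ f v = 1.
Proof.
move=> v0.
pose P (W : set V) := (forall a x y, W x -> W y -> W (a *: x + y)) /\ ~ W v.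
have [|A [[Alin Av] Amax]] := @Zorn_bigcup V P.
  move=> F FP Ftot; split=> [a x y [X FX Xx] [Y FY Yy]|[X /FP[]//]].
  by case: (Ftot _ _ FX FY) => XY; [exists Y|exists X] => //;
     apply: (FP _ _).1 => //; exact: XY.
pose B x := [set y | exists c w, (A w \/ w = 0) /\ y = w + c *: x]%classic.
have A0lin a x y : A x \/ x = 0 -> A y \/ y = 0 -> A (a *: x + y) \/ a *: x + y = 0.
  move=> [Ax|->] [Ay|->]; rewrite ?scaler0 ?add0r ?addr0; try by [left; auto|right].
  left; rewrite (_ : a *: x = (a - 1) *: x + x); first exact: Alin.
  by rewrite scalerBl scale1r subrK.
have Blin x a y z : B x y -> B x z -> B x (a *: y + z).
  move=> [c [w [Aw ->]]] [d [u [Au ->]]]; exists (a * c + d), (a *: w + u).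
  by split; [exact: A0lin|rewrite scalerDr scalerDl scalerA addrACA].
have Bv x : ~ A x -> B x v.
  move=> Ax; apply: contrapT => Bxv.
  have PB : P (B x) by split=> //; exact: Blin.
  apply: (Amax _ _ PB); rewrite /proper; split.
    by move=> y Ay; exists 0, y; split; [left|rewrite scale0r addr0].
  by move=> BA; apply/Ax/BA; exists 1, 0; split; [right|rewrite add0r scale1r].
have A0 : A 0%R.
  apply: contrapT => nA0; have [c [w [[Aw|->]]]] := Bv _ nA0; rewrite scaler0 addr0 => vE.
    by apply: Av; rewrite vE.
  by rewrite vE eqxx in v0.
have Al x y a : A x -> A y -> A (a *: x + y) by exact: Alin.
have dec x : exists c, A (x - c *: v).
  have [Ax|/Bv[c [w [Aw vE]]]] := pselect (A x); first by exists 0; rewrite scale0r subr0.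
  have {}Aw : A w by case: Aw => // ->.
  have c0 : c != 0.
    by apply: contra_not_neq Av => c0; rewrite vE c0 scale0r addr0.
  exists c^-1; rewrite {1}vE scalerDr scalerA mulVf // scale1r opprD addrCA subrr addr0.
  by rewrite -[- _]addr0 -scaleNr; exact: Al.
have uniq x c d : A (x - c *: v) -> A (x - d *: v) -> c = d.
  move=> Ac Ad; apply/eqP; rewrite -subr_eq0; apply: contra_notT Av => cd.
  have /(Al _ 0 (c - d)^-1) : A (-1 *: (x - c *: v) + (x - d *: v)) by exact: Al.
  rewrite addr0 scaleN1r opprB addrA subrK -scalerBl scalerA mulVf // scale1r.
  by apply.
have [f fP] := choice dec; exists f; split=> [a x y|].
  apply: (uniq (a *: x + y)) => //.
  rewrite scalerDl -scalerA opprD addrACA -scalerBr; exact: Al.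
by apply: (uniq v) => //; rewrite scale1r subrr.
Qed.

Section TensorModule.
Variables (K : fieldType) (V W : lmodType K).

Definition tensK : Type :=
  tensor (fun (v : V) (a : K) => a *: v) (fun (a : K) (w : W) => a *: w).

HB.instance Definition _ := GRing.Zmodule.on tensK.

Definition pureK (v : V) (w : W) : tensK := pure _ _ v w.

Definition tensK_scale (a : K) : tensK -> tensK :=
  tlift (fun v w => pureK (a *: v) w).

Fact tensK_scale_bal a :
  balanced_biadditive (fun v a => a *: v) (fun a w => a *: w)
    (fun v w => pureK (a *: v) w).
Proof.
split=> [v v' w|v w w'|v b w].
- by rewrite scalerDr [LHS]pureDl.
- by rewrite [LHS]pureDr.
- by rewrite scalerA mulrC -scalerA [LHS]pure_balanced.
Qed.

Lemma tensK_scale_pure a v w : tensK_scale a (pureK v w) = pureK (a *: v) w.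
Proof. exact: (tlift_pure (tensK_scale_bal a)). Qed.

Lemma tensK_scaleD a x y : tensK_scale a (x + y) = tensK_scale a x + tensK_scale a y.
Proof. exact: (tliftD (tensK_scale_bal a)). Qed.

Fact tensK_scaleA a b x : tensK_scale a (tensK_scale b x) = tensK_scale (a * b) x.
Proof.
move: x; apply: tensor_ext => [x y|x y|v w]; rewrite ?tensK_scaleD //.
by rewrite -[pure _ _ _ _]/(pureK v w) !tensK_scale_pure scalerA.
Qed.

Fact tensK_scale1 : left_id 1 tensK_scale.
Proof.
apply: tensor_ext => [x y|x y|v w]; rewrite ?tensK_scaleD //.
by rewrite -[pure _ _ _ _]/(pureK v w) !tensK_scale_pure scale1r.
Qed.

Fact tensK_scaleDl x : {morph tensK_scale^~ x : a b / a + b}.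
Proof.
move=> a b /=; move: x; apply: tensor_ext => [x y|x y|v w]; rewrite ?tensK_scaleD //.
  by rewrite addrACA.
rewrite -[pure _ _ _ _]/(pureK v w) !tensK_scale_pure scalerDl.
exact: pureDl.
Qed.

HB.instance Definition _ := GRing.Zmodule_isLmodule.Build K tensK
  tensK_scaleA tensK_scale1 tensK_scaleD tensK_scaleDl.

End TensorModule.

Notation "v \ox w" := (pureK v w) (at level 39, left associativity) : ring_scope.
Notation "V \OX W" := (tensK V W) (at level 39, left associativity) : type_scope.

Section TensorModuleTheory.
Variables (K : fieldType) (V W : lmodType K).
Implicit Types (v : V) (w : W) (a : K).

Lemma oxDl v v' w : (v + v') \ox w = v \ox w + v' \ox w.
Proof. exact: pureDl. Qed.
Lemma oxDr v w w' : v \ox (w + w') = v \ox w + v \ox w'.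
Proof. exact: pureDr. Qed.
Lemma oxZl a v w : (a *: v) \ox w = a *: (v \ox w).
Proof. by rewrite [RHS]tensK_scale_pure. Qed.
Lemma oxZr a v w : v \ox (a *: w) = a *: (v \ox w).
Proof. by rewrite -oxZl [RHS]pure_balanced. Qed.

Lemma ox_ind (P : V \OX W -> Prop) :
  P 0 -> (forall x y, P x -> P y -> P (x + y)) -> (forall v w, P (v \ox w)) ->
  forall x, P x.
Proof. exact: tensor_ind. Qed.

Lemma ox_ext (Z : zmodType) (f g : V \OX W -> Z) :
  {morph f : x y / x + y} -> {morph g : x y / x + y} ->
  (forall v w, f (v \ox w) = g (v \ox w)) -> f =1 g.
Proof. exact: tensor_ext. Qed.

Section Lift.
Variables (Z : lmodType K) (f : V -> W -> Z).

Definition is_bilinear : Prop :=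
  [/\ forall v v' w, f (v + v') w = f v w + f v' w,
      forall v w w', f v (w + w') = f v w + f v w',
      forall a v w, f (a *: v) w = a *: f v w
    & forall a v w, f v (a *: w) = a *: f v w].

(* Only meaningful for bilinear f.                                             *)
Definition liftK : V \OX W -> Z := tlift f.

Hypothesis fP : is_bilinear.

Let fbal : balanced_biadditive (fun v a => a *: v) (fun a w => a *: w) f.
Proof. by case: fP => fDl fDr fZl fZr; split=> // v a w; rewrite fZl fZr. Qed.

Lemma liftK_ox v w : liftK (v \ox w) = f v w.
Proof. exact: (tlift_pure fbal). Qed.
Lemma liftKD x y : liftK (x + y) = liftK x + liftK y.
Proof. exact: (tliftD fbal). Qed.
Lemma liftKZ a x : liftK (a *: x) = a *: liftK x.
Proof.
move: x; apply: ox_ext => [x y|x y|v w].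
- by rewrite scalerDr liftKD.
- by rewrite liftKD scalerDr.
- by case: fP => _ _ fZl _; rewrite -oxZl !liftK_ox fZl.
Qed.

End Lift.
End TensorModuleTheory.

Section TensorAlgebra.
Variables (K : fieldType) (A B : algType K).

(* (a (x) b)(a' (x) b') = aa' (x) bb'                                          *)
Definition tensK_lmul (a : A) (b : B) : A \OX B -> A \OX B :=
  liftK (fun a' b' => (a * a') \ox (b * b')).
Definition tensK_mul (x y : A \OX B) : A \OX B :=
  liftK (fun a b => tensK_lmul a b y) x.

Fact tensK_lmul_bil (a : A) (b : B) : is_bilinear (fun a' b' => (a * a') \ox (b * b')).
Proof.
split=> [x y z|x y z|c x y|c x y].
- by rewrite mulrDr oxDl.
- by rewrite mulrDr oxDr.
- by rewrite -scalerAr oxZl.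
- by rewrite -scalerAr oxZr.
Qed.

Lemma tensK_lmul_ox a b a' b' : tensK_lmul a b (a' \ox b') = (a * a') \ox (b * b').
Proof. exact: (liftK_ox (tensK_lmul_bil a b)). Qed.
Lemma tensK_lmulD a b x y :
  tensK_lmul a b (x + y) = tensK_lmul a b x + tensK_lmul a b y.
Proof. exact: (liftKD (tensK_lmul_bil a b)). Qed.
Lemma tensK_lmulZ a b c x : tensK_lmul a b (c *: x) = c *: tensK_lmul a b x.
Proof. exact: (liftKZ (tensK_lmul_bil a b)). Qed.

Fact tensK_mul_bil y : is_bilinear (fun a b => tensK_lmul a b y).
Proof.
split=> [a a' b|a b b'|c a b|c a b]; move: y; apply: ox_ext => [x y|x y|a0 b0];
  rewrite ?tensK_lmulD ?scalerDr //; try by rewrite addrACA.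
- by rewrite !tensK_lmul_ox mulrDl oxDl.
- by rewrite !tensK_lmul_ox mulrDl oxDr.
- by rewrite !tensK_lmul_ox -scalerAl oxZl.
- by rewrite !tensK_lmul_ox -scalerAl oxZr.
Qed.

Lemma tensK_mul_oxl a b y : tensK_mul (a \ox b) y = tensK_lmul a b y.
Proof. exact: (liftK_ox (tensK_mul_bil y)). Qed.
Fact tensK_mulDl : left_distributive tensK_mul +%R.
Proof. by move=> x y z; exact: (liftKD (tensK_mul_bil z)). Qed.
Fact tensK_mulDr : right_distributive tensK_mul +%R.
Proof.
move=> x y z; move: x; apply: ox_ind => [|x x' IH IH'|a b].
- have m0 u : tensK_mul 0 u = 0.
    by apply: (@addrI _ (tensK_mul 0 u)); rewrite -tensK_mulDl !addr0.
  by rewrite !m0 addr0.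
- by rewrite !tensK_mulDl IH IH' addrACA.
- by rewrite !tensK_mul_oxl tensK_lmulD.
Qed.

Fact tensK_mulA : associative tensK_mul.
Proof.
move=> x y z; move: x; apply: ox_ext => [x x'|x x'|a b]; rewrite ?tensK_mulDl //.
move: y; apply: ox_ext => [y y'|y y'|a' b']; rewrite ?(tensK_mulDl, tensK_mulDr) //.
move: z; apply: ox_ext => [z z'|z z'|a'' b'']; rewrite ?tensK_mulDr //.
by rewrite !(tensK_mul_oxl, tensK_lmul_ox) !mulrA.
Qed.
Fact tensK_mul1 : left_id (1 \ox 1) tensK_mul.
Proof.
apply: ox_ext => [x y|//|a b]; first by rewrite tensK_mulDr.
by rewrite tensK_mul_oxl tensK_lmul_ox !mul1r.
Qed.
Fact tensK_mulr1 : right_id (1 \ox 1) tensK_mul.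
Proof.
apply: ox_ext => [x y|//|a b]; first by rewrite tensK_mulDl.
by rewrite tensK_mul_oxl tensK_lmul_ox !mulr1.
Qed.
Fact tensK_1neq0 : 1 \ox 1 != 0 :> A \OX B.
Proof.
have [f [fL f1]] := functional_eq1 (oner_neq0 A).
have [g [gL g1]] := functional_eq1 (oner_neq0 B).
have addL (V : lmodType K) (h : V -> K) :
    (forall a x y, h (a *: x + y) = a * h x + h y) -> {morph h : x y / x + y}.
  by move=> hL x y; rewrite -[x in LHS]scale1r hL mul1r.
have sclL (V : lmodType K) (h : V -> K) :
    (forall a x y, h (a *: x + y) = a * h x + h y) -> forall a x, h (a *: x) = a * h x.
  move=> hL a x; have hD := addL _ _ hL.
  by rewrite -[in LHS](addr0 (a *: x)) hL -[RHS]addr0; congr (_ + _);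
     apply: (@addrI _ (h 0)); rewrite -hD !addr0.
have fgP : is_bilinear (fun a b => (f a * g b : K^o)).
  split=> [x y z|x y z|c x y|c x y].
  - by rewrite (addL _ f) // mulrDl.
  - by rewrite (addL _ g) // mulrDr.
  - by rewrite (sclL _ f) // -mulrA.
  - by rewrite (sclL _ g) // mulrCA.
apply/eqP => /(congr1 (liftK (fun a b => (f a * g b : K^o)))).
rewrite (liftK_ox fgP) f1 g1 mul1r -[X in liftK _ X](scale0r (0 : A \OX B)).
by rewrite (liftKZ fgP) scale0r => /eqP; rewrite oner_eq0.
Qed.

HB.instance Definition _ := GRing.Zmodule_isNzRing.Build (A \OX B)
  tensK_mulA tensK_mul1 tensK_mulr1 tensK_mulDl tensK_mulDr tensK_1neq0.

Lemma oxM (a a' : A) (b b' : B) : (a \ox b) * (a' \ox b') = (a * a') \ox (b * b').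
Proof. by rewrite [LHS]tensK_mul_oxl tensK_lmul_ox. Qed.
Lemma ox1 : 1 \ox 1 = 1 :> A \OX B. Proof. by []. Qed.

Fact tensK_scaleAl (c : K) (x y : A \OX B) : c *: (x * y) = c *: x * y.
Proof. by rewrite [RHS](liftKZ (tensK_mul_bil y)). Qed.
HB.instance Definition _ := GRing.Lmodule_isLalgebra.Build K (A \OX B) tensK_scaleAl.
Fact tensK_scaleAr (c : K) (x y : A \OX B) : c *: (x * y) = x * (c *: y).
Proof.
move: x; apply: ox_ext => [x x'|x x'|a b].
- by rewrite mulrDl scalerDr.
- by rewrite mulrDl.
- by rewrite ![_ \ox _ * _]tensK_mul_oxl tensK_lmulZ.
Qed.
HB.instance Definition _ := GRing.Lalgebra_isAlgebra.Build K (A \OX B) tensK_scaleAr.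

End TensorAlgebra.

Section TensorAlgebraMaps.
Variable K : fieldType.

Section MultiplicativeLift.
Variables (A B C : algType K) (F : A -> B -> C).
Hypotheses (F_bil : is_bilinear F) (F1 : F 1 1 = 1).
Hypothesis FM : forall a a' b b', F (a * a') (b * b') = F a b * F a' b'.

Fact liftK_zmod : {morph liftK F : x y / x - y}.
Proof.
by move=> x y; rewrite -[in LHS](scaleN1r y) (liftKD F_bil) (liftKZ F_bil) scaleN1r.
Qed.
Fact liftK_scalable : scalable (liftK F).
Proof. exact: (liftKZ F_bil). Qed.
Fact liftK_monoid : GRing.monoid_morphism (liftK F).
Proof.
split=> [|x y]; first by rewrite -ox1 (liftK_ox F_bil) F1.
move: x; apply: ox_ext => [x x'|x x'|a b]; rewrite ?(mulrDl, liftKD F_bil) //=.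
move: y; apply: ox_ext => [y y'|y y'|a' b']; rewrite ?(mulrDr, liftKD F_bil) //=.
by rewrite oxM !(liftK_ox F_bil) FM.
Qed.
End MultiplicativeLift.

Section Map.
Variables (A A' B B' : algType K).
Variables (f : {lrmorphism A -> A'}) (g : {lrmorphism B -> B'}).

Definition mapK : A \OX B -> A' \OX B' := liftK (fun a b => f a \ox g b).

Fact mapK_bil : is_bilinear (fun a b => f a \ox g b).
Proof.
by split=> *; rewrite ?(rmorphD, linearZ) /= ?(oxDl, oxDr, oxZl, oxZr).
Qed.
Fact mapK_1 : f 1 \ox g 1 = 1. Proof. by rewrite !rmorph1. Qed.
Fact mapK_mul a a' b b' : f (a * a') \ox g (b * b') = (f a \ox g b) * (f a' \ox g b').
Proof. by rewrite !rmorphM oxM. Qed.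

HB.instance Definition _ :=
  GRing.isZmodMorphism.Build _ _ mapK (liftK_zmod mapK_bil).
HB.instance Definition _ :=
  GRing.isScalable.Build K _ _ _ mapK (liftK_scalable mapK_bil).
HB.instance Definition _ :=
  GRing.isMonoidMorphism.Build _ _ mapK (liftK_monoid mapK_bil mapK_1 mapK_mul).

Lemma mapK_ox a b : mapK (a \ox b) = f a \ox g b.
Proof. exact: (liftK_ox mapK_bil). Qed.
End Map.

Section Swap.
Variables A B : algType K.

Definition swapK : A \OX B -> B \OX A := liftK (fun a b => b \ox a).

Fact swapK_bil : is_bilinear (fun (a : A) (b : B) => b \ox a).
Proof. by split=> *; rewrite ?(oxDl, oxDr, oxZl, oxZr). Qed.
Fact swapK_mul (a a' : A) (b b' : B) : (b * b') \ox (a * a') = (b \ox a) * (b' \ox a').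
Proof. by rewrite oxM. Qed.

HB.instance Definition _ :=
  GRing.isZmodMorphism.Build _ _ swapK (liftK_zmod swapK_bil).
HB.instance Definition _ :=
  GRing.isScalable.Build K _ _ _ swapK (liftK_scalable swapK_bil).
HB.instance Definition _ :=
  GRing.isMonoidMorphism.Build _ _ swapK
    (liftK_monoid swapK_bil (erefl _) swapK_mul).

Lemma swapK_ox a b : swapK (a \ox b) = b \ox a.
Proof. exact: (liftK_ox swapK_bil). Qed.
End Swap.

Section Assoc.
Variables A B C : algType K.

(* a (x) (b (x) c) |-> (a (x) b) (x) c                                         *)
Definition assocK_at (a : A) : B \OX C -> (A \OX B) \OX C :=
  liftK (fun b c => (a \ox b) \ox c).
Definition assocK : A \OX (B \OX C) -> (A \OX B) \OX C := liftK assocK_at.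

Fact assocK_at_bil (a : A) : is_bilinear (fun (b : B) (c : C) => (a \ox b) \ox c).
Proof. by split=> *; rewrite ?(oxDl, oxDr, oxZl, oxZr). Qed.

Lemma assocK_at_ox a b c : assocK_at a (b \ox c) = (a \ox b) \ox c.
Proof. exact: (liftK_ox (assocK_at_bil a)). Qed.
Lemma assocK_atD a x y : assocK_at a (x + y) = assocK_at a x + assocK_at a y.
Proof. exact: (liftKD (assocK_at_bil a)). Qed.
Lemma assocK_atZ a k x : assocK_at a (k *: x) = k *: assocK_at a x.
Proof. exact: (liftKZ (assocK_at_bil a)). Qed.

Fact assocK_bil : is_bilinear assocK_at.
Proof.
split=> [a a' x|a x y|k a x|k a x].
- move: x; apply: ox_ext => [x y|x y|b c]; rewrite ?assocK_atD //.
    by rewrite addrACA.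
  by rewrite !assocK_at_ox !oxDl.
- exact: assocK_atD.
- move: x; apply: ox_ext => [x y|x y|b c]; rewrite ?assocK_atD //.
    by rewrite scalerDr.
  by rewrite !assocK_at_ox !oxZl.
- exact: assocK_atZ.
Qed.
Fact assocK_1 : assocK_at 1 1 = 1.
Proof. exact: assocK_at_ox. Qed.
Fact assocK_mul (a a' : A) (x y : B \OX C) :
  assocK_at (a * a') (x * y) = assocK_at a x * assocK_at a' y.
Proof.
move: x; apply: ox_ext => [x x'|x x'|b c]; rewrite ?(mulrDl, assocK_atD) //=.
move: y; apply: ox_ext => [y y'|y y'|b' c']; rewrite ?(mulrDr, assocK_atD) //=.
by rewrite oxM !assocK_at_ox !oxM.
Qed.

HB.instance Definition _ :=
  GRing.isZmodMorphism.Build _ _ assocK (liftK_zmod assocK_bil).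
HB.instance Definition _ :=
  GRing.isScalable.Build K _ _ _ assocK (liftK_scalable assocK_bil).
HB.instance Definition _ :=
  GRing.isMonoidMorphism.Build _ _ assocK
    (liftK_monoid assocK_bil assocK_1 assocK_mul).

Lemma assocK_ox a b c : assocK (a \ox (b \ox c)) = (a \ox b) \ox c.
Proof. by rewrite [LHS](liftK_ox assocK_bil) assocK_at_ox. Qed.
End Assoc.

End TensorAlgebraMaps.

(* The universal enveloping algebra: the K-algebra generated by L subject to   *)
(* linearity of the generators and xy - yx = [x, y], as a quotient of formal   *)
(* expressions.                                                                *)

Section EnvelopingAlgebra.
Variables (K : fieldType) (L : lieAlgType K).

Inductive uterm : Type :=
  | UZero
  | UOne
  | UAdd of uterm & uterm
  | UOpp of uterm
  | UScale of K & uterm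
  | UMul of uterm & uterm
  | UGen of L.

Inductive ueq : uterm -> uterm -> Prop :=
  | ueq_refl x : ueq x x
  | ueq_sym x y : ueq x y -> ueq y x
  | ueq_trans x y z : ueq x y -> ueq y z -> ueq x z
  | ueq_congD x x' y y' : ueq x x' -> ueq y y' -> ueq (UAdd x y) (UAdd x' y')
  | ueq_congN x x' : ueq x x' -> ueq (UOpp x) (UOpp x')
  | ueq_congZ a x x' : ueq x x' -> ueq (UScale a x) (UScale a x')
  | ueq_congM x x' y y' : ueq x x' -> ueq y y' -> ueq (UMul x y) (UMul x' y')
  | ueq_addA x y z : ueq (UAdd x (UAdd y z)) (UAdd (UAdd x y) z)
  | ueq_addC x y : ueq (UAdd x y) (UAdd y x)
  | ueq_add0 x : ueq (UAdd UZero x) x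
  | ueq_addN x : ueq (UAdd (UOpp x) x) UZero
  | ueq_scaleA a b x : ueq (UScale a (UScale b x)) (UScale (a * b) x)
  | ueq_scale1 x : ueq (UScale 1 x) x
  | ueq_scaleDr a x y : ueq (UScale a (UAdd x y)) (UAdd (UScale a x) (UScale a y))
  | ueq_scaleDl a b x : ueq (UScale (a + b) x) (UAdd (UScale a x) (UScale b x))
  | ueq_mulA x y z : ueq (UMul x (UMul y z)) (UMul (UMul x y) z)
  | ueq_mul1 x : ueq (UMul UOne x) x
  | ueq_mulr1 x : ueq (UMul x UOne) x
  | ueq_mulDl x y z : ueq (UMul (UAdd x y) z) (UAdd (UMul x z) (UMul y z))
  | ueq_mulDr x y z : ueq (UMul x (UAdd y z)) (UAdd (UMul x y) (UMul x z))
  | ueq_scaleAl a x y : ueq (UScale a (UMul x y)) (UMul (UScale a x) y)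
  | ueq_scaleAr a x y : ueq (UScale a (UMul x y)) (UMul x (UScale a y))
  | ueq_genD x y : ueq (UGen (x + y)) (UAdd (UGen x) (UGen y))
  | ueq_genZ a x : ueq (UGen (a *: x)) (UScale a (UGen x))
  | ueq_lie x y :
      ueq (UGen (lie x y))
          (UAdd (UMul (UGen x) (UGen y)) (UOpp (UMul (UGen y) (UGen x)))).

HB.instance Definition _ := gen_eqMixin uterm.
HB.instance Definition _ := gen_choiceMixin uterm.

Definition ueqb : rel uterm := fun x y => `[< ueq x y >].

Fact ueqb_refl : reflexive ueqb.
Proof. by move=> x; apply/asboolP/ueq_refl. Qed.
Fact ueqb_sym : symmetric ueqb.
Proof. by move=> x y; apply/asboolP/asboolP => /ueq_sym. Qed.
Fact ueqb_trans : transitive ueqb.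
Proof.
by move=> y x z /asboolP xy /asboolP yz; apply/asboolP/(ueq_trans xy yz).
Qed.

Canonical ueqb_equiv := EquivRel ueqb ueqb_refl ueqb_sym ueqb_trans.

Definition envAlg : Type := {eq_quot ueqb_equiv}.

HB.instance Definition _ := Choice.on envAlg.
HB.instance Definition _ := EqQuotient.on envAlg.

Lemma ueqP x y : reflect (\pi_envAlg x = \pi_envAlg y) `[< ueq x y >].
Proof. exact: (@eqquotP _ _ envAlg). Qed.
Lemma upi x y : ueq x y -> \pi_envAlg x = \pi_envAlg y.
Proof. by move=> xy; apply/ueqP/asboolP. Qed.
Lemma ueq_repr x : ueq (repr (\pi_envAlg x)) x.
Proof. by apply/asboolP/ueqP; rewrite reprK. Qed.

Definition env0 : envAlg := \pi_envAlg UZero.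
Definition env1 : envAlg := \pi_envAlg UOne.
Definition env_add (x y : envAlg) : envAlg := \pi_envAlg (UAdd (repr x) (repr y)).
Definition env_opp (x : envAlg) : envAlg := \pi_envAlg (UOpp (repr x)).
Definition env_scale a (x : envAlg) : envAlg := \pi_envAlg (UScale a (repr x)).
Definition env_mul (x y : envAlg) : envAlg := \pi_envAlg (UMul (repr x) (repr y)).
Definition env_gen (x : L) : envAlg := \pi_envAlg (UGen x).

Lemma env_addE x y : env_add (\pi_envAlg x) (\pi_envAlg y) = \pi_envAlg (UAdd x y).
Proof. by apply/upi/ueq_congD; exact: ueq_repr. Qed.
Lemma env_oppE x : env_opp (\pi_envAlg x) = \pi_envAlg (UOpp x).
Proof. by apply/upi/ueq_congN; exact: ueq_repr. Qed.
Lemma env_scaleE a x : env_scale a (\pi_envAlg x) = \pi_envAlg (UScale a x).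
Proof. by apply/upi/ueq_congZ; exact: ueq_repr. Qed.
Lemma env_mulE x y : env_mul (\pi_envAlg x) (\pi_envAlg y) = \pi_envAlg (UMul x y).
Proof. by apply/upi/ueq_congM; exact: ueq_repr. Qed.

Fact env_addA : associative env_add.
Proof.
elim/quotW=> x; elim/quotW=> y; elim/quotW=> z.
rewrite (env_addE y) (env_addE x y) (env_addE x) (env_addE (UAdd x y)).
exact/upi/ueq_addA.
Qed.
Fact env_addC : commutative env_add.
Proof.
elim/quotW=> x; elim/quotW=> y; rewrite (env_addE x) (env_addE y).
exact/upi/ueq_addC.
Qed.
Fact env_add0 : left_id env0 env_add.
Proof. by elim/quotW=> x; rewrite env_addE; exact/upi/ueq_add0. Qed.
Fact env_addN : left_inverse env0 env_opp env_add.
Proof.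
by elim/quotW=> x; rewrite (env_oppE x) (env_addE (UOpp x)); exact/upi/ueq_addN.
Qed.

HB.instance Definition _ :=
  GRing.isZmodule.Build envAlg env_addA env_addC env_add0 env_addN.

Fact env_scaleA a b x : env_scale a (env_scale b x) = env_scale (a * b) x.
Proof.
elim/quotW: x => x; rewrite (env_scaleE b x) (env_scaleE a) (env_scaleE _ x).
exact/upi/ueq_scaleA.
Qed.
Fact env_scale1 : left_id 1 env_scale.
Proof. by elim/quotW=> x; rewrite (env_scaleE 1 x); exact/upi/ueq_scale1. Qed.
Fact env_scaleDr : right_distributive env_scale +%R.
Proof.
move=> a; elim/quotW=> x; elim/quotW=> y.
rewrite -[_ + _]/(env_add _ _) -[X in _ = X]/(env_add _ _).
rewrite (env_addE x) (env_scaleE a x) (env_scaleE a y) (env_scaleE a).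
by rewrite (env_addE (UScale a x)); exact/upi/ueq_scaleDr.
Qed.
Fact env_scaleDl x : {morph env_scale^~ x : a b / a + b}.
Proof.
move=> a b; elim/quotW: x => x; rewrite !(env_scaleE _ x).
by rewrite [RHS]env_addE; exact/upi/ueq_scaleDl.
Qed.

HB.instance Definition _ := GRing.Zmodule_isLmodule.Build K envAlg
  env_scaleA env_scale1 env_scaleDr env_scaleDl.

Fact env_mulA : associative env_mul.
Proof.
elim/quotW=> x; elim/quotW=> y; elim/quotW=> z.
rewrite (env_mulE y) (env_mulE x y) (env_mulE x) (env_mulE (UMul x y)).
exact/upi/ueq_mulA.
Qed.
Fact env_mul1 : left_id env1 env_mul.
Proof. by elim/quotW=> x; rewrite env_mulE; exact/upi/ueq_mul1. Qed.
Fact env_mulr1 : right_id env1 env_mul.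
Proof. by elim/quotW=> x; rewrite env_mulE; exact/upi/ueq_mulr1. Qed.
Fact env_mulDl : left_distributive env_mul +%R.
Proof.
elim/quotW=> x; elim/quotW=> y; elim/quotW=> z.
rewrite (env_mulE x z) (env_mulE y z) [RHS]env_addE.
by rewrite -[_ + _]/(env_add _ _) (env_addE x y) env_mulE; exact/upi/ueq_mulDl.
Qed.
Fact env_mulDr : right_distributive env_mul +%R.
Proof.
elim/quotW=> x; elim/quotW=> y; elim/quotW=> z.
rewrite (env_mulE x y) (env_mulE x z) [RHS]env_addE.
by rewrite -[_ + _]/(env_add _ _) (env_addE y z) env_mulE; exact/upi/ueq_mulDr.
Qed.

Section Eval.
Variables (A : algType K) (f : L -> A).

Fixpoint ueval (x : uterm) : A :=
  match x with
  | UZero => 0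
  | UOne => 1
  | UAdd x y => ueval x + ueval y
  | UOpp x => - ueval x
  | UScale a x => a *: ueval x
  | UMul x y => ueval x * ueval y
  | UGen x => f x
  end.

Definition lie_rep : Prop :=
  [/\ forall x y, f (x + y) = f x + f y,
      forall a x, f (a *: x) = a *: f x
    & forall x y, f (lie x y) = f x * f y - f y * f x].

(* The algebra morphism extending f; only meaningful when [lie_rep] holds.     *)
Definition env_lift (x : envAlg) : A := ueval (repr x).

Hypothesis fP : lie_rep.

Lemma ueval_ueq x y : ueq x y -> ueval x = ueval y.
Proof.
case: fP => fD fZ fL; elim=> //=.
- by move=> ? ? ? _ -> _ ->.
- by move=> ? ? ? ? _ -> _ ->.
- by move=> ? ? _ ->.
- by move=> ? ? ? _ ->.
- by move=> ? ? ? ? _ -> _ ->.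
- by move=> *; rewrite addrA.
- by move=> *; rewrite addrC.
- by move=> *; rewrite add0r.
- by move=> *; rewrite addNr.
- by move=> *; rewrite scalerA.
- by move=> *; rewrite scale1r.
- by move=> *; rewrite scalerDr.
- by move=> *; rewrite scalerDl.
- by move=> *; rewrite mulrA.
- by move=> *; rewrite mul1r.
- by move=> *; rewrite mulr1.
- by move=> *; rewrite mulrDl.
- by move=> *; rewrite mulrDr.
- by move=> *; rewrite scalerAl.
- by move=> *; rewrite scalerAr.
Qed.

Lemma env_lift_pi x : env_lift (\pi_envAlg x) = ueval x.
Proof. by apply: ueval_ueq; exact: ueq_repr. Qed.

End Eval.

Fact env_1neq0 : env1 != 0.
Proof.
have rP : lie_rep (fun _ : L => (0 : K^o)).
  by split=> *; rewrite ?(addr0, scaler0, mulr0, subrr).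
apply/eqP => /(congr1 (env_lift (fun _ => (0 : K^o)))).
by rewrite !(env_lift_pi rP) /= => /eqP; rewrite oner_eq0.
Qed.

HB.instance Definition _ := GRing.Zmodule_isNzRing.Build envAlg
  env_mulA env_mul1 env_mulr1 env_mulDl env_mulDr env_1neq0.

Fact env_scaleAl (a : K) (x y : envAlg) : a *: (x * y) = a *: x * y.
Proof.
elim/quotW: x => x; elim/quotW: y => y.
rewrite -[_ * _]/(env_mul _ _) -[X in _ = X]/(env_mul _ _).
rewrite -[_ *: _]/(env_scale _ _) -[a *: \pi_envAlg x]/(env_scale _ _).
rewrite (env_mulE x y) (env_scaleE a x) (env_scaleE a) (env_mulE (UScale a x)).
exact/upi/ueq_scaleAl.
Qed.
HB.instance Definition _ := GRing.Lmodule_isLalgebra.Build K envAlg env_scaleAl.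

Fact env_scaleAr (a : K) (x y : envAlg) : a *: (x * y) = x * (a *: y).
Proof.
elim/quotW: x => x; elim/quotW: y => y.
rewrite -[_ * _]/(env_mul _ _) -[X in _ = X]/(env_mul _ _).
rewrite -[_ *: _]/(env_scale _ _) -[a *: \pi_envAlg y]/(env_scale _ _).
rewrite (env_mulE x y) (env_scaleE a y) (env_scaleE a) (env_mulE x).
exact/upi/ueq_scaleAr.
Qed.
HB.instance Definition _ := GRing.Lalgebra_isAlgebra.Build K envAlg env_scaleAr.

Lemma env_genD x y : env_gen (x + y) = env_gen x + env_gen y.
Proof. by rewrite [RHS]env_addE; exact/upi/ueq_genD. Qed.
Lemma env_genZ a x : env_gen (a *: x) = a *: env_gen x.
Proof. by rewrite [RHS](env_scaleE a); exact/upi/ueq_genZ. Qed.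
Lemma env_gen_lie x y :
  env_gen (lie x y) = env_gen x * env_gen y - env_gen y * env_gen x.
Proof.
have -> : env_gen x * env_gen y = \pi_envAlg (UMul (UGen x) (UGen y)).
  by rewrite [LHS]env_mulE.
have -> : env_gen y * env_gen x = \pi_envAlg (UMul (UGen y) (UGen x)).
  by rewrite [LHS]env_mulE.
have -> z : - \pi_envAlg z = \pi_envAlg (UOpp z) by rewrite [LHS]env_oppE.
by rewrite [RHS]env_addE; exact/upi/ueq_lie.
Qed.

Lemma env_ind (P : envAlg -> Prop) :
  P 1 -> (forall x y, P x -> P y -> P (x + y)) ->
  (forall a x, P x -> P (a *: x)) ->
  (forall x y, P x -> P y -> P (x * y)) -> (forall x, P (env_gen x)) ->
  forall x, P x.
Proof.
move=> P1 PD PZ PM Pg; elim/quotW; elim=> [||x Px y Py|x Px|a x Px|x Px y Py|//].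
- by rewrite -[\pi_envAlg _]/(0 : envAlg) -(scale0r 1); exact: PZ.
- exact: P1.
- by rewrite -(env_addE x y); exact: PD.
- by rewrite -(env_oppE x) -[env_opp _]/(- (\pi_envAlg x)) -scaleN1r; exact: PZ.
- by rewrite -(env_scaleE a x); exact: PZ.
- by rewrite -(env_mulE x y); exact: PM.
Qed.

Section Universal.
Variables (A : algType K) (f : L -> A).
Hypothesis fP : lie_rep f.

Lemma env_lift_gen x : env_lift f (env_gen x) = f x.
Proof. exact: (env_lift_pi fP). Qed.
Lemma env_lift_zmod : {morph env_lift f : x y / x - y}.
Proof.
elim/quotW=> x; elim/quotW=> y.
have -> : \pi_envAlg x - \pi_envAlg y = \pi_envAlg (UAdd x (UOpp y)).
  by rewrite -[- _]/(env_opp _) (env_oppE y) [LHS]env_addE.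
by rewrite !(env_lift_pi fP).
Qed.
Lemma env_lift_scalable : scalable (env_lift f).
Proof.
move=> a; elim/quotW=> x; rewrite -[a *: \pi_envAlg x]/(env_scale _ _) env_scaleE.
by rewrite !(env_lift_pi fP).
Qed.
Lemma env_lift_monoid : GRing.monoid_morphism (env_lift f).
Proof.
split; first exact: (env_lift_pi fP).
elim/quotW=> x; elim/quotW=> y; rewrite -[\pi_envAlg x * _]/(env_mul _ _) env_mulE.
by rewrite !(env_lift_pi fP).
Qed.
End Universal.

Lemma env_ext (A : algType K) (f g : {lrmorphism envAlg -> A}) :
  (forall x, f (env_gen x) = g (env_gen x)) -> f =1 g.
Proof.
move=> fg; apply: env_ind => [|x y fx fy|a x fx|x y fx fy|//].
- by rewrite !rmorph1.
- by rewrite !rmorphD /= fx fy.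
- by rewrite !linearZ_LR /= fx.
- by rewrite !rmorphM /= fx fy.
Qed.

End EnvelopingAlgebra.

Notation "''U' ( L )" := (envAlg L) (at level 8, format "''U' ( L )") : type_scope.

(* The coproduct of H = U(L), with H^(x)3 realized as (H (x) H) (x) H.         *)

Notation UU L := ('U(L) \OX 'U(L)).
Notation UUU L := ((UU L) \OX 'U(L)).

Section Coproduct.
Variables (K : fieldType) (L : lieAlgType K).
Local Notation H := 'U(L).

Definition primitive2 (x : L) : UU L := env_gen x \ox 1 + 1 \ox env_gen x.

Fact primitive2_rep : lie_rep primitive2.
Proof.
split=> [x y|a x|x y]; rewrite /primitive2.
- by rewrite env_genD oxDl oxDr addrACA.
- by rewrite env_genZ oxZl oxZr scalerDr.
- rewrite !mulrDl !mulrDr !oxM !(mul1r, mulr1) env_gen_lie.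
  have oxN1 (u : H) : (- u) \ox (1 : H) = - (u \ox 1) by exact: pureNl.
  have ox1N (u : H) : (1 : H) \ox (- u) = - (1 \ox u) by exact: pureNr.
  rewrite oxDl oxDr oxN1 ox1N.
  move: (_ \ox 1) (_ \ox 1) (1 \ox _) (1 \ox _) => a a' d d'.
  move: (_ \ox _) (_ \ox _) => b c.
  rewrite !opprD -!addrA; congr (a' + _).
  rewrite (addrCA (- a) (- b)) (addrCA d' (- b)) (addrA b) subrr add0r.
  rewrite (addrCA (- a) (- c)) (addrCA d' (- c)) (addrA c) subrr add0r.
  exact: addrCA.
Qed.

Definition Delta : H -> UU L := env_lift primitive2.

HB.instance Definition _ :=
  GRing.isZmodMorphism.Build _ _ Delta (env_lift_zmod primitive2_rep).
HB.instance Definition _ :=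
  GRing.isScalable.Build K _ _ _ Delta (env_lift_scalable primitive2_rep).
HB.instance Definition _ :=
  GRing.isMonoidMorphism.Build _ _ Delta (env_lift_monoid primitive2_rep).

Lemma Delta_gen x : Delta (env_gen x) = env_gen x \ox 1 + 1 \ox env_gen x.
Proof. exact: (env_lift_gen primitive2_rep). Qed.

Definition Delta_id : UU L -> UUU L := mapK Delta idfun.
HB.instance Definition _ := GRing.LRMorphism.on Delta_id.

Definition id_Delta : UU L -> UUU L := @assocK K H H H \o mapK idfun Delta.
HB.instance Definition _ := GRing.LRMorphism.on id_Delta.

Definition Delta3 : H -> UUU L := Delta_id \o Delta.
HB.instance Definition _ := GRing.LRMorphism.on Delta3.

(* beta (x) 1, 1 (x) beta and the permutation (12) in H^(x)3                   *)
Definition ox_1r (b : UU L) : UUU L := b \ox 1.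
Definition ox_1l (b : UU L) : UUU L := assocK (1 \ox b).
Definition swap12 : UUU L -> UUU L := mapK (@swapK K H H) idfun.
HB.instance Definition _ := GRing.LRMorphism.on swap12.

Lemma Delta_id_ox f g : Delta_id (f \ox g) = Delta f \ox g.
Proof. exact: mapK_ox. Qed.
Lemma id_Delta_ox f g : id_Delta (f \ox g) = assocK (f \ox Delta g).
Proof. by rewrite /id_Delta /= mapK_ox. Qed.
Lemma ox_1l_ox f g : ox_1l (f \ox g) = (1 \ox f) \ox g.
Proof. exact: assocK_ox. Qed.
Lemma swap12_ox f h g : swap12 ((f \ox h) \ox g) = (h \ox f) \ox g.
Proof. by rewrite [LHS]mapK_ox /= swapK_ox. Qed.

Lemma ox_1rM b c : ox_1r (b * c) = ox_1r b * ox_1r c.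
Proof. by rewrite /ox_1r oxM mulr1. Qed.
Lemma ox_1lM b c : ox_1l (b * c) = ox_1l b * ox_1l c.
Proof. by rewrite /ox_1l -rmorphM oxM mulr1. Qed.
Lemma ox_1rD b c : ox_1r (b + c) = ox_1r b + ox_1r c.
Proof. exact: oxDl. Qed.
Lemma ox_1lD b c : ox_1l (b + c) = ox_1l b + ox_1l c.
Proof. by rewrite /ox_1l oxDr rmorphD. Qed.

Lemma coassoc h : id_Delta (Delta h) = Delta3 h.
Proof.
have e := @env_ext K L _ (id_Delta \o Delta) Delta3; apply: e => x /=.
rewrite /Delta3 /= Delta_gen !rmorphD /= !id_Delta_ox !Delta_id_ox.
rewrite !Delta_gen rmorph1 oxDl oxDr rmorphD /= !assocK_ox.
by rewrite addrA.
Qed.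

Lemma swap12_Delta3 h : swap12 (Delta3 h) = Delta3 h.
Proof.
have e := @env_ext K L _ (swap12 \o Delta3) Delta3; apply: e => x /=.
rewrite /Delta3 /= Delta_gen !rmorphD /= !Delta_id_ox Delta_gen rmorph1.
by rewrite oxDl rmorphD /= -ox1 !swap12_ox (addrC (_ \ox _ \ox _)).
Qed.

End Coproduct.

(* B (x)_H N, where H acts on the right of B through phi : H -> B.             *)

Section BaseChange.
Variables (H B : nzRingType) (phi : {rmorphism H -> B}) (N : lmodType H).

Definition tensH : Type :=
  tensor (fun (b : B) (h : H) => b * phi h) (fun (h : H) (n : N) => h *: n).

HB.instance Definition _ := GRing.Zmodule.on tensH.

Definition pureH (b : B) (n : N) : tensH := pure _ _ b n.

Lemma pureH_balanced b h n : pureH (b * phi h) n = pureH b (h *: n).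
Proof. exact: pure_balanced. Qed.

Definition tensH_scale (c : B) : tensH -> tensH := tlift (fun b n => pureH (c * b) n).

Fact tensH_scale_bal c :
  balanced_biadditive (fun (b : B) (h : H) => b * phi h)
    (fun (h : H) (n : N) => h *: n) (fun b n => pureH (c * b) n).
Proof.
split=> [b b' n|b n n'|b h n].
- by rewrite mulrDr [LHS]pureDl.
- by rewrite [LHS]pureDr.
- by rewrite mulrA pureH_balanced.
Qed.

Lemma tensH_scale_pure c b n : tensH_scale c (pureH b n) = pureH (c * b) n.
Proof. exact: (tlift_pure (tensH_scale_bal c)). Qed.
Fact tensH_scaleDr : right_distributive tensH_scale +%R.
Proof. by move=> c x y; exact: (tliftD (tensH_scale_bal c)). Qed.
Fact tensH_scaleA c d x : tensH_scale c (tensH_scale d x) = tensH_scale (c * d) x.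
Proof.
move: x; apply: tensor_ext => [x y|x y|b n]; rewrite ?tensH_scaleDr //.
by rewrite -[pure _ _ _ _]/(pureH b n) !tensH_scale_pure mulrA.
Qed.
Fact tensH_scale1 : left_id 1 tensH_scale.
Proof.
apply: tensor_ext => [x y|x y|b n]; rewrite ?tensH_scaleDr //.
by rewrite -[pure _ _ _ _]/(pureH b n) !tensH_scale_pure mul1r.
Qed.
Fact tensH_scaleDl x : {morph tensH_scale^~ x : c d / c + d}.
Proof.
move=> c d /=; move: x; apply: tensor_ext => [x y|x y|b n].
- by rewrite tensH_scaleDr.
- by rewrite !tensH_scaleDr addrACA.
- rewrite -[pure _ _ _ _]/(pureH b n) !tensH_scale_pure mulrDl.
  exact: pureDl.
Qed.

HB.instance Definition _ := GRing.Zmodule_isLmodule.Build B tensH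
  tensH_scaleA tensH_scale1 tensH_scaleDr tensH_scaleDl.

Lemma pureH_scale c b n : c *: pureH b n = pureH (c * b) n.
Proof. exact: tensH_scale_pure. Qed.
Lemma pureHDl b b' n : pureH (b + b') n = pureH b n + pureH b' n.
Proof. exact: pureDl. Qed.
Lemma pureHDr b n n' : pureH b (n + n') = pureH b n + pureH b n'.
Proof. exact: pureDr. Qed.
Lemma tensH_ind (Q : tensH -> Prop) :
  Q 0 -> (forall x y, Q x -> Q y -> Q (x + y)) -> (forall b n, Q (pureH b n)) ->
  forall x, Q x.
Proof. exact: tensor_ind. Qed.
Lemma tensH_ext (Z : zmodType) (f g : tensH -> Z) :
  {morph f : x y / x + y} -> {morph g : x y / x + y} ->
  (forall b n, f (pureH b n) = g (pureH b n)) -> f =1 g.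
Proof. exact: tensor_ext. Qed.

End BaseChange.

(* psi (x)_H id                                                                *)
Section BaseChangeMap.
Variables (H B C : nzRingType) (phi : {rmorphism H -> B}) (chi : {rmorphism H -> C}).
Variables (psi : {rmorphism B -> C}) (N : lmodType H).

Definition mapH : tensH phi N -> tensH chi N := tlift (fun b n => pureH chi (psi b) n).

Hypothesis psiP : forall h, psi (phi h) = chi h.

Let mapH_bal :
  balanced_biadditive (fun (b : B) (h : H) => b * phi h)
    (fun (h : H) (n : N) => h *: n) (fun b n => pureH chi (psi b) n).
Proof.
split=> [b b' n|b n n'|b h n].
- by rewrite rmorphD pureHDl.
- by rewrite pureHDr.
- by rewrite rmorphM psiP pureH_balanced.
Qed.

Lemma mapH_pure b n : mapH (pureH phi b n) = pureH chi (psi b) n.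
Proof. exact: (tlift_pure mapH_bal). Qed.
Lemma mapHD x y : mapH (x + y) = mapH x + mapH y.
Proof. exact: (tliftD mapH_bal). Qed.
Lemma mapHZ c x : mapH (c *: x) = psi c *: mapH x.
Proof.
move: x; apply: tensH_ext => [x y|x y|b n].
- by rewrite scalerDr mapHD.
- by rewrite mapHD scalerDr.
- by rewrite pureH_scale !mapH_pure rmorphM pureH_scale.
Qed.

End BaseChangeMap.


Section Pseudoalgebra.
Variables (K : fieldType) (L : lieAlgType K).
Local Notation H := 'U(L).

Definition UU_tens (A : lmodType H) : Type := tensH (@Delta K L) A.
Definition UUU_tens (A : lmodType H) : Type := tensH (@Delta3 K L) A.

HB.instance Definition _ (A : lmodType H) := GRing.Lmodule.on (UU_tens A).
HB.instance Definition _ (A : lmodType H) := GRing.Lmodule.on (UUU_tens A).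

Definition oxH2 (A : lmodType H) (b : UU L) (x : A) : UU_tens A := pureH _ b x.

(* (h (x) g (x)_H 1)(x * y) is the left action of h (x) g on                   *)
(* (H (x) H) (x)_H A.  K-bilinearity is the case h, g \in K of [pprodZ].       *)
Record pseudoproduct (A : lmodType H) : Type := Pseudoproduct {
  pprod :> A -> A -> UU_tens A;
  pprodDl : forall x x' y, pprod (x + x') y = pprod x y + pprod x' y;
  pprodDr : forall x y y', pprod x (y + y') = pprod x y + pprod x y';
  pprodZ : forall (h g : H) x y, pprod (h *: x) (g *: y) = (h \ox g) *: pprod x y
}.

Section PreLie.
Variables (A : lmodType H) (star : pseudoproduct A).

Definition Delta_idH : UU_tens A -> UUU_tens A :=
  mapH (@Delta3 K L) (@Delta_id K L) (N := A).
Definition id_DeltaH : UU_tens A -> UUU_tens A :=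
  mapH (@Delta3 K L) (@id_Delta K L) (N := A).
Definition swap12H : UUU_tens A -> UUU_tens A :=
  mapH (@Delta3 K L) (@swap12 K L) (N := A).

(* (beta (x)_H x) * y and x * (beta (x)_H y), see [pprod_l_pure] and           *)
(* [pprod_r_pure].                                                             *)
Definition pprod_l (w : UU_tens A) (y : A) : UUU_tens A :=
  tlift (fun b x => ox_1r b *: Delta_idH (star x y)) w.
Definition pprod_r (x : A) (w : UU_tens A) : UUU_tens A :=
  tlift (fun b y => ox_1l b *: id_DeltaH (star x y)) w.

Definition left_prelie : Prop := forall x y z : A,
  pprod_l (star x y) z - pprod_r x (star y z) =
  swap12H (pprod_l (star y x) z - pprod_r y (star x z)).

Lemma Delta_idHD w w' : Delta_idH (w + w') = Delta_idH w + Delta_idH w'.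
Proof. by apply: mapHD. Qed.
Lemma Delta_idHZ b w : Delta_idH (b *: w) = Delta_id b *: Delta_idH w.
Proof. by apply: mapHZ. Qed.
Lemma Delta_idH_pure b x : Delta_idH (oxH2 b x) = pureH _ (Delta_id b) x.
Proof. by apply: mapH_pure. Qed.
Lemma id_DeltaHD w w' : id_DeltaH (w + w') = id_DeltaH w + id_DeltaH w'.
Proof. by apply: mapHD => h; exact: coassoc. Qed.
Lemma id_DeltaHZ b w : id_DeltaH (b *: w) = id_Delta b *: id_DeltaH w.
Proof. by apply: mapHZ => h; exact: coassoc. Qed.
Lemma id_DeltaH_pure b x : id_DeltaH (oxH2 b x) = pureH _ (id_Delta b) x.
Proof. by apply: mapH_pure => h; exact: coassoc. Qed.
Lemma swap12HD w w' : swap12H (w + w') = swap12H w + swap12H w'.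
Proof. by apply: mapHD => h; exact: swap12_Delta3. Qed.
Lemma swap12H_pure b x : swap12H (pureH _ b x) = pureH _ (swap12 b) x.
Proof. by apply: mapH_pure => h; exact: swap12_Delta3. Qed.

Let pprod_l_bal y :
  balanced_biadditive (fun (b : UU L) (h : H) => b * Delta h)
    (fun (h : H) (x : A) => h *: x) (fun b x => ox_1r b *: Delta_idH (star x y)).
Proof.
split=> [b b' x|b x x'|b h x].
- by rewrite ox_1rD scalerDl.
- by rewrite pprodDl Delta_idHD scalerDr.
- rewrite -[y in RHS]scale1r pprodZ Delta_idHZ Delta_id_ox scalerA.
  by rewrite -[Delta h \ox 1]/(ox_1r _) -ox_1rM.
Qed.

Let pprod_r_bal x :
  balanced_biadditive (fun (b : UU L) (h : H) => b * Delta h)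
    (fun (h : H) (y : A) => h *: y) (fun b y => ox_1l b *: id_DeltaH (star x y)).
Proof.
split=> [b b' y|b y y'|b h y].
- by rewrite ox_1lD scalerDl.
- by rewrite pprodDr id_DeltaHD scalerDr.
- rewrite -[x in RHS]scale1r pprodZ id_DeltaHZ id_Delta_ox scalerA.
  by rewrite -[assocK _]/(ox_1l _) -ox_1lM.
Qed.

Lemma pprod_l_pure b x y :
  pprod_l (oxH2 b x) y = ox_1r b *: Delta_idH (star x y).
Proof. exact: (tlift_pure (pprod_l_bal y)). Qed.
Lemma pprod_lD w w' y : pprod_l (w + w') y = pprod_l w y + pprod_l w' y.
Proof. exact: (tliftD (pprod_l_bal y)). Qed.
Lemma pprod_r_pure x b y :
  pprod_r x (oxH2 b y) = ox_1l b *: id_DeltaH (star x y).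
Proof. exact: (tlift_pure (pprod_r_bal x)). Qed.
Lemma pprod_rD x w w' : pprod_r x (w + w') = pprod_r x w + pprod_r x w'.
Proof. exact: (tliftD (pprod_r_bal x)). Qed.

End PreLie.
End Pseudoalgebra.

Notation "b \oxH x" := (oxH2 b x) (at level 41) : ring_scope.

Definition free_basis2 (R : nzRingType) (A : lmodType R) (e1 e2 : A) : Prop :=
  forall x, exists! c : R * R, x = c.1 *: e1 + c.2 *: e2.

(* Main.v *)
Require Import Defs.
From HB Require Import structures.
From mathcomp Require Import all_boot all_order all_algebra.
From mathcomp Require boolp.
From mathcomp Require Import ring zify.
From mathcomp.multinomials Require Import ssrcomplements mpoly.
Import GRing.Theory.

Set Implicit Arguments.
Unset Strict Implicit.
Unset Printing Implicit Defensive.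

Local Open Scope ring_scope.

(** Write [e1 * e2 = A e1 + B e2] and [e2 * e1 = C e1 + D e2] with [A, B, C, D] in
[H \OX H]. The associator is [H]-trilinear, so the pre-Lie identity only has
to hold on [e1] and [e2] ([left_prelie_coef]); comparing coefficients turns it
into the eight equations of [prelie_system] in [H \OX H \OX H]
([prelie_systemP]). Substituting the four types into these equations proves
that they are pre-Lie.

For the converse one needs to compare degrees in each tensor factor. By the
Poincare-Birkhoff-Witt theorem, [H] has the polynomials as a basis in such a
way that leading terms multiply as polynomials do ([symbM_lead]). Taking
coefficients in an algebra [A], this gives the elements of [A \OX H] a degree
in the last factor ([zdeg]). It is additive as soon as [A] has no zero divisors
([zdegM]), whence [H], [H \OX H] and [H \OX H \OX H] have none. Three
facts do most of the work: [Delta h] and [1 \ox h] have the same leading part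
([zdeg_Delta_lead]), elements of degree [0] have the form [a \ox 1]
([zdeg_leq1]), and the factors can be permuted so that any of them is the last.

Write [w_12], [w_23] for [w] placed in these two of three factors. The solution
then runs as follows, where an equation is named by the three basis vectors
put into the identity.
- (1,1,2), coefficient of [e2]: [B_23 (id (x) Delta) B] is symmetric in the
  first two factors. It has degree [deg_1 B] in the first and
  [deg_1 B + deg_2 B] in the second, so [B = b \ox 1] ([B_first_slot]).
- (1,2,1), coefficient of [e2]: one term has degree [2 deg_1 D] in the middle
  factor and all others at most [deg_1 D], so [D = 1 \ox d]
  ([D_last_slot]). What remains is [d \ox d = t Delta d], and the degree
  in the last factor of [(d - t) \ox d] leaves [d = 0] or [d = t]
  ([D_scalar]).
- (1,2,2), coefficient of [e2], then gives two relations between [A], [b] and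
  [C] ([A_C_from_B]).
- Case [d = 0]. The relations give [b = 0], and (1,1,2) makes [A_23]
  symmetric, so [A = 1 \ox a]. Next, [C = a \ox 1 + c] with [c] primitive
  in the last factor and [a \ox a + (1 \ox a) c = (1 \ox s) Delta a]
  ([D0_shape]). If [a <> 0], leading terms give [c = 1 \ox s], then [a = s],
  the fourth type ([D0_A_neq0]). If [a = 0], then (2,2,1) leaves [c = 0] or
  [c = 1 \ox s], the first two types ([D0_A_eq0]).
- Case [d = t]. Here [C = 1 \ox c] and [b = 0] or [b = t]. If [b = 0],
  then [c = - s], against (2,2,1) ([Dt_B0_absurd]). If [b = t], then
  [A = a \ox 1] and [c = s + 2 a] is primitive; (2,2,1) leaves [c = s],
  that is [2 a = 0], or [c = 0], where (1,2,2) gives [a = 0] as well; this is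
  the third type ([Dt_Bt_A0], [Dt_solution]). *)

(** * Polynomials and their monomials *)

Section LinearExtension.
Variables (K : fieldType) (n : nat) (W : lmodType K).
Implicit Types (f g : 'X_{1..n} -> W) (p q : {mpoly K[n]}).

Definition lext f p : W := \sum_(m <- msupp p) p@_m *: f m.

Lemma lextE f p k : (msize p <= k)%N ->
  lext f p = \sum_(m : 'X_{1..n < k}) p@_m *: f m.
Proof.
move=> lpk; rewrite /lext (big_mksub ('X_{1..n < k} : subFinType _)) //=.
- by rewrite big_rmcond //= => m /memN_msupp_eq0 ->; rewrite scale0r.
- exact: msupp_uniq.
- by move=> m /msize_mdeg_lt /leq_trans; apply.
Qed.

Lemma lext_is_linear f : linear (lext f).
Proof.
move=> a p q; pose k := maxn (msize (a *: p + q)) (maxn (msize p) (msize q)).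
rewrite !(@lextE f _ k) ?leq_max ?leqnn ?orbT // scaler_sumr -big_split /=.
by apply: eq_bigr => m _; rewrite mcoeffD mcoeffZ scalerDl scalerA.
Qed.
HB.instance Definition _ f :=
  GRing.isLinear.Build K {mpoly K[n]} W _ (lext f) (lext_is_linear f).

Lemma lextX f m : lext f 'X_[m] = f m.
Proof. by rewrite /lext msuppX big_seq1 mcoeffX eqxx scale1r. Qed.

Lemma eq_lext f g p :
  (forall m, (mdeg m < msize p)%N -> f m = g m) -> lext f p = lext g p.
Proof.
move=> fg; rewrite /lext big_seq [RHS]big_seq.
by apply: eq_bigr => m /msize_mdeg_lt /fg ->.
Qed.

Lemma linear_mpoly_ext (F G : {mpoly K[n]} -> W) p : linear F -> linear G ->
  (forall m, (mdeg m < msize p)%N -> F 'X_[m] = G 'X_[m]) -> F p = G p.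
Proof.
move=> FL GL FG.
have sumE (h : {mpoly K[n]} -> W) : linear h -> h p = \sum_(m <- msupp p) p@_m *: h 'X_[m].
  move=> hL; rewrite {1}(mpolyE p); elim/big_rec2: _ => [|m x q _ <-]; last exact: hL.
  by have := hL (-1) 0 0; rewrite scaler0 addr0 scaleN1r addNr.
rewrite !sumE // big_seq [RHS]big_seq.
by apply: eq_bigr => m /msize_mdeg_lt /FG ->.
Qed.

End LinearExtension.

Section MonomialSize.
Variables (R : nzRingType) (n : nat).
Implicit Types (p q : {mpoly R[n]}) (k : nat).

Lemma msizeD_leq p q k : (msize p <= k)%N -> (msize q <= k)%N -> (msize (p + q) <= k)%N.
Proof. by move=> pk qk; rewrite (leq_trans (msizeD_le _ _)) // geq_max pk. Qed.
Lemma msizeB_leq p q k : (msize p <= k)%N -> (msize q <= k)%N -> (msize (p - q) <= k)%N.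
Proof. by move=> pk qk; apply: msizeD_leq; rewrite ?msizeN. Qed.
Lemma msize_sum_leq (I : eqType) (r : seq I) (P : pred I) (F : I -> {mpoly R[n]}) k :
  (forall i, i \in r -> P i -> (msize (F i) <= k)%N) ->
  (msize (\sum_(i <- r | P i) F i) <= k)%N.
Proof.
move=> Fk; rewrite big_seq_cond; elim/big_rec: _ => [|i p /andP[ir Pi] pk].
  by rewrite msize0.
by apply: msizeD_leq => //; exact: Fk.
Qed.

Lemma msize_leqP p k : reflect (forall m, m \in msupp p -> (mdeg m < k)%N) (msize p <= k)%N.
Proof.
apply: (iffP idP) => [pk m /msize_mdeg_lt/leq_trans|pk]; first exact.
by rewrite msizeE; apply/bigmax_leqP_seq => m /pk.
Qed.

Lemma msizeM_leq p q a b : (msize p <= a.+1)%N -> (msize q <= b.+1)%N ->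
  (msize (p * q) <= (a + b).+1)%N.
Proof.
move=> /msize_leqP pa /msize_leqP qb; apply/msize_leqP => m /msuppM_le.
case/allpairsP => -[m1 m2] /= [/pa m1a /qb m2b ->].
by rewrite mdegD ltnS leq_add.
Qed.

End MonomialSize.

(** A nonconstant monomial is [X_j m'] with [j] its lowest variable in a single
way. This decomposition replaces ordered words of basis vectors, and
[monomial_ind] is induction along it. *)
Section LowestVariable.
Variable n : nat.
Implicit Types (i j : 'I_n) (m : 'X_{1..n}).

Definition below i m := [forall j, (m j != 0%N) ==> (i <= j)%N].
Definition low m : option 'I_n := [pick j | (m j != 0%N) && below j m].

Lemma belowP i m : reflect (forall j, m j != 0%N -> (i <= j)%N) (below i m).
Proof. by apply: (iffP forallP) => im j; [apply/implyP|apply/implyP]; exact: im. Qed.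

Lemma below_addU i j m : (i <= j)%N -> below i m -> below i (m + U_(j)).
Proof.
move=> ij /belowP im; apply/belowP => k.
rewrite mnmDE mnm1E; case: (eqVneq j k) => [<-|_] //.
by rewrite addn0 => /im.
Qed.

Lemma low_addU j m : below j m -> low (m + U_(j)) = Some j.
Proof.
move=> jm; rewrite /low; case: pickP => [i|/(_ j)]; last first.
  by rewrite mnmDE mnm1E eqxx addn1 /= below_addU.
case/andP=> mi /belowP ib; congr Some; apply/val_inj/anti_leq/andP; split.
  by apply: ib; rewrite mnmDE mnm1E eqxx addn1.
by have /belowP := below_addU (leqnn j) jm; apply.
Qed.

Lemma low0 : low 0%MM = None.
Proof. by rewrite /low; case: pickP => // j; rewrite mnm0E. Qed.

Lemma monomial_split m : m = 0%MM \/ exists j m', below j m' /\ m = (m' + U_(j))%MM.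
Proof.
have [->|m0] := eqVneq m 0%MM; [by left|right].
have [j mj] : exists j, m j != 0%N.
  apply/existsP; apply: contraNT m0 => /existsPn m0; apply/eqP/mnmP => i.
  by rewrite mnm0E; apply/eqP; rewrite -[_ == _]negbK m0.
case: (@arg_minnP _ j (fun i => m i != 0%N) val mj) => {mj}j mj jmin.
exists j, (m - U_(j))%MM; split.
  apply/belowP => i; rewrite mnmBE => mi; apply: jmin.
  by apply: contraNN mi => /eqP ->.
apply/mnmP => i; rewrite mnmDE mnmBE mnm1E.
by case: eqVneq => [<-|_]; rewrite ?subn0 ?addn0 // subnK // lt0n.
Qed.

Lemma monomial_ind (P : 'X_{1..n} -> Prop) : P 0%MM ->
  (forall j m, below j m -> P m -> P (m + U_(j))%MM) -> forall m, P m.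
Proof.
move=> P0 PU m; move: {2}(mdeg m) (erefl (mdeg m)) => d.
elim: d m => [|d IH] m; first by move/eqP; rewrite mdeg_eq0 => /eqP ->.
case: (monomial_split m) => [->|[j [m' [jm' ->]]]]; first by rewrite mdeg0.
by rewrite mdegD mdeg1 addn1 => -[/IH]; exact: PU.
Qed.

Lemma monomial_addK m j : (m + U_(j) - U_(j))%MM = m.
Proof. by apply/mnmP => i; rewrite mnmBE mnmDE addnK. Qed.

End LowestVariable.

(** * The action of the enveloping algebra on polynomials *)

Section PBW.
Variables (K : fieldType) (L : lieAlgType K) (n : nat) (e : 'I_n -> L).
Variable co : 'I_n -> {scalar L}.
Hypothesis eK : forall x, x = \sum_i co i x *: e i.
Hypothesis co_e : forall i j, co i (e j) = (i == j)%:R.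

Local Notation V := {mpoly K[n]}.
Implicit Types (i j k : 'I_n) (m : 'X_{1..n}) (p : V).

(** The action of [e_i] on the monomial [m] that makes ordered words correspond to
monomials. When [i] is not above the lowest variable [j] of [m = X_j m'], it is
multiplication by [X_i]; otherwise it is dictated by
[e_i e_j = e_j e_i + [e_i, e_j]] applied to [m']. In [e_j (e_i m')] the leading
part [X_i m'] of [e_i m'] contributes [X_i m], and only the remainder, of
lower degree, needs a recursive call. [d] bounds the depth of the recursion. *)
Fixpoint act d i m : V :=
  if d is d'.+1 then
    if low m is Some j then
      if (j < i)%N then
        let m' := (m - U_(j))%MM in
        'X_i * 'X_[m] + lext (act d' j) (act d' i m' - 'X_i * 'X_[m'])
        + \sum_k co k (lie (e i) (e j)) *: act d' k m'
      else 'X_i * 'X_[m]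
    else 'X_i * 'X_[m]
  else 'X_i * 'X_[m].

Lemma act_below d i m : below i m -> act d i m = 'X_i * 'X_[m].
Proof.
case: d => //= d im; case: (monomial_split m) => [->|[j [m' [jm' em]]]].
  by rewrite low0.
rewrite em low_addU // ifF // ltnNge; apply/negbF.
by apply: (belowP _ _ im); rewrite em mnmDE mnm1E eqxx addn1.
Qed.

Lemma actS d i j m : (j < i)%N -> below j m ->
  act d.+1 i (m + U_(j)) = 'X_i * 'X_[m + U_(j)]
    + lext (act d j) (act d i m - 'X_i * 'X_[m])
    + \sum_k co k (lie (e i) (e j)) *: act d k m.
Proof. by move=> ji jm /=; rewrite low_addU // ji monomial_addK. Qed.

Lemma msizeXX i m : msize ('X_i * 'X_[m] : V) = (mdeg m).+2.
Proof. by rewrite -mpolyXD msizeX mdegD mdeg1. Qed.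

(** The degree estimate that makes the recursion of [act] meaningful: recursive
calls only see monomials whose degree the depth still covers. *)
Lemma act_lead d i m : (mdeg m <= d)%N ->
  (msize (act d i m - 'X_i * 'X_[m]) <= (mdeg m).+1)%N.
Proof.
elim: d i m => [|d IH] i m; first by rewrite subrr msize0.
case: (monomial_split m) => [->|[j [m' [jm' ->]]]].
  by rewrite /= low0 subrr msize0.
have [ji|ij _] := ltnP j i; last first.
  by rewrite act_below ?below_addU ?subrr ?msize0 //; apply/belowP => k /(belowP _ _ jm')/(leq_trans ij).
have sz k m1 : (mdeg m1 <= d)%N -> (msize (act d k m1) <= (mdeg m1).+2)%N.
  move=> /(IH k m1) ak; rewrite -[act _ _ _](subrK ('X_k * 'X_[m1])).
  by apply: msizeD_leq; [exact: leqW|rewrite msizeXX].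
rewrite mdegD mdeg1 addn1 ltnS => m'd; rewrite actS // [X in msize X](_ : _ =
    lext (act d j) (act d i m' - 'X_i * 'X_[m'])
    + \sum_k co k (lie (e i) (e j)) *: act d k m'); last by ring.
apply: msizeD_leq; apply: msize_sum_leq => k kr _; rewrite (leq_trans (msizeZ_le _ _)) //.
  have km' := leq_trans (msize_mdeg_lt kr) (IH i m' m'd).
  by rewrite (leq_trans (sz _ _ _)) // (leq_trans _ m'd).
exact: sz.
Qed.

Lemma act_fuel d d' i m : (mdeg m <= d)%N -> (mdeg m <= d')%N -> act d i m = act d' i m.
Proof.
elim: d d' i m => [|d IH] d' i m.
  by rewrite leqn0 mdeg_eq0 => /eqP -> _; rewrite !act_below //; apply/belowP => j; rewrite mnm0E.
case: (monomial_split m) => [-> _ _|[j [m' [jm' ->]]]].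
  by rewrite !act_below //; apply/belowP => j; rewrite mnm0E.
rewrite mdegD mdeg1 addn1; case: d' => // d'; rewrite !ltnS => md md'.
have [ji|ij] := ltnP j i; last first.
  by rewrite !act_below ?below_addU //; apply/belowP => k /(belowP _ _ jm')/(leq_trans ij).
rewrite !actS // (IH d') //; congr (_ + _ + _); last first.
  by apply: eq_bigr => k _; rewrite (IH d').
apply: eq_lext => m1 m1m; have := leq_trans m1m (act_lead i md').
by rewrite ltnS => m1m'; apply: IH; rewrite (leq_trans m1m').
Qed.

Definition rho i : V -> V := lext (fun m => act (mdeg m) i m).
HB.instance Definition _ i := GRing.Linear.on (rho i).

Lemma rho_below i m : below i m -> rho i 'X_[m] = 'X_i * 'X_[m].
Proof. by move=> im; rewrite /rho lextX act_below. Qed.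

Lemma rho_lead i p (d : nat) : (msize p <= d)%N -> (msize (rho i p - 'X_i * p) <= d)%N.
Proof.
move=> pd; rewrite [p in 'X_i * p]mpolyE /rho /lext mulr_sumr -sumrB.
apply: msize_sum_leq => m /msize_mdeg_lt mp _; rewrite -scalerAr -scalerBr.
rewrite (leq_trans (msizeZ_le _ _)) // (leq_trans (act_lead i (leqnn _))) //.
exact: leq_trans pd.
Qed.

Definition lie_act (x : L) p : V := \sum_i co i x *: rho i p.

Lemma lie_act_is_linear x : linear (lie_act x).
Proof.
move=> a p q; rewrite /lie_act scaler_sumr -big_split; apply: eq_bigr => i _ /=.
by rewrite linearP scalerDr !scalerA mulrC.
Qed.
HB.instance Definition _ x := GRing.isLinear.Build K V V _ (lie_act x) (lie_act_is_linear x).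

Lemma lie_actP a x y p : lie_act (a *: x + y) p = a *: lie_act x p + lie_act y p.
Proof.
rewrite /lie_act scaler_sumr -big_split; apply: eq_bigr => i _ /=.
by rewrite linearP /= scalerDl scalerA.
Qed.

Lemma lie_act_e i p : lie_act (e i) p = rho i p.
Proof.
rewrite /lie_act (bigD1 i) //= co_e eqxx scale1r big1 ?addr0 // => j ji.
by rewrite co_e (negbTE ji) scale0r.
Qed.

(** The recursion defining [act], read as a commutation rule. *)
Lemma rho_swap_below i j m : (j < i)%N -> below j m ->
  rho i (rho j 'X_[m]) = rho j (rho i 'X_[m]) + lie_act (lie (e i) (e j)) 'X_[m].
Proof.
move=> ji jm; rewrite (rho_below jm) -mpolyXD (addmC U_(j)%MM).
rewrite {1}/rho lextX mdegD mdeg1 addn1 actS //.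
have rX k : rho k 'X_[m] = act (mdeg m) k m by rewrite /rho lextX.
rewrite -rX; congr (_ + _); last by apply: eq_bigr => k _; rewrite rX.
have -> : lext (act (mdeg m) j) (rho i 'X_[m] - 'X_i * 'X_[m])
    = rho j (rho i 'X_[m] - 'X_i * 'X_[m]).
  apply: eq_lext => m1 m1m; apply: act_fuel => //.
  by rewrite rX in m1m; have := leq_trans m1m (act_lead i (leqnn _)); rewrite ltnS.
have rXX : rho j ('X_i * 'X_[m]) = 'X_i * 'X_[m + U_(j)].
  rewrite -mpolyXD rho_below ?(addmC U_(i)%MM) ?below_addU ?(ltnW ji) //.
  by rewrite !mpolyXD; ring.
by rewrite linearB /= rXX addrC subrK.
Qed.

(** By bilinearity the bracket relation for basis vectors on the monomials of [p]
implies it for all of [L] on [p]. The induction of [rho_bracket] needs it for a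
single [p], all of whose monomials have small degree. *)
Lemma rho_bracketP p : (forall m, (mdeg m < msize p)%N -> forall i j,
    rho i (rho j 'X_[m]) = rho j (rho i 'X_[m]) + lie_act (lie (e i) (e j)) 'X_[m]) ->
  forall x y, lie_act x (lie_act y p) = lie_act y (lie_act x p) + lie_act (lie x y) p.
Proof.
move=> Hm x y.
have Hp i j : rho i (rho j p) = rho j (rho i p) + lie_act (lie (e i) (e j)) p.
  apply: (linear_mpoly_ext (F := rho i \o rho j)
    (G := (rho j \o rho i) \+ lie_act (lie (e i) (e j)))) => [a q r|a q r|m mp] /=.
  - by rewrite !linearP.
  - by rewrite !linearP /= scalerDr addrACA.
  - exact: Hm.
have lieE : lie_act (lie x y) p
    = \sum_i \sum_j (co i x * co j y) *: lie_act (lie (e i) (e j)) p.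
  have act0 q : lie_act 0 q = 0.
    by rewrite /lie_act big1 // => k _; rewrite linear0 scale0r.
  have suml (F : 'I_n -> L) q : lie_act (\sum_i F i) q = \sum_i lie_act (F i) q.
    elim/big_rec2: _ => [//|k a b _ <-].
    by rewrite -[F k]scale1r lie_actP !scale1r.
  have sumZ a z q : lie_act (a *: z) q = a *: lie_act z q.
    by rewrite -[a *: z]addr0 lie_actP act0 addr0.
  have lie0l z : lie 0 z = 0 :> L.
    by apply: (@addrI _ (lie 0 z)); rewrite -lieDl !addr0.
  have lie0r z : lie z 0 = 0 :> L.
    by apply: (@addrI _ (lie z 0)); rewrite -lieDr !addr0.
  rewrite {1}(eK x) (big_morph (fun z => lie z y) (fun a b => lieDl a b y) (lie0l y)) suml.
  apply: eq_bigr => i _; rewrite lieZl sumZ {1}(eK y).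
  rewrite (big_morph (lie (e i)) (lieDr (e i)) (lie0r (e i))) suml scaler_sumr.
  by apply: eq_bigr => j _; rewrite lieZr sumZ scalerA.
rewrite lieE /lie_act.
under eq_bigr => i _.
  rewrite (linear_sum (rho i)) scaler_sumr.
  under eq_bigr => j _ do rewrite linearZ /= scalerA Hp scalerDr.
  rewrite big_split /=; over.
rewrite big_split /=; congr (_ + _); rewrite exchange_big /=.
apply: eq_bigr => j _; rewrite (linear_sum (rho j)) scaler_sumr.
by apply: eq_bigr => i _; rewrite linearZ /= scalerA mulrC.
Qed.

Lemma lieC (x y : L) : lie x y = - lie y x.
Proof.
apply/eqP; rewrite -addr_eq0; apply/eqP.
by have := liexx (x + y); rewrite lieDl !lieDr !liexx addr0 add0r.
Qed.

Lemma lieNr (x y : L) : lie x (- y) = - lie x y.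
Proof. by rewrite -scaleN1r lieZr scaleN1r. Qed.

Lemma lie_actN x p : lie_act (- x) p = - lie_act x p.
Proof. by rewrite /lie_act -sumrN; apply: eq_bigr => i _; rewrite linearN scaleNr. Qed.

Lemma lie_act0 p : lie_act 0 p = 0.
Proof. by rewrite /lie_act big1 // => k _; rewrite linear0 scale0r. Qed.

Lemma lie_actD x y p : lie_act (x + y) p = lie_act x p + lie_act y p.
Proof. by have := lie_actP 1 x y p; rewrite !scale1r. Qed.

(** The basis vectors act as a representation of [L], by induction on the degree
of [m]. The definition of the action covers [i > j] with [j] below [m], so let
the lowest variable [k] of [m = X_k m'] be below both. Then [X^m = e_k m'], and
[e_k] can be moved to the front of [e_i e_j e_k] and of [e_j e_i e_k]; what is
left is a combination of instances for [m'], which cancel by the Jacobi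
identity. *)
Lemma rho_bracket i j m :
  rho i (rho j 'X_[m]) = rho j (rho i 'X_[m]) + lie_act (lie (e i) (e j)) 'X_[m].
Proof.
move: {2}(mdeg m).+1 (ltnSn (mdeg m)) => d.
elim: d m i j => [//|d IH] m i j; rewrite ltnS => md.
wlog ji : i j / (j < i)%N => [wl|].
  case: (ltngtP j i) => [||/val_inj ->]; first exact: wl.
    by move/wl ->; rewrite (lieC (e j)) lie_actN subrK.
  by rewrite liexx /lie_act big1 ?addr0 // => k _; rewrite linear0 scale0r.
case: (monomial_split m) => [em|[k [m' [km' em]]]].
  by apply: rho_swap_below => //; apply/belowP => k; rewrite em mnm0E.
have [jk|kj] := leqP j k.
  apply: rho_swap_below => //; rewrite em below_addU //.
  by apply/belowP => l /(belowP _ _ km')/(leq_trans jk).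
have ki := ltn_trans kj ji; have m'd : (mdeg m' < d)%N.
  by rewrite (leq_trans _ md) // em mdegD mdeg1 addn1.
have IHp p : (msize p <= (mdeg m').+1)%N -> forall x y,
    lie_act x (lie_act y p) = lie_act y (lie_act x p) + lie_act (lie x y) p.
  move=> pm'; apply: rho_bracketP => m1 m1p a b; apply: IH.
  by rewrite (leq_trans _ m'd) // (leq_trans m1p).
have Xm' : (msize ('X_[m'] : V) <= (mdeg m').+1)%N by rewrite msizeX.
(* The leading part of [e_b m'] has [k] below it, so that the definition of the
   action applies; the remainder has the degree of [m'], so that induction does. *)
have swap (a b : 'I_n) : (k < a)%N -> (k < b)%N -> rho a (rho b (rho k 'X_[m'])) =
    rho k (rho a (rho b 'X_[m'])) + lie_act (lie (e a) (e k)) (rho b 'X_[m'])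
    + rho a (lie_act (lie (e b) (e k)) 'X_[m']).
  move=> ka kb; rewrite rho_swap_below // linearD /=; congr (_ + _).
  rewrite -[rho b _](subrK ('X_b * 'X_[m'])); have := rho_lead b Xm'.
  move: (rho b _ - _) => w wm'; rewrite !linearD /= -mpolyXD addmC.
  rewrite (rho_swap_below ka) ?below_addU ?(ltnW kb) //.
  have := IHp _ wm' (e a) (e k); rewrite !lie_act_e => ->.
  by rewrite addrACA.
have -> : 'X_[m] = rho k 'X_[m'] by rewrite rho_below // em addmC mpolyXD.
rewrite !swap //.
have := IHp _ Xm' (e i) (e j); rewrite !lie_act_e => ->; rewrite linearD /=.
have := IHp _ Xm' (lie (e i) (e k)) (e j); rewrite !lie_act_e => ->.
have := IHp _ Xm' (e i) (lie (e j) (e k)); rewrite !lie_act_e => ->.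
have := IHp _ Xm' (lie (e i) (e j)) (e k); rewrite !lie_act_e => ->.
have -> : lie (lie (e i) (e j)) (e k)
    = lie (lie (e i) (e k)) (e j) + lie (e i) (lie (e j) (e k)).
  rewrite (lieC (lie (e i) (e j))) (lieC (lie (e i) (e k))) (lieC (e i) (e k)) lieNr opprK.
  have := lie_jacobi (e i) (e j) (e k); move/eqP; rewrite addr_eq0 => /eqP <-.
  by rewrite addrC.
rewrite lie_actD; ring.
Qed.

Lemma lie_act_bracket x y p :
  lie_act x (lie_act y p) = lie_act y (lie_act x p) + lie_act (lie x y) p.
Proof. by apply: rho_bracketP => m _ i j; exact: rho_bracket. Qed.

Fixpoint term_act (u : uterm L) : V -> V :=
  match u with
  | UZero => fun=> 0
  | UOne => id
  | UAdd u v => fun p => term_act u p + term_act v p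
  | UOpp u => fun p => - term_act u p
  | UScale a u => fun p => a *: term_act u p
  | UMul u v => term_act u \o term_act v
  | UGen x => lie_act x
  end.

Lemma term_act_linear u : linear (term_act u).
Proof.
elim: u => [|//|u IHu v IHv|u IHu|a u IHu|u IHu v IHv|x] b p q /=.
- by rewrite scaler0 addr0.
- by rewrite IHu IHv scalerDr addrACA.
- by rewrite IHu opprD scalerN.
- by rewrite IHu scalerDr !scalerA mulrC.
- by rewrite IHv IHu.
- exact: linearP.
Qed.

Lemma term_act_ueq u v : ueq u v -> term_act u =1 term_act v.
Proof.
have tD u' p q : term_act u' (p + q) = term_act u' p + term_act u' q.
  by have := term_act_linear u' 1 p q; rewrite !scale1r.
have tZ u' a p : term_act u' (a *: p) = a *: term_act u' p.
  have t0 : term_act u' 0 = 0.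
    by apply: (@addrI _ (term_act u' 0)); rewrite -tD !addr0.
  by have := term_act_linear u' a p 0; rewrite t0 !addr0.
elim=> //=.
- by move=> ? ? _ e1 p; rewrite e1.
- by move=> ? ? ? _ e1 _ e2 p; rewrite e1.
- by move=> ? ? ? ? _ e1 _ e2 p; rewrite e1 e2.
- by move=> ? ? _ e1 p; rewrite e1.
- by move=> ? ? ? _ e1 p; rewrite e1.
- by move=> ? ? ? ? _ e1 _ e2 p /=; rewrite e2 e1.
- by move=> * p /=; rewrite addrA.
- by move=> * p /=; rewrite addrC.
- by move=> * p /=; rewrite add0r.
- by move=> * p /=; rewrite addNr.
- by move=> * p /=; rewrite scalerA.
- by move=> * p /=; rewrite scale1r.
- by move=> * p /=; rewrite scalerDr.
- by move=> * p /=; rewrite scalerDl.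
- by move=> * p /=; rewrite tD.
- by move=> * p /=; rewrite tZ.
- by move=> x y p; rewrite lie_actD.
- by move=> a x p; rewrite -[a *: x]addr0 lie_actP lie_act0 addr0.
- by move=> x y p; rewrite lie_act_bracket addrC addKr.
Qed.

Local Notation H := 'U(L).

Definition env_act (h : H) : V -> V := term_act (repr h).
Implicit Types (f g h : H).

Lemma env_act_pi u p : env_act (\pi_(H)%qT u) p = term_act u p.
Proof. by apply: term_act_ueq; exact: ueq_repr. Qed.

HB.instance Definition _ h :=
  GRing.isLinear.Build K V V _ (env_act h) (term_act_linear (repr h)).

Lemma env_act1 p : env_act 1 p = p.
Proof. exact: (env_act_pi (UOne L)). Qed.
Lemma env_actD f g p : env_act (f + g) p = env_act f p + env_act g p.
Proof.
elim/quotW: f => f; elim/quotW: g => g; rewrite -[_ + _]/(env_add _ _) env_addE.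
by rewrite !env_act_pi.
Qed.
Lemma env_actZ a h p : env_act (a *: h) p = a *: env_act h p.
Proof. by elim/quotW: h => h; rewrite -[_ *: _]/(env_scale _ _) env_scaleE !env_act_pi. Qed.
Lemma env_actM f g p : env_act (f * g) p = env_act f (env_act g p).
Proof.
elim/quotW: f => f; elim/quotW: g => g; rewrite -[_ * _]/(env_mul _ _) env_mulE.
by rewrite !env_act_pi.
Qed.
Lemma env_act_gen x p : env_act (env_gen x) p = lie_act x p.
Proof. exact: (env_act_pi (UGen x)). Qed.

Fixpoint ordered_word d m : H :=
  if d is d'.+1 then
    if low m is Some j then env_gen (e j) * ordered_word d' (m - U_(j)) else 1
  else 1.

Definition tau : V -> H := lext (fun m => ordered_word (mdeg m) m).
HB.instance Definition _ := GRing.Linear.on tau.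

Lemma tau1 : tau 1 = 1.
Proof. by rewrite -mpolyX0 /tau lextX mdeg0. Qed.

Lemma tau_addU j m : below j m -> tau ('X_j * 'X_[m]) = env_gen (e j) * tau 'X_[m].
Proof.
move=> jm; rewrite -mpolyXD addmC /tau !lextX mdegD mdeg1 addn1 /=.
by rewrite low_addU // monomial_addK.
Qed.

Lemma gen_sum x : env_gen x = \sum_i co i x *: env_gen (e i) :> H.
Proof.
have gen0 : env_gen (0 : L) = 0 by rewrite -(scale0r (0 : L)) env_genZ scale0r.
rewrite {1}(eK x) (big_morph _ (@env_genD _ L) gen0).
by apply: eq_bigr => i _; rewrite env_genZ.
Qed.

(** [tau] intertwines the action on polynomials with left multiplication; hence it
inverts the evaluation [psi] of the action at [1]. The induction follows that
of [rho_bracket]. *)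
Lemma tau_rho i p : env_gen (e i) * tau p = tau (rho i p).
Proof.
have mono_p q : (forall m i, (mdeg m < msize q)%N -> env_gen (e i) * tau 'X_[m] = tau (rho i 'X_[m])) ->
    forall i, env_gen (e i) * tau q = tau (rho i q).
  move=> qm {}i; apply: (linear_mpoly_ext (F := fun p => _ * tau p) (G := tau \o rho i)) => [a r s|a r s|m] /=.
  - by rewrite linearP mulrDr -scalerAr.
  - by rewrite !linearP.
  - exact: qm.
apply: (mono_p p) => m {p}{}i _; move: {2}(mdeg m).+1 (ltnSn (mdeg m)) => d.
elim: d m i => [//|d IH] m i; rewrite ltnS => md.
case: (monomial_split m) => [em|[j [m' [jm' em]]]].
  have im : below i m by apply/belowP => j; rewrite em mnm0E.
  by rewrite rho_below // tau_addU.
have [ij|ji] := leqP i j.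
  have im : below i m.
    rewrite em below_addU //; by apply/belowP => l /(belowP _ _ jm')/(leq_trans ij).
  by rewrite rho_below // tau_addU.
have m'd : (mdeg m' < d)%N by rewrite (leq_trans _ md) // em mdegD mdeg1 addn1.
have Xm : 'X_[m] = rho j 'X_[m'] by rewrite rho_below // em addmC mpolyXD.
rewrite Xm rho_bracket linearD /= rho_below // tau_addU // mulrA.
have -> : env_gen (e i) * env_gen (e j)
    = env_gen (e j) * env_gen (e i) + env_gen (lie (e i) (e j)) :> H.
  by rewrite env_gen_lie addrC subrK.
rewrite mulrDl -mulrA IH //; congr (_ + _); last first.
  rewrite gen_sum mulr_suml linear_sum; apply: eq_bigr => k _.
  by rewrite -scalerAl linearZ /= IH.
rewrite -[rho i _](subrK ('X_i * 'X_[m'])); have := rho_lead i (leqnn (msize ('X_[m'] : V))).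
move: (rho i _ - _) => w wm'; rewrite (linearD (rho j)) !(linearD tau) mulrDr; congr (_ + _).
  apply: mono_p => m1 k m1w; apply: IH; rewrite (leq_trans _ m'd) // ltnS -ltnS.
  by rewrite (leq_trans m1w) // (leq_trans wm') // msizeX.
have jXm' : below j (m' + U_(i)) by rewrite below_addU // ltnW.
by rewrite /= -mpolyXD addmC rho_below // tau_addU.
Qed.

Lemma tau_act h p : h * tau p = tau (env_act h p).
Proof.
elim/env_ind: h p => [p|f g IHf IHg p|a f IHf p|f g IHf IHg p|x p].
- by rewrite mul1r env_act1.
- by rewrite mulrDl IHf IHg env_actD linearD.
- by rewrite -scalerAl IHf env_actZ linearZ.
- by rewrite -mulrA IHg IHf env_actM.
- rewrite env_act_gen gen_sum mulr_suml linear_sum; apply: eq_bigr => i _.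
  by rewrite -scalerAl tau_rho linearZ.
Qed.

Definition psi h : V := env_act h 1.

Lemma psi_is_linear : linear psi.
Proof. by move=> a f g; rewrite /psi env_actD env_actZ. Qed.
HB.instance Definition _ := GRing.isLinear.Build K H V _ psi psi_is_linear.

Lemma psiK : cancel psi tau.
Proof. by move=> h; rewrite -tau_act tau1 mulr1. Qed.

Lemma psi1 : psi 1 = 1.
Proof. exact: env_act1. Qed.

Lemma psiM f g : psi (f * g) = env_act f (psi g).
Proof. exact: env_actM. Qed.

(** The Poincare-Birkhoff-Witt theorem: [psi] and [tau] are inverse to each other,
so the ordered words form a basis of [U(L)]. *)
Lemma tauK : cancel tau psi.
Proof.
move=> p; apply: (linear_mpoly_ext (F := psi \o tau) (G := id)) => [a q r|//|m _] /=.
  by rewrite !linearP.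
elim/monomial_ind: m => /= [|j m jm IH].
  by rewrite mpolyX0 tau1 psi1.
rewrite addmC mpolyXD tau_addU // psiM IH env_act_gen lie_act_e.
exact: rho_below.
Qed.

Lemma psi_gen x : psi (env_gen x) = \sum_i co i x *: 'X_i.
Proof.
rewrite gen_sum linear_sum; apply: eq_bigr => i _; rewrite linearZ; congr (_ *: _).
rewrite /= /psi env_act_gen lie_act_e -mpolyX0 rho_below ?mpolyX0 ?mulr1 //.
by apply/belowP => j; rewrite mnm0E.
Qed.

Lemma env_gen_inj : injective (@env_gen K L).
Proof.
move=> x y /(congr1 psi); rewrite !psi_gen => exy.
rewrite (eK x) (eK y); apply: eq_bigr => i _; congr (_ *: _).
have co_i z : co i z = (\sum_j co j z *: 'X_j : V)@_(U_(i)).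
  rewrite raddf_sum (bigD1 i) //= mcoeffZ mcoeffXU eqxx mulr1 big1 ?addr0 // => j ji.
  by rewrite mcoeffZ mcoeffXU (negbTE ji) mulr0.
by rewrite !co_i exy.
Qed.

(** An ordered word acts as multiplication by its monomial up to terms of lower
degree, as each of its letters does. *)
Lemma act_tau_lead m p (d : nat) : (msize p <= d.+1)%N ->
  (msize (env_act (tau 'X_[m]) p - 'X_[m] * p) <= mdeg m + d)%N.
Proof.
move=> pd; elim/monomial_ind: m => [|j m jm IH].
  by rewrite mpolyX0 tau1 env_act1 mul1r subrr msize0.
rewrite addmC mpolyXD tau_addU // env_actM env_act_gen lie_act_e mdegD mdeg1.
move: (env_act _ p) IH => y ym; rewrite -[rho j y](subrK ('X_j * y)) -addrA.
have szy : (msize y <= (mdeg m + d).+1)%N.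
  rewrite -[y](subrK ('X_[m] * p)); apply: msizeD_leq; first exact: leqW.
  by apply: msizeM_leq => //; rewrite msizeX.
apply: msizeD_leq; first exact: rho_lead.
rewrite -mulrA -mulrBr add1n addSn; move: (mdeg m + d)%N ym => k.
have [->|w0] := eqVneq (y - 'X_[m] * p) 0; first by rewrite mulr0 msize0.
case: k => [|k]; first by rewrite leqn0 msize_poly_eq0 (negbTE w0).
by move=> wk; rewrite -(add1n k); apply: msizeM_leq => //; rewrite msizeX mdeg1.
Qed.

(** The graded algebra associated with [U(L)] is the polynomial ring. *)
Lemma psiM_lead (a b : nat) f g : (msize (psi f) <= a.+1)%N -> (msize (psi g) <= b.+1)%N ->
  (msize (psi (f * g)%R - psi f * psi g) <= a + b)%N.
Proof.
move=> fa gb; rewrite psiM -{1}[f]psiK; move: (psi f) (psi g) fa gb => p q pa qb.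
have -> : env_act (tau p) q - p * q = \sum_(m <- msupp p) p@_m *: (env_act (tau 'X_[m]) q - 'X_[m] * q).
  rewrite {1 2}(mpolyE p) linear_sum mulr_suml.
  rewrite (big_morph (fun h => env_act h q) (fun f g : H => env_actD f g q) (id1 := 0)); last first.
    by rewrite -(scale0r 0) env_actZ scale0r.
  rewrite -sumrB; apply: eq_bigr => m _.
  by rewrite linearZ env_actZ -scalerAl scalerBr.
apply: msize_sum_leq => m /msize_mdeg_lt mp _; rewrite (leq_trans (msizeZ_le _ _)) //.
rewrite (leq_trans (act_tau_lead m qb)) // leq_add2r -ltnS.
exact: leq_trans pa.
Qed.

End PBW.

(** * Symbols and the degree in the last tensor factor *)

Lemma mul_terms (R : nzRingType) (n : nat) (a b : R) (m m' : 'X_{1..n}) :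
  (a *: 'X_[m]) * (b *: 'X_[m']) = (a * b) *: ('X_[m] * 'X_[m']) :> {mpoly R[n]}.
Proof.
rewrite -scalerAl -scalerA; congr (_ *: _).
by rewrite -!mul_mpolyC !mulrA; congr (_ * _); exact/esym/commr_mpolyX.
Qed.

Section Symbol.
Variables (K : fieldType) (L : finDimLieAlgType K).
Local Notation H := 'U(L).
Local Notation n := (\dim {:L}).

Definition pbw_basis (i : 'I_n) : L := (vbasis {:L})`_i.
Definition pbw_coord (i : 'I_n) : {scalar L} := coord (vbasis {:L}) i.

Lemma pbw_sum x : x = \sum_i pbw_coord i x *: pbw_basis i.
Proof. exact: coord_vbasis (memvf x). Qed.

Lemma pbw_coord_basis i j : pbw_coord i (pbw_basis j) = (i == j)%:R.
Proof. by rewrite eq_sym; exact: (coord_free j i (basis_free (vbasisP _))). Qed.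

Definition symb (h : H) : {mpoly K[n]} := psi pbw_basis pbw_coord h.
Definition unsymb (p : {mpoly K[n]}) : H := tau pbw_basis p.

Fact symb_is_linear : linear symb.
Proof. exact: (psi_is_linear pbw_sum pbw_coord_basis). Qed.
HB.instance Definition _ := GRing.isLinear.Build K H {mpoly K[n]} _ symb symb_is_linear.
Fact unsymb_is_linear : linear unsymb.
Proof. exact: linearP. Qed.
HB.instance Definition _ := GRing.isLinear.Build K {mpoly K[n]} H _ unsymb unsymb_is_linear.

Lemma symbK : cancel symb unsymb.
Proof. exact: (psiK pbw_sum pbw_coord_basis). Qed.
Lemma unsymbK : cancel unsymb symb.
Proof. exact: (tauK pbw_sum pbw_coord_basis). Qed.
Lemma symb1 : symb 1 = 1.
Proof. exact: (psi1 pbw_sum pbw_coord_basis). Qed.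
Lemma symb_gen x : symb (env_gen x) = \sum_i pbw_coord i x *: 'X_i.
Proof. exact: (psi_gen pbw_sum pbw_coord_basis). Qed.
Lemma symbM_lead a b (f g : H) : (msize (symb f) <= a.+1)%N -> (msize (symb g) <= b.+1)%N ->
  (msize (symb (f * g)%R - symb f * symb g) <= a + b)%N.
Proof. exact: (psiM_lead pbw_sum pbw_coord_basis). Qed.
Lemma unsymb1 : unsymb 1 = 1. Proof. by rewrite -symb1 symbK. Qed.
Lemma unsymb_addU j m : below j m ->
  unsymb ('X_j * 'X_[m]) = env_gen (pbw_basis j) * unsymb 'X_[m].
Proof. exact: tau_addU. Qed.

Lemma env_gen_injective : injective (@env_gen K L).
Proof. exact: (env_gen_inj pbw_sum pbw_coord_basis). Qed.

Section TensorSymbol.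
Variable A : algType K.
Implicit Types (P Q : A \OX H) (p q : {mpoly A[n]}) (a : A) (h : H).

Local Notation polyA q := (map_mpoly (in_alg A) q).

Lemma polyAZ c (q : {mpoly K[n]}) : polyA (c *: q) = c%:A *: polyA q.
Proof. exact: map_mpolyZ. Qed.

(** An element of [A \OX H] as a polynomial with coefficients in [A], possibly not
commutative, and central variables. *)
Definition sym : A \OX H -> {mpoly A[n]} := tlift (fun a h => a *: polyA (symb h)).

Fact sym_bal : balanced_biadditive (fun a (c : K) => c *: a) (fun (c : K) h => c *: h)
  (fun a h => a *: polyA (symb h)).
Proof.
split=> [a b h|a h g|a c h].
- by rewrite scalerDl.
- by rewrite linearD /= rmorphD scalerDr.
- by rewrite linearZ /= polyAZ scalerA -scalerAr mulr1.
Qed.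

Lemma sym_ox a h : sym (a \ox h) = a *: polyA (symb h).
Proof. exact: (tlift_pure sym_bal). Qed.
Lemma symB : {morph sym : P Q / P - Q}.
Proof. by move=> P Q; rewrite [LHS](tliftD sym_bal) (tliftN sym_bal). Qed.
HB.instance Definition _ := GRing.isZmodMorphism.Build _ _ sym symB.

Definition unsym p : A \OX H := \sum_(m <- msupp p) p@_m \ox unsymb 'X_[m].

Lemma unsymE p k : (msize p <= k)%N ->
  unsym p = \sum_(m : 'X_{1..n < k}) p@_m \ox unsymb 'X_[m].
Proof.
move=> lpk; rewrite /unsym (big_mksub ('X_{1..n < k} : subFinType _)) //=.
- by rewrite big_rmcond //= => m /memN_msupp_eq0 ->; exact: pure0l.
- exact: msupp_uniq.
- by move=> m /msize_mdeg_lt /leq_trans; apply.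
Qed.

Lemma unsymD : {morph unsym : p q / p + q}.
Proof.
move=> p q; pose k := maxn (msize (p + q)) (maxn (msize p) (msize q)).
rewrite !(@unsymE _ k) ?leq_max ?leqnn ?orbT // -big_split /=.
by apply: eq_bigr => m _; rewrite mcoeffD oxDl.
Qed.

Lemma symK : cancel sym unsym.
Proof.
apply: ox_ext => [P Q|//|a h]; first by rewrite raddfD unsymD.
rewrite sym_ox; set q := symb h.
pose k := maxn (msize (a *: polyA q)) (msize q).
have hE : h = unsymb (\sum_(m : 'X_{1..n < k}) q@_m *: 'X_[m]).
  by rewrite -mpolywE ?leq_maxr // symbK.
rewrite (@unsymE _ k) ?leq_maxl // hE linear_sum.
have ox_sum (I : finType) (F : I -> H) : a \ox (\sum_i F i) = \sum_i a \ox F i.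
  by apply: (big_morph (fun h => a \ox h) (oxDr a)); exact: pure0r.
rewrite ox_sum; apply: eq_bigr => m _.
by rewrite mcoeffZ mcoeff_map_mpoly linearZ /= oxZr -oxZl -scalerAr mulr1.
Qed.

Lemma symM_lead (a b : nat) P Q : (msize (sym P) <= a.+1)%N -> (msize (sym Q) <= b.+1)%N ->
  (msize (sym (P * Q)%R - sym P * sym Q) <= a + b)%N.
Proof.
rewrite -{2}[P]symK -{2}[Q]symK; move: (sym P) (sym Q) => p q pa qb.
have -> : sym (unsym p * unsym q) - p * q = \sum_(m <- msupp p) \sum_(m' <- msupp q)
    (p@_m * q@_m') *: polyA (symb (unsymb 'X_[m] * unsymb 'X_[m']) - 'X_[m] * 'X_[m']).
  have -> : p * q = (\sum_(m <- msupp p) p@_m *: 'X_[m]) * (\sum_(m <- msupp q) q@_m *: 'X_[m]).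
    by rewrite -!mpolyE.
  rewrite /unsym !mulr_suml raddf_sum -sumrB /=.
  apply: eq_bigr => m _; rewrite !mulr_sumr raddf_sum -sumrB /=.
  apply: eq_bigr => m' _; rewrite oxM sym_ox rmorphB rmorphM /= !map_mpolyX scalerBr.
  by rewrite mul_terms.
apply: msize_sum_leq => m /msize_mdeg_lt mp _.
apply: msize_sum_leq => m' /msize_mdeg_lt mq _.
rewrite (leq_trans (msizeZ_le _ _)) //; apply/msize_leqP => m1.
rewrite mcoeff_msupp mcoeff_map_mpoly => m1s.
have : m1 \in msupp (symb (unsymb 'X_[m] * unsymb 'X_[m']) - 'X_[m] * 'X_[m']).
  by rewrite mcoeff_msupp; apply: contraNneq m1s => ->; rewrite /= scale0r.
move/msize_mdeg_lt/leq_trans; apply.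
have ma : (msize (symb (unsymb 'X_[m])) <= a.+1)%N by rewrite unsymbK msizeX (leq_trans mp).
have mb : (msize (symb (unsymb 'X_[m'])) <= b.+1)%N by rewrite unsymbK msizeX (leq_trans mq).
by have := symbM_lead ma mb; rewrite !unsymbK.
Qed.

(** One plus the degree in the last factor, and [0] for the zero element: the
convention of [msize] and of [size] for polynomials. *)
Definition zdeg P := msize (sym P).

Lemma zdeg_eq0 P : (zdeg P == 0%N) = (P == 0).
Proof.
rewrite /zdeg msize_poly_eq0; apply/eqP/eqP => [P0|->]; last by rewrite raddf0.
by rewrite -[P]symK P0 -[0](raddf0 sym) symK.
Qed.

Lemma zdeg0 : zdeg 0 = 0%N. Proof. by apply/eqP; rewrite zdeg_eq0. Qed.

Lemma zdegN P : zdeg (- P) = zdeg P.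
Proof. by rewrite /zdeg raddfN msizeN. Qed.

Lemma zdegD_leq P Q k : (zdeg P <= k)%N -> (zdeg Q <= k)%N -> (zdeg (P + Q)%R <= k)%N.
Proof. by rewrite /zdeg raddfD; exact: msizeD_leq. Qed.

Lemma zdegB_leq P Q k : (zdeg P <= k)%N -> (zdeg Q <= k)%N -> (zdeg (P - Q)%R <= k)%N.
Proof. by move=> Pk Qk; apply: zdegD_leq; rewrite ?zdegN. Qed.

Lemma zdegM_leq P Q : (zdeg (P * Q)%R <= (zdeg P + zdeg Q).-1)%N.
Proof.
have [->|P0] := eqVneq P 0; first by rewrite mul0r zdeg0.
have [->|Q0] := eqVneq Q 0; first by rewrite mulr0 zdeg0.
rewrite -zdeg_eq0 in P0; rewrite -zdeg_eq0 in Q0.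
case Pa : (zdeg P) P0 => [//|a] _; case Qb : (zdeg Q) Q0 => [//|b] _.
rewrite addSn addnS /zdeg -[sym _](subrK (sym P * sym Q)).
apply: msizeD_leq; last by apply: msizeM_leq; rewrite -/(zdeg _) ?Pa ?Qb.
by apply: leqW; apply: symM_lead; rewrite -/(zdeg _) ?Pa ?Qb.
Qed.

Lemma zdegM_le2 P Q (a b : nat) : (zdeg P <= a)%N -> (zdeg Q <= b)%N ->
  (zdeg (P * Q)%R <= (a + b).-1)%N.
Proof. by move=> Pa Qb; have := zdegM_leq P Q; lia. Qed.

(** Without zero divisors in [A] the product of the leading coefficients survives,
and by [symM_lead] the corrections have lower degree. *)
Lemma zdegM P Q : (forall a b : A, a * b = 0 -> a = 0 \/ b = 0) -> P != 0 -> Q != 0 ->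
  zdeg (P * Q) = (zdeg P + zdeg Q).-1.
Proof.
move=> domA; rewrite -!zdeg_eq0 => P0 Q0.
apply/eqP; rewrite eqn_leq zdegM_leq /=.
have lc0 : mleadc (sym P) * mleadc (sym Q) != 0.
  by apply/eqP => /domA [] /eqP; rewrite mleadc_eq0 -msize_poly_eq0; apply/negP.
have szM := msizeM_proper lc0; rewrite -/(zdeg P) -/(zdeg Q) in szM; rewrite -szM.
case Pa : (zdeg P) P0 => [//|a] _; case Qb : (zdeg Q) Q0 => [//|b] _.
have low : (msize (sym (P * Q)%R - sym P * sym Q) <= a + b)%N.
  by apply: symM_lead; rewrite -/(zdeg _) ?Pa ?Qb.
have [//|ltM] := leqP (msize (sym P * sym Q)) (zdeg (P * Q)).
have : (msize (sym P * sym Q) <= a + b)%N.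
  rewrite -[sym P * sym Q](subKr (sym (P * Q))); apply: msizeB_leq => //.
  by rewrite -ltnS (leq_trans ltM) // szM Pa Qb addSn addnS.
by rewrite szM Pa Qb addSn addnS ltnn.
Qed.

Lemma zdeg_ox a h : (zdeg (a \ox h) <= msize (symb h))%N.
Proof.
rewrite /zdeg sym_ox (leq_trans (msizeZ_le _ _)) //; apply/msize_leqP => m.
rewrite mcoeff_msupp mcoeff_map_mpoly => m1s; apply: msize_mdeg_lt.
by rewrite mcoeff_msupp; apply: contraNneq m1s => ->; rewrite /= scale0r.
Qed.

Lemma zdeg_ox_eq a h : a != 0 -> zdeg (a \ox h) = msize (symb h).
Proof.
move=> a0; apply/eqP; rewrite eqn_leq zdeg_ox; apply/msize_leqP => m ms.
rewrite /zdeg sym_ox; apply: msize_mdeg_lt; rewrite mcoeff_msupp mcoeffZ mcoeff_map_mpoly /=.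
by rewrite -scalerAr mulr1 scaler_eq0 negb_or a0 -mcoeff_msupp ms.
Qed.

Lemma zdeg_ox1 a : (zdeg (a \ox 1)%R <= 1)%N.
Proof. by rewrite (leq_trans (zdeg_ox _ _)) // symb1 msize1. Qed.

Lemma zdeg_oxgen a x : (zdeg (a \ox env_gen x) <= 2)%N.
Proof.
rewrite (leq_trans (zdeg_ox _ _)) // symb_gen; apply: msize_sum_leq => i _ _.
by rewrite (leq_trans (msizeZ_le _ _)) // msizeX mdeg1.
Qed.

Lemma zdeg_leq1 P : (zdeg P <= 1)%N -> exists a, P = a \ox 1.
Proof.
move/msize1_polyC => P1; exists (sym P)@_0; rewrite -[LHS]symK -[RHS]symK; congr unsym.
by rewrite sym_ox symb1 rmorph1 {1}P1 -mul_mpolyC mulr1.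
Qed.

(** The symbol of an element of the Lie algebra has scalar coefficients, hence
commutes with every symbol: only lower terms of the two products differ. *)
Lemma zdeg_comm x P :
  (zdeg ((1 \ox env_gen x) * P - P * (1 \ox env_gen x))%R <= zdeg P)%N.
Proof.
have [->|P0] := eqVneq P 0; first by rewrite mulr0 mul0r subrr zdeg0.
rewrite -zdeg_eq0 in P0; case Pa : (zdeg P) P0 => [//|a] _; set s := _ \ox _.
have s2 : (msize (sym s) <= 2)%N by exact: zdeg_oxgen.
have comm_s : sym s * sym P = sym P * sym s.
  rewrite /s sym_ox scale1r symb_gen raddf_sum mulr_suml mulr_sumr.
  apply: eq_bigr => i _; rewrite /= polyAZ map_mpolyX.
  rewrite (mpolyE (sym P)) mulr_suml mulr_sumr; apply: eq_bigr => m _.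
  by rewrite !mul_terms -scalerAl -scalerAr mul1r mulr1 commr_mpolyX.
rewrite /zdeg raddfB /= -[X in msize X](_ : (sym (s * P) - sym s * sym P) - (sym (P * s) - sym P * sym s) = _); last first.
  by rewrite comm_s opprB addrA subrK.
have Pa' : (msize (sym P) <= a.+1)%N by rewrite -Pa.
apply: msizeB_leq; first by rewrite -add1n; apply: symM_lead.
by rewrite -addn1; apply: symM_lead.
Qed.

End TensorSymbol.

(** An algebra map applied to the first factor acts on the coefficients of the
symbol. *)
Section ZdegMap.
Variables (A B : algType K) (phi : {lrmorphism A -> B}).

Definition zmap : A \OX H -> B \OX H := Defs.mapK phi idfun.
HB.instance Definition _ := GRing.LRMorphism.on zmap.

Lemma zmapD (P Q : A \OX H) : zmap (P + Q) = zmap P + zmap Q. Proof. exact: raddfD. Qed.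
Lemma zmapB (P Q : A \OX H) : zmap (P - Q) = zmap P - zmap Q. Proof. exact: raddfB. Qed.
Lemma zmapZ (c : K) (P : A \OX H) : zmap (c *: P) = c *: zmap P. Proof. exact: linearZ. Qed.

Lemma zmap_ox a h : zmap (a \ox h) = phi a \ox h.
Proof. exact: mapK_ox. Qed.

Lemma sym_zmap P : sym (zmap P) = map_mpoly phi (sym P).
Proof.
elim/ox_ind: P => [|P Q IHP IHQ|a h]; first by rewrite !raddf0.
  by rewrite !raddfD /= IHP IHQ.
rewrite zmap_ox !sym_ox map_mpolyZ; congr (_ *: _); apply/mpolyP => m.
by rewrite !mcoeff_map_mpoly /= linearZ /= rmorph1.
Qed.

Lemma zdeg_zmap P : (zdeg (zmap P) <= zdeg P)%N.
Proof.
rewrite /zdeg sym_zmap; apply/msize_leqP => m.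
rewrite mcoeff_msupp mcoeff_map_mpoly => m1s; apply: msize_mdeg_lt.
by rewrite mcoeff_msupp; apply: contraNneq m1s => ->; rewrite /= linear0.
Qed.

Lemma zdeg_zmap_inj P : injective phi -> zdeg (zmap P) = zdeg P.
Proof.
move=> phiI; apply/eqP; rewrite eqn_leq zdeg_zmap /zdeg sym_zmap.
apply/msize_leqP => m ms; apply: msize_mdeg_lt.
rewrite mcoeff_msupp mcoeff_map_mpoly; rewrite mcoeff_msupp in ms.
by apply: contraNneq ms => pm0; apply/eqP/phiI; rewrite pm0 linear0.
Qed.
End ZdegMap.

Lemma symb_eq0 (h : H) : (msize (symb h) == 0%N) = (h == 0).
Proof.
rewrite msize_poly_eq0; apply/eqP/eqP => [h0|->]; last by rewrite linear0.
by rewrite -[h]symbK h0 linear0.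
Qed.

Lemma ox_eq0 (A : algType K) (a : A) (h : H) : a \ox h = 0 -> a = 0 \/ h = 0.
Proof.
have [->|a0 ah0] := eqVneq a 0; [by left|right].
by apply/eqP; rewrite -symb_eq0 -(zdeg_ox_eq _ a0) ah0 zdeg0.
Qed.

Definition no_zero_divisors (R : nzRingType) := forall a b : R, a * b = 0 -> a = 0 \/ b = 0.

Lemma nzd_tensor (A : algType K) : no_zero_divisors A -> no_zero_divisors (A \OX H).
Proof.
move=> domA P Q PQ0; have [->|P0] := eqVneq P 0; [by left|right].
apply/eqP; case: (eqVneq Q 0) => // Q0.
have := zdegM domA P0 Q0; rewrite PQ0 zdeg0.
by move: P0 Q0; rewrite -!zdeg_eq0; lia.
Qed.

Section TensorFactors.
Variables A B : algType K.

Definition tens_inl (a : A) : A \OX B := a \ox 1.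
Fact tens_inl_linear : linear tens_inl.
Proof. by move=> c a a'; rewrite /tens_inl oxDl oxZl. Qed.
Fact tens_inl_monoid : GRing.monoid_morphism tens_inl.
Proof. by split=> [//|a a']; rewrite /tens_inl oxM mulr1. Qed.
HB.instance Definition _ := GRing.isLinear.Build K A (A \OX B) _ tens_inl tens_inl_linear.
HB.instance Definition _ := GRing.isMonoidMorphism.Build A (A \OX B) tens_inl tens_inl_monoid.

Definition tens_inr (b : B) : A \OX B := 1 \ox b.
Fact tens_inr_linear : linear tens_inr.
Proof. by move=> c b b'; rewrite /tens_inr oxDr oxZr. Qed.
Fact tens_inr_monoid : GRing.monoid_morphism tens_inr.
Proof. by split=> [//|b b']; rewrite /tens_inr oxM mulr1. Qed.
HB.instance Definition _ := GRing.isLinear.Build K B (A \OX B) _ tens_inr tens_inr_linear.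
HB.instance Definition _ := GRing.isMonoidMorphism.Build B (A \OX B) tens_inr tens_inr_monoid.
End TensorFactors.

Fact counit_rep : lie_rep (fun _ : L => (0 : K^o)).
Proof. by split=> *; rewrite ?(addr0, scaler0, mulr0, subrr). Qed.

Definition counit : H -> K^o := env_lift (fun _ : L => (0 : K^o)).
HB.instance Definition _ :=
  GRing.isZmodMorphism.Build _ _ counit (env_lift_zmod counit_rep).
HB.instance Definition _ :=
  GRing.isScalable.Build K _ _ _ counit (env_lift_scalable counit_rep).
HB.instance Definition _ :=
  GRing.isMonoidMorphism.Build _ _ counit (env_lift_monoid counit_rep).

Lemma counit_gen x : counit (env_gen x) = 0.
Proof. exact: (env_lift_gen counit_rep). Qed.

Section CounitRight.
Variable A : algType K.

Definition counitr_at (a : A) (h : H) : A := counit h *: a.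
Fact counitr_bil : is_bilinear counitr_at.
Proof.
rewrite /counitr_at; split=> [a b h|a h g|c a h|c a h].
- exact: scalerDr.
- by rewrite rmorphD scalerDl.
- by rewrite !scalerA mulrC.
- by rewrite linearZ scalerA.
Qed.
Fact counitr_1 : counitr_at 1 1 = 1.
Proof. by rewrite /counitr_at rmorph1 scale1r. Qed.
Fact counitr_mul (a a' : A) (h h' : H) :
  counitr_at (a * a') (h * h') = counitr_at a h * counitr_at a' h'.
Proof. by rewrite /counitr_at rmorphM -scalerAl -scalerAr scalerA. Qed.

Definition counitr : A \OX H -> A := Defs.liftK counitr_at.
HB.instance Definition _ :=
  GRing.isZmodMorphism.Build _ _ counitr (liftK_zmod counitr_bil).
HB.instance Definition _ :=
  GRing.isScalable.Build K _ _ _ counitr (liftK_scalable counitr_bil).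
HB.instance Definition _ :=
  GRing.isMonoidMorphism.Build _ _ counitr (liftK_monoid counitr_bil counitr_1 counitr_mul).

Lemma counitrD (P Q : A \OX H) : counitr (P + Q) = counitr P + counitr Q. Proof. exact: raddfD. Qed.
Lemma counitrB (P Q : A \OX H) : counitr (P - Q) = counitr P - counitr Q. Proof. exact: raddfB. Qed.
Lemma counitrN (P : A \OX H) : counitr (- P) = - counitr P. Proof. exact: raddfN. Qed.
Lemma counitrZ (c : K) (P : A \OX H) : counitr (c *: P) = c *: counitr P. Proof. exact: linearZ. Qed.

Lemma counitr_ox a h : counitr (a \ox h) = counit h *: a.
Proof. exact: (liftK_ox counitr_bil). Qed.

(** How equations are solved up to lower degree terms: the difference of the two
sides has degree [0], and the counit shows that it vanishes. *)
Lemma zdeg_leq1_eq0 P : (zdeg P <= 1)%N -> counitr P = 0 -> P = 0.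
Proof.
case/zdeg_leq1 => a ->; rewrite counitr_ox rmorph1 scale1r => ->.
exact: pure0l.
Qed.
End CounitRight.

(** The case [A = K] of [nzd_tensor], as [H] embeds into [K \OX H]. *)
Lemma nzd_env : no_zero_divisors H.
Proof.
have domK : no_zero_divisors K^o by move=> a b /eqP; rewrite mulf_eq0 => /orP[]/eqP; auto.
move=> f g fg0; have := @nzd_tensor K^o domK (1 \ox f) (1 \ox g).
rewrite oxM fg0 [_ \ox 0]pure0r => /(_ erefl) [] /ox_eq0 []; auto;
  by move/eqP; rewrite oner_eq0.
Qed.

(** In the coproduct of an ordered word of length [m], the only term with [m]
letters on the right is the one with all of them there. *)
Lemma zdeg_Delta_lead (h : H) : (zdeg (Delta h - 1 \ox h)%R <= (msize (symb h)).-1)%N.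
Proof.
have lead m : (zdeg (Delta (unsymb 'X_[m]) - 1 \ox unsymb 'X_[m])%R <= mdeg m)%N.
  elim/monomial_ind: m => [|j m jm IH].
    by rewrite mpolyX0 unsymb1 rmorph1 subrr zdeg0.
  rewrite addmC mpolyXD unsymb_addU // rmorphM /= Delta_gen mdegD mdeg1 add1n.
  move: (unsymb 'X_[m]) (unsymbK 'X_[m]) IH => w wE IH; set x := env_gen _.
  have -> : (x \ox 1 + 1 \ox x) * Delta w - 1 \ox (x * w)
      = (x \ox 1) * Delta w + (1 \ox x) * (Delta w - 1 \ox w).
    by rewrite mulrDl mulrBr oxM mulr1 addrA.
  have wD : (zdeg (Delta w) <= (mdeg m).+1)%N.
    rewrite -[Delta w](subrK (1 \ox w)); apply: zdegD_leq; first exact: leqW.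
    by rewrite (leq_trans (zdeg_ox _ _)) // wE msizeX.
  apply: zdegD_leq; first exact: (zdegM_le2 (zdeg_ox1 x) wD).
  exact: (zdegM_le2 (zdeg_oxgen 1 (pbw_basis j)) IH).
have hE : h = \sum_(m <- msupp (symb h)) (symb h)@_m *: unsymb 'X_[m].
  rewrite -{1}[h]symbK {1}(mpolyE (symb h)) linear_sum; apply: eq_bigr => m _.
  by rewrite linearZ.
have ox1_sum (F : 'X_{1..n} -> H) r : 1 \ox (\sum_(m <- r) F m) = \sum_(m <- r) 1 \ox F m :> UU L.
  by apply: (big_morph (fun h => 1 \ox h) (oxDr _)); exact: pure0r.
rewrite {1 2}hE (raddf_sum (@Delta K L)) ox1_sum -sumrB big_seq.
elim/big_rec: _ => [|m P ms IH]; first by rewrite zdeg0.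
apply: zdegD_leq => //; rewrite /= linearZ oxZr -scalerBr -[X in _ *: X]mul1r scalerAl.
have -> : (symb h)@_m *: 1 = ((symb h)@_m *: 1) \ox 1 :> UU L by rewrite oxZl.
apply: leq_trans (zdegM_le2 (zdeg_ox1 _) (lead m)) _.
by have := msize_mdeg_lt ms; lia.
Qed.

(** The leading parts in the last factor of [(id (x) Delta) P] and of [P] placed in
factors one and three coincide. *)
Lemma zdeg_id_Delta_lead (P : UU L) :
  (zdeg (id_Delta P - zmap (@tens_inl H H) P)%R <= (zdeg P).-1)%N.
Proof.
have PE : P = \sum_(m <- msupp (sym P)) (sym P)@_m \ox unsymb 'X_[m] by rewrite -[LHS]symK.
rewrite {1 2}PE (raddf_sum (@id_Delta K L)) (raddf_sum (zmap (@tens_inl H H))) -sumrB big_seq.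
elim/big_rec: _ => [|m Q ms IH]; first by rewrite zdeg0.
apply: zdegD_leq => //=; set a := _@_m; set w := unsymb _.
rewrite id_Delta_ox zmap_ox.
have -> : assocK (a \ox Delta w) - tens_inl H a \ox w
    = ((a \ox 1) \ox 1) * zmap (@tens_inr H H) (Delta w - 1 \ox w).
  rewrite rmorphB mulrBr /= zmap_ox oxM mul1r rmorph1 mulr1; congr (_ - _).
  move: (Delta w); apply: ox_ext => [x y|x y|f g].
  - by rewrite oxDr rmorphD.
  - by rewrite rmorphD mulrDr.
  - by rewrite assocK_ox zmap_ox !oxM mulr1 !mul1r.
have wm : (zdeg (Delta w - 1 \ox w)%R <= mdeg m)%N.
  by have := zdeg_Delta_lead w; rewrite unsymbK msizeX.
apply: leq_trans (zdegM_le2 (zdeg_ox1 _) (leq_trans (zdeg_zmap _ _) wm)) _.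
by have := msize_mdeg_lt ms; rewrite -/(zdeg P); lia.
Qed.

End Symbol.

(** * Free modules under base change, and the associator *)

Section FreeBaseChange.
Variables (H B : nzRingType) (phi : {rmorphism H -> B}) (P : lmodType H) (e1 e2 : P).
Hypothesis e_basis : free_basis2 e1 e2.

Lemma pureHN b (x : P) : pureH phi (- b) x = - pureH phi b x.
Proof. exact: pureNl. Qed.

Lemma free_basis2_coords : exists c : P -> H * H,
  (forall x, x = (c x).1 *: e1 + (c x).2 *: e2) /\
  (forall a b, c (a *: e1 + b *: e2) = (a, b)).
Proof.
have ex x : exists c : H * H, x = c.1 *: e1 + c.2 *: e2.
  by case: (e_basis x) => c [xc _]; exists c.
have [c cP] := boolp.choice ex; exists c; split=> // a b.
case: (e_basis (a *: e1 + b *: e2)) => d [_ d_uniq].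
by rewrite -(d_uniq _ (cP _)); exact: d_uniq.
Qed.

Lemma free_tensH_ex (w : tensH phi P) : exists b1 b2, w = pureH phi b1 e1 + pureH phi b2 e2.
Proof.
elim/tensH_ind: w => [|x y [b1 [b2 ->]] [b1' [b2' ->]]|b x].
- by exists 0, 0; rewrite [pureH _ _ _]pure0l [pureH _ _ _]pure0l addr0.
- by exists (b1 + b1'), (b2 + b2'); rewrite !pureHDl addrACA.
have [c [cP _]] := free_basis2_coords.
exists (b * phi (c x).1), (b * phi (c x).2).
by rewrite !pureH_balanced -pureHDr -cP.
Qed.

(** The coordinates with respect to [e1] and [e2] are [H]-linear, hence extend to
the base change, where they read off the coefficients. *)
Lemma free_tensH_inj b1 b2 b1' b2' :
  pureH phi b1 e1 + pureH phi b2 e2 = pureH phi b1' e1 + pureH phi b2' e2 ->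
  b1 = b1' /\ b2 = b2'.
Proof.
have [c [cP cK]] := free_basis2_coords.
have cD x y : c (x + y) = ((c x).1 + (c y).1, (c x).2 + (c y).2).
  by rewrite {1}(cP x) {1}(cP y) addrACA -!scalerDl cK.
have cZ h x : c (h *: x) = (h * (c x).1, h * (c x).2).
  by rewrite {1}(cP x) scalerDr !scalerA cK.
have ce1 : c e1 = (1, 0) by rewrite -(cK 1 0) scale1r scale0r addr0.
have ce2 : c e2 = (0, 1) by rewrite -(cK 0 1) scale1r scale0r add0r.
have bal1 : balanced_biadditive (fun b h => b * phi h) (fun (h : H) (x : P) => h *: x)
    (fun b x => b * phi (c x).1).
  split=> [b b' x|b x y|b h x]; first by rewrite mulrDl.
    by rewrite cD rmorphD mulrDr.
  by rewrite cZ rmorphM mulrA.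
have bal2 : balanced_biadditive (fun b h => b * phi h) (fun (h : H) (x : P) => h *: x)
    (fun b x => b * phi (c x).2).
  split=> [b b' x|b x y|b h x]; first by rewrite mulrDl.
    by rewrite cD rmorphD mulrDr.
  by rewrite cZ rmorphM mulrA.
move=> e12; split.
  have := congr1 (tlift (fun b x => b * phi (c x).1)) e12.
  rewrite !(tliftD bal1) !(tlift_pure bal1) ce1 ce2.
  by rewrite rmorph0 rmorph1 !mulr0 !mulr1 !addr0.
have := congr1 (tlift (fun b x => b * phi (c x).2)) e12.
rewrite !(tliftD bal2) !(tlift_pure bal2) ce1 ce2.
by rewrite rmorph0 rmorph1 !mulr0 !mulr1 !add0r.
Qed.

End FreeBaseChange.

Section Associator.
Variables (K : fieldType) (L : lieAlgType K).
Local Notation H := 'U(L).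
Variables (A : lmodType H) (star : pseudoproduct A).
Implicit Types (x y z : A) (w : UU_tens A).

(** The pre-Lie identity says that exchanging [x] and [y] flips the first two
factors of this. *)
Definition associator x y z : UUU_tens A :=
  pprod_l star (star x y) z - pprod_r star x (star y z).

Lemma pprod_l0 z : pprod_l star 0 z = 0.
Proof. by apply: (@addrI _ (pprod_l star 0 z)); rewrite -pprod_lD !addr0. Qed.
Lemma pprod_r0 x : pprod_r star x 0 = 0.
Proof. by apply: (@addrI _ (pprod_r star x 0)); rewrite -pprod_rD !addr0. Qed.

Lemma pprod_lDr w z z' : pprod_l star w (z + z') = pprod_l star w z + pprod_l star w z'.
Proof.
elim/tensH_ind: w => [|u v IHu IHv|b x]; first by rewrite !pprod_l0 addr0.
  by rewrite !pprod_lD IHu IHv addrACA.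
by rewrite !pprod_l_pure pprodDr Delta_idHD scalerDr.
Qed.

Lemma pprod_rDl x x' w : pprod_r star (x + x') w = pprod_r star x w + pprod_r star x' w.
Proof.
elim/tensH_ind: w => [|u v IHu IHv|b y]; first by rewrite !pprod_r0 addr0.
  by rewrite !pprod_rD IHu IHv addrACA.
by rewrite !pprod_r_pure pprodDl id_DeltaHD scalerDr.
Qed.

(** Scaling the first argument by all of [UU L], and not only by [H], reduces the
claim on sums to pure tensors. *)
Lemma pprod_lZ (b : UU L) (f : H) w z :
  pprod_l star (b *: w) (f *: z) = (b \ox f) *: pprod_l star w z.
Proof.
elim/tensH_ind: w => [|u v IHu IHv|c x]; first by rewrite scaler0 !pprod_l0 scaler0.
  by rewrite scalerDr !pprod_lD IHu IHv scalerDr.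
rewrite pureH_scale !pprod_l_pure -[in LHS](scale1r x) pprodZ Delta_idHZ !scalerA.
congr (_ *: _); rewrite Delta_id_ox rmorph1 /ox_1r !oxM.
by rewrite !mulr1 mul1r.
Qed.

Lemma pprod_rZ (b : UU L) (h : H) w x :
  pprod_r star (h *: x) (b *: w) = assocK (h \ox b) *: pprod_r star x w.
Proof.
elim/tensH_ind: w => [|u v IHu IHv|c y]; first by rewrite scaler0 !pprod_r0 scaler0.
  by rewrite scalerDr !pprod_rD IHu IHv scalerDr.
rewrite pureH_scale !pprod_r_pure -[in LHS](scale1r y) pprodZ id_DeltaHZ !scalerA.
congr (_ *: _); rewrite id_Delta_ox rmorph1 /ox_1l -!rmorphM !oxM.
by rewrite !mulr1 mul1r.
Qed.

Lemma associatorDl x x' y z : associator (x + x') y z = associator x y z + associator x' y z.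
Proof. by rewrite /associator pprodDl pprod_lD pprod_rDl opprD addrACA. Qed.
Lemma associatorDm x y y' z : associator x (y + y') z = associator x y z + associator x y' z.
Proof. by rewrite /associator pprodDr pprodDl pprod_lD pprod_rD opprD addrACA. Qed.
Lemma associatorDr x y z z' : associator x y (z + z') = associator x y z + associator x y z'.
Proof. by rewrite /associator pprodDr pprod_lDr pprod_rD opprD addrACA. Qed.
Lemma associatorZ (h g f : H) x y z :
  associator (h *: x) (g *: y) (f *: z) = ((h \ox g) \ox f) *: associator x y z.
Proof. by rewrite /associator !pprodZ pprod_lZ pprod_rZ assocK_ox scalerBr. Qed.

Lemma swap12HZ (b : UUU L) (u : UUU_tens A) : swap12H (b *: u) = swap12 b *: swap12H u.
Proof. by apply: mapHZ => h; exact: swap12_Delta3. Qed.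

End Associator.

Lemma sub_shuffle (V : zmodType) (a b c d a' b' c' d' : V) :
  a + b + (c + d) - (a' + b' + (c' + d')) = c - c' + (a - a') + (d - d' + (b - b')).
Proof.
rewrite (addrACA a) (addrACA a') opprD [LHS]addrACA !opprD.
by congr (_ + _); rewrite addrACA addrC.
Qed.

Section StructureConstants.
Variables (K : fieldType) (L : lieAlgType K).
Local Notation H := 'U(L).
Variables (P : lmodType H) (e1 e2 : P) (star : pseudoproduct P).
Hypothesis e_basis : free_basis2 e1 e2.

Let e (i : bool) : P := if i then e2 else e1.

(** The coefficient of [e n] in the associator of [e i], [e j], [e k] for the
pseudoproduct with structure constants [g]; [false] indexes [e1] and [true]
indexes [e2]. *)
Definition assoc_coef (g : bool -> bool -> bool -> UU L) (i j k n : bool) : UUU L :=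
  \sum_(m : bool) (ox_1r (g i j m) * Delta_id (g m k n) - ox_1l (g j k m) * id_Delta (g i m n)).

Variable g : bool -> bool -> bool -> UU L.
Hypothesis star_e : forall i j, star (e i) (e j) = g i j false \oxH e1 + g i j true \oxH e2.

Lemma associator_e i j k : associator star (e i) (e j) (e k) =
  pureH (@Delta3 K L) (assoc_coef g i j k false) e1
  + pureH (@Delta3 K L) (assoc_coef g i j k true) e2.
Proof.
rewrite /associator /assoc_coef !big_bool star_e pprod_lD !pprod_l_pure.
rewrite (star_e j k) pprod_rD !pprod_r_pure.
rewrite -[e1]/(e false) -[e2]/(e true) !star_e !Delta_idHD !id_DeltaHD !Delta_idH_pure !id_DeltaH_pure.
rewrite !scalerDr !pureH_scale.
rewrite !pureHDl. rewrite !pureHN.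
exact: sub_shuffle.
Qed.

(** By trilinearity of the associator the identity follows from its instances on
basis vectors, whose coefficients can be compared because the base change of a
free module is free. *)
Lemma left_prelie_coef : left_prelie star <->
  forall i j k n, assoc_coef g i j k n = swap12 (assoc_coef g j i k n).
Proof.
have swapE i j k : swap12H (associator star (e j) (e i) (e k)) =
    pureH (@Delta3 K L) (swap12 (assoc_coef g j i k false)) e1
    + pureH (@Delta3 K L) (swap12 (assoc_coef g j i k true)) e2.
  by rewrite associator_e swap12HD !swap12H_pure.
split=> [prelie i j k n|gP].
  have := prelie (e i) (e j) (e k); rewrite -!/(associator _ _ _ _) swapE associator_e.
  by case/(free_tensH_inj e_basis) => ? ?; case: n.
move=> x y z; rewrite -!/(associator _ _ _ _).
have [c [cP _]] := free_basis2_coords e_basis.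
have T i j k : associator star (e i) (e j) (e k) = swap12H (associator star (e j) (e i) (e k)).
  by rewrite swapE associator_e !(gP i j).
have TZ h h' h'' i j k : associator star (h *: e i) (h' *: e j) (h'' *: e k) =
    swap12H (associator star (h' *: e j) (h *: e i) (h'' *: e k)).
  by rewrite !associatorZ swap12HZ -T swap12_ox.
have TD3 h h' i j z' : associator star (h *: e i) (h' *: e j) z' =
    swap12H (associator star (h' *: e j) (h *: e i) z').
  rewrite (cP z') !associatorDr swap12HD.
  by rewrite (TZ _ _ _ i j false) (TZ _ _ _ i j true).
have TD2 h i y' z' : associator star (h *: e i) y' z' = swap12H (associator star y' (h *: e i) z').
  rewrite (cP y') associatorDl associatorDm swap12HD.
  by rewrite (TD3 _ _ i false) (TD3 _ _ i true).
rewrite (cP x) associatorDl associatorDm swap12HD.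
by rewrite (TD2 _ false) (TD2 _ true).
Qed.

End StructureConstants.

(** * Permuting the tensor factors *)

Section Slots.
Variables (K : fieldType) (L : lieAlgType K).
Local Notation H := 'U(L).
Implicit Types (w : UU L) (P : UUU L).

Fact ox_1r_linear : linear (@ox_1r K L).
Proof. by move=> a u w; rewrite ox_1rD /ox_1r oxZl. Qed.
Fact ox_1r_monoid : GRing.monoid_morphism (@ox_1r K L).
Proof. by split=> [|u w]; [rewrite /ox_1r ox1|exact: ox_1rM]. Qed.
HB.instance Definition _ := GRing.isLinear.Build K (UU L) (UUU L) _ (@ox_1r K L) ox_1r_linear.
HB.instance Definition _ := GRing.isMonoidMorphism.Build (UU L) (UUU L) (@ox_1r K L) ox_1r_monoid.

Fact ox_1l_linear : linear (@ox_1l K L).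
Proof. by move=> a u w; rewrite ox_1lD /ox_1l oxZr linearZ. Qed.
Fact ox_1l_monoid : GRing.monoid_morphism (@ox_1l K L).
Proof. by split=> [|u w]; [rewrite /ox_1l ox1 rmorph1|exact: ox_1lM]. Qed.
HB.instance Definition _ := GRing.isLinear.Build K (UU L) (UUU L) _ (@ox_1l K L) ox_1l_linear.
HB.instance Definition _ := GRing.isMonoidMorphism.Build (UU L) (UUU L) (@ox_1l K L) ox_1l_monoid.

Lemma swap12K : involutive (@swap12 K L).
Proof.
apply: ox_ext => [P Q|//|w f]; first by rewrite !rmorphD.
elim/ox_ind: w => [|u w IHu IHw|h g]; first by rewrite [0 \ox _]pure0l !rmorph0.
  by rewrite oxDl !rmorphD /= IHu IHw.
by rewrite !swap12_ox.
Qed.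

Lemma swapK_Delta (h : H) : swapK (Delta h) = Delta h.
Proof.
pose f : {lrmorphism H -> UU L} := (@swapK K H H) \o (@Delta K L).
rewrite -[LHS]/(f h); apply: env_ext => x.
by rewrite /f /= Delta_gen rmorphD /= !swapK_ox addrC.
Qed.

Lemma swapKK (w : UU L) : swapK (swapK w) = w.
Proof.
move: w; apply: ox_ext => [P Q|//|h g]; first by rewrite !rmorphD.
by rewrite !swapK_ox.
Qed.

Lemma swap12_Delta_id (w : UU L) : swap12 (Delta_id w) = Delta_id w.
Proof.
move: w; apply: ox_ext => [u w|u w|f g]; rewrite ?rmorphD //.
by rewrite Delta_id_ox [LHS]mapK_ox /= swapK_Delta.
Qed.

Lemma swap12_ox_1r (w : UU L) : swap12 (ox_1r w) = ox_1r (swapK w).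
Proof. exact: mapK_ox. Qed.

(** Sends [f \ox h \ox g] to [g \ox f \ox h]: the degree of the middle
factor becomes the degree in the last one. *)
Definition rot3 : UUU L -> UUU L := @assocK K H H H \o @swapK K (UU L) H.
HB.instance Definition _ := GRing.LRMorphism.on rot3.

Lemma swap12B (P Q : UUU L) : swap12 (P - Q) = swap12 P - swap12 Q. Proof. exact: raddfB. Qed.
Lemma swap12D (P Q : UUU L) : swap12 (P + Q) = swap12 P + swap12 Q. Proof. exact: raddfD. Qed.
Lemma swap12N (P : UUU L) : swap12 (- P) = - swap12 P. Proof. exact: raddfN. Qed.
Lemma swap12M (P Q : UUU L) : swap12 (P * Q) = swap12 P * swap12 Q. Proof. exact: rmorphM. Qed.
Lemma swap12Z (a : K) (P : UUU L) : swap12 (a *: P) = a *: swap12 P. Proof. exact: linearZ. Qed.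
Lemma rot3B (P Q : UUU L) : rot3 (P - Q) = rot3 P - rot3 Q. Proof. exact: raddfB. Qed.
Lemma rot3D (P Q : UUU L) : rot3 (P + Q) = rot3 P + rot3 Q. Proof. exact: raddfD. Qed.
Lemma rot3N (P : UUU L) : rot3 (- P) = - rot3 P. Proof. exact: raddfN. Qed.
Lemma rot3M (P Q : UUU L) : rot3 (P * Q) = rot3 P * rot3 Q. Proof. exact: rmorphM. Qed.
Lemma rot3Z (a : K) (P : UUU L) : rot3 (a *: P) = a *: rot3 P. Proof. exact: linearZ. Qed.
Lemma ox_1lB (P Q : UU L) : ox_1l (P - Q) = ox_1l P - ox_1l Q. Proof. exact: raddfB. Qed.
Lemma ox_1lN (P : UU L) : ox_1l (- P) = - ox_1l P. Proof. exact: raddfN. Qed.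
Lemma ox_1lZ (a : K) (P : UU L) : ox_1l (a *: P) = a *: ox_1l P. Proof. exact: linearZ. Qed.
Lemma Delta_idZ (a : K) (P : UU L) : Delta_id (a *: P) = a *: Delta_id P. Proof. exact: linearZ. Qed.
Lemma id_DeltaB (P Q : UU L) : id_Delta (P - Q) = id_Delta P - id_Delta Q. Proof. exact: raddfB. Qed.
Lemma id_DeltaD (P Q : UU L) : id_Delta (P + Q) = id_Delta P + id_Delta Q. Proof. exact: raddfD. Qed.
Lemma id_DeltaZ (a : K) (P : UU L) : id_Delta (a *: P) = a *: id_Delta P. Proof. exact: linearZ. Qed.
Lemma ox_1rB (P Q : UU L) : ox_1r (P - Q) = ox_1r P - ox_1r Q. Proof. exact: raddfB. Qed.
Lemma ox_1rZ (a : K) (P : UU L) : ox_1r (a *: P) = a *: ox_1r P. Proof. exact: linearZ. Qed.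

Lemma rot3_ox (f h g : H) : rot3 ((f \ox h) \ox g) = (g \ox f) \ox h.
Proof. by rewrite /rot3 /= swapK_ox assocK_ox. Qed.

End Slots.

Section SlotDegrees.
Variables (K : fieldType) (L : finDimLieAlgType K).
Local Notation H := 'U(L).
Implicit Types (w : UU L).

Definition counitl : UU L -> H := @counitr K L H \o @swapK K H H.
HB.instance Definition _ := GRing.LRMorphism.on counitl.

Lemma counitl_ox (f g : H) : counitl (f \ox g) = (counit f : K) *: g.
Proof. by rewrite /counitl /= swapK_ox counitr_ox. Qed.

Lemma counitr_Delta (h : H) : counitr (Delta h) = h.
Proof.
pose f : {lrmorphism H -> H} := (@counitr K L H) \o (@Delta K L).
pose g : {lrmorphism H -> H} := idfun.
rewrite -[LHS]/(f h) -[RHS]/(g h); apply: env_ext => x; rewrite /f /g /=.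
by rewrite Delta_gen rmorphD /= !counitr_ox counit_gen rmorph1 scale1r scale0r addr0.
Qed.

Lemma counitl_Delta (h : H) : counitl (Delta h) = h.
Proof. by rewrite /counitl /= swapK_Delta counitr_Delta. Qed.

Lemma rot3_ox_1l w : rot3 (ox_1l w) = zmap (@tens_inl K H H) (swapK w).
Proof.
move: w; apply: ox_ext => [u w|u w|f g]; rewrite ?rmorphD //.
by rewrite ox_1l_ox rot3_ox swapK_ox zmap_ox.
Qed.

Lemma rot3_ox_1r w : rot3 (ox_1r w) = zmap (@tens_inr K H H) w.
Proof.
move: w; apply: ox_ext => [u w|u w|f g]; rewrite ?rmorphD //.
by rewrite /ox_1r rot3_ox zmap_ox.
Qed.

Lemma rot3_Delta_id w : rot3 (Delta_id w) = id_Delta (swapK w).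
Proof.
move: w; apply: ox_ext => [u w|u w|f g]; rewrite ?rmorphD //.
rewrite Delta_id_ox swapK_ox id_Delta_ox; move: (Delta f).
apply: ox_ext => [u w|u w|x y]; rewrite ?(oxDl, oxDr) ?rmorphD //.
by rewrite rot3_ox assocK_ox.
Qed.

Lemma rot3_id_Delta w : rot3 (swap12 (id_Delta w)) = zmap (@Delta K L) (swapK w).
Proof.
move: w; apply: ox_ext => [u w|u w|f g]; rewrite ?rmorphD //.
rewrite id_Delta_ox swapK_ox zmap_ox /= -[in RHS]swapK_Delta; move: (Delta g).
apply: ox_ext => [u w|u w|x y]; rewrite ?(oxDl, oxDr) ?rmorphD ?(oxDl, oxDr) //.
by rewrite assocK_ox swap12_ox rot3_ox swapK_ox.
Qed.

(** Applying a counit to one of the two factors made by [Delta] recovers [w]. This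
bounds the degree of [w] by that of [(id (x) Delta) w] in the middle factor, and
by [zmap_id_Delta] below in the last. *)
Lemma zmap_rot3_id_Delta w : zmap counitl (rot3 (id_Delta w)) = w.
Proof.
move: w; apply: ox_ext => [u w|//|f g]; rewrite ?rmorphD //.
rewrite id_Delta_ox -[in RHS](counitr_Delta g); move: (Delta g).
apply: ox_ext => [u w|u w|x y]; rewrite ?(oxDl, oxDr) ?rmorphD ?(oxDl, oxDr) //.
by rewrite assocK_ox rot3_ox zmap_ox /= counitl_ox counitr_ox oxZl oxZr.
Qed.

Lemma zmap_id_Delta w : zmap (@counitr K L H) (id_Delta w) = w.
Proof.
move: w; apply: ox_ext => [u w|//|f g]; rewrite ?rmorphD //.
rewrite id_Delta_ox -[in RHS](counitl_Delta g); move: (Delta g).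
apply: ox_ext => [u w|u w|x y]; rewrite ?(oxDl, oxDr) ?rmorphD ?(oxDl, oxDr) //.
by rewrite assocK_ox zmap_ox /= counitr_ox counitl_ox oxZl oxZr.
Qed.

Lemma zdeg_id_Delta w : (zdeg (id_Delta w) <= zdeg w)%N.
Proof.
rewrite -[id_Delta w](subrK (zmap (@tens_inl K H H) w)); apply: zdegD_leq.
  by apply: leq_trans (zdeg_id_Delta_lead w) _; exact: leq_pred.
exact: zdeg_zmap.
Qed.

Lemma tens_inlK (A : algType K) : cancel (@tens_inl K A H) (@counitr K L A).
Proof. by move=> a; rewrite [LHS]counitr_ox rmorph1 scale1r. Qed.

Lemma tens_inrK : cancel (@tens_inr K H H) counitl.
Proof. by move=> a; rewrite [LHS]counitl_ox rmorph1 scale1r. Qed.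

Lemma zdeg_rot3_ox_1l w : zdeg (rot3 (ox_1l w)) = zdeg (swapK w).
Proof. by rewrite rot3_ox_1l zdeg_zmap_inj //; exact: can_inj (@tens_inlK H). Qed.

Lemma zdeg_rot3_ox_1r w : zdeg (rot3 (ox_1r w)) = zdeg w.
Proof. by rewrite rot3_ox_1r zdeg_zmap_inj //; exact: can_inj tens_inrK. Qed.

End SlotDegrees.

Section Cancellation.
Variables (K : fieldType) (L : finDimLieAlgType K) (A : algType K).
Local Notation H := 'U(L).
Hypothesis domA : no_zero_divisors A.
Implicit Types P Q : A \OX H.

Lemma zdeg_cancell P Q (b : nat) : P != 0 -> (0 < b)%N ->
  (zdeg (P * Q)%R <= (zdeg P + b).-1)%N -> (zdeg Q <= b)%N.
Proof.
move=> P0 b0; have [->|Q0] := eqVneq Q 0; first by rewrite zdeg0.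
rewrite zdegM //; rewrite -zdeg_eq0 in P0; move: (zdeg P) (zdeg Q) P0 b0 => p q.
lia.
Qed.

Lemma zdeg_cancelr P Q : Q != 0 -> (zdeg (P * Q)%R <= 1)%N -> (zdeg P <= 1)%N.
Proof.
move=> Q0; have [->|P0] := eqVneq P 0; first by rewrite zdeg0.
rewrite zdegM //; rewrite -zdeg_eq0 in Q0; move: (zdeg P) (zdeg Q) Q0 => p q.
lia.
Qed.

End Cancellation.

(** * The pre-Lie identity in coordinates *)

(** The equations and their solutions use the four maps [p : w -> w_12],
[l : w -> w_23], [d = Delta (x) id], [e = id (x) Delta] and the flip [sg] of the
first two factors only through the identities assumed here, with
[S = 1 \ox s], [y = 1 \ox s \ox 1] and [z = 1 \ox 1 \ox s]. Among
them, [sg \o d = d] is cocommutativity and [e S = y + z] is primitivity. *)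
Section System.
Variables (K : fieldType) (R T : algType K).
Variables (p l d e : {lrmorphism R -> T}) (sg : {lrmorphism T -> T}).
Variables (S : R) (y z : T) (t : K).
Hypotheses (sgK : involutive sg) (sg_d : forall w, sg (d w) = d w).
Hypotheses (pS : p S = y) (lS : l S = z) (dS : d S = z) (eS : e S = y + z) (yz : y * z = z * y).

Definition structure_constants (A B C D : R) (i j k : bool) : R :=
  match i, j, k with
  | false, false, false => t *: 1
  | false, false, true => 0
  | false, true, false => A
  | false, true, true => B
  | true, false, false => C
  | true, false, true => D
  | true, true, false => 0
  | true, true, true => S
  end.

Definition gen_assoc (g : bool -> bool -> bool -> R) (i j k n : bool) : T :=
  \sum_(m : bool) (p (g i j m) * d (g m k n) - l (g j k m) * e (g i m n)).

(** The equations of the first half come from the triples (1,1,2) for the first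
two and (2,2,1) for the last two, those of the second half from (1,2,1) and
(1,2,2). In each pair the first equation compares coefficients of [e1], except
for (1,1,2), where it compares those of [e2]. *)
Definition prelie_system (A B C D : R) : Prop :=
  [/\ sg (l B * e B) = l B * e B,
      sg ((t *: 1) * l A + l B * e A) = (t *: 1) * l A + l B * e A,
      sg (y * d C - l C * e C) = y * d C - l C * e C
    & sg (y * d D - l D * (y + z) - l C * e D) = y * d D - l D * (y + z) - l C * e D]
  /\
  [/\ (t *: 1) * p A + p B * d C - (t *: 1) * l C - l D * e A
        = sg ((t *: 1) * p C + p D * d C - (t *: 1) * e C),
      p B * d D - l D * e B = sg (p D * d D - (t *: 1) * e D),
      p A * d A - z * e A = sg (p C * d A - l A * e C)
    & p A * d B + p B * z - z * e B
        = sg (p C * d B + p D * z - l A * e D - l B * (y + z))].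

Lemma sub_pairs (V : zmodType) (a b c c' : V) : a - c + (b - c') = b + a - c' - c.
Proof. by rewrite addrACA addrA [a + b]addrC addrAC. Qed.

Lemma gen_assocE g i j k n : gen_assoc g i j k n =
  p (g i j false) * d (g false k n) + p (g i j true) * d (g true k n)
  - l (g j k false) * e (g i false n) - l (g j k true) * e (g i true n).
Proof. by rewrite /gen_assoc big_bool /= sub_pairs. Qed.

Section Expand.
Variables A B C D : R.
Local Notation g := (structure_constants A B C D).
Local Notation ac := (gen_assoc g).

Let fZ (f : {lrmorphism R -> T}) : f (t *: 1) = t *: 1.
Proof. by rewrite linearZ rmorph1. Qed.
Let f0 (f : {lrmorphism R -> T}) : f 0 = 0. Proof. exact: raddf0. Qed.
Let scale1_mull (P : T) : (t *: 1) * P = t *: P.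
Proof. by rewrite -scalerAl mul1r. Qed.
Let scale1_mulr (P : T) : P * (t *: 1) = t *: P.
Proof. by rewrite -scalerAr mulr1. Qed.
Let simp := (fZ, f0, scale1_mull, scale1_mulr, pS, lS, dS, eS, scaler0, oppr0,
  mul0r, mulr0, addr0, add0r, subr0, sub0r).

Lemma sym_subl P Q : sg P = P -> sg (P - Q) = P - Q <-> sg Q = Q.
Proof. by rewrite rmorphB /= => ->; split=> [/addrI/oppr_inj|->]. Qed.

(** Of the sixteen equations, those for (j,i,k) are the images under [sg] of those
for (i,j,k). The ones for (1,1,1) and (2,2,2) hold because [e1] and [e2]
span pre-Lie subalgebras, and [d A] and [d B] drop out of the symmetry
conditions for (1,1,2). *)
Lemma prelie_systemP :
  (forall i j k n, ac i j k n = sg (ac j i k n)) <-> prelie_system A B C D.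
Proof.
rewrite /prelie_system !scale1_mull; have sg_td w : sg (t *: d w) = t *: d w by rewrite linearZ /= sg_d.
have a000 : ac false false false false = 0 by rewrite gen_assocE /= !simp subrr.
have a001 : ac false false false true = 0 by rewrite gen_assocE /= !simp.
have a010 : ac false false true false = t *: d A - (t *: l A + l B * e A).
  by rewrite gen_assocE /= !simp opprD addrA.
have a011 : ac false false true true = t *: d B - l B * e B.
  by rewrite gen_assocE /= !simp.
have a100 : ac true true false false = y * d C - l C * e C by rewrite gen_assocE /= !simp.
have a101 : ac true true false true = y * d D - l D * (y + z) - l C * e D.
  by rewrite gen_assocE /= !simp addrAC.
have a110 : ac true true true false = 0 by rewrite gen_assocE /= !simp.
have a111 : ac true true true true = y * z - z * (y + z).
  by rewrite gen_assocE /= !simp.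
have b00 : ac false true false false = t *: p A + p B * d C - t *: l C - l D * e A.
  by rewrite gen_assocE /= !simp.
have b01 : ac false true false true = p B * d D - l D * e B.
  by rewrite gen_assocE /= !simp.
have b10 : ac false true true false = p A * d A - z * e A.
  by rewrite gen_assocE /= !simp.
have b11 : ac false true true true = p A * d B + p B * z - z * e B.
  by rewrite gen_assocE /= !simp.
have c00 : ac true false false false = t *: p C + p D * d C - t *: e C.
  by rewrite gen_assocE /= !simp.
have c01 : ac true false false true = p D * d D - t *: e D.
  by rewrite gen_assocE /= !simp.
have c10 : ac true false true false = p C * d A - l A * e C.
  by rewrite gen_assocE /= !simp.
have c11 : ac true false true true = p C * d B + p D * z - l A * e D - l B * (y + z).
  by rewrite gen_assocE /= !simp.
split=> [E|[[Q1 Q2 Q3 Q4] [Q5 Q6 Q7 Q8]]].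
  split; split.
  - by apply/(sym_subl _ (sg_td B)); rewrite -a011 -E.
  - by apply/(sym_subl _ (sg_td A)); rewrite -a010 -E.
  - by rewrite -a100 -E.
  - by rewrite -a101 -E.
  - by rewrite -b00 -c00.
  - by rewrite -b01 -c01.
  - by rewrite -b10 -c10.
  - by rewrite -b11 -c11.
have E01 k n : ac false true k n = sg (ac true false k n).
  case: k n => [] []; by rewrite ?(b00, b01, b10, b11, c00, c01, c10, c11).
case=> [] [] k n; last first.
- case: k n => [] []; rewrite ?a000 ?a001 ?raddf0 //.
    by apply/esym; rewrite a011; apply/sym_subl.
  by apply/esym; rewrite a010; apply/sym_subl.
- exact: E01.
- by rewrite E01 sgK.
case: k n => [] []; rewrite ?a110 ?raddf0 ?a100 ?a101 //.
have sgz : sg z = z by rewrite -dS sg_d.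
by rewrite a111 mulrDr yz opprD addrA subrr add0r rmorphN rmorphM /= sgz.
Qed.
End Expand.

(** The four types as solutions of the system; here [s1] and [x] stand for
[s \ox 1] and [s \ox 1 \ox 1]. *)
Section Solutions.
Variables (s1 : R) (x : T).
Hypotheses (ps : p s1 = x) (ls : l s1 = y) (ds : d s1 = x + y) (es : e s1 = x).
Hypotheses (sgx : sg x = y) (xz : x * z = z * x).

Let fZ (f : {lrmorphism R -> T}) : f (t *: 1) = t *: 1.
Proof. by rewrite linearZ rmorph1. Qed.
Let f0 (f : {lrmorphism R -> T}) : f 0 = 0. Proof. exact: raddf0. Qed.
Let fD (f : {lrmorphism R -> T}) u v : f (u + v) = f u + f v. Proof. exact: raddfD. Qed.
Let scale1_mull (P : T) : (t *: 1) * P = t *: P.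
Proof. by rewrite -scalerAl mul1r. Qed.
Let scale1_mulr (P : T) : P * (t *: 1) = t *: P.
Proof. by rewrite -scalerAr mulr1. Qed.
Let sgz : sg z = z. Proof. by rewrite -dS sg_d. Qed.
Let sgy : sg y = x. Proof. by rewrite -sgx sgK. Qed.
Let sg0 : sg 0 = 0. Proof. exact: raddf0. Qed.
Let sgZ a P : sg (a *: P) = a *: sg P. Proof. exact: linearZ. Qed.
Let sgN P : sg (- P) = - sg P. Proof. exact: raddfN. Qed.
Let sgM P Q : sg (P * Q) = sg P * sg Q. Proof. exact: rmorphM. Qed.
Let sgD P Q : sg (P + Q) = sg P + sg Q. Proof. exact: raddfD. Qed.
Let sg1 : sg 1 = 1. Proof. exact: rmorph1. Qed.
Let simp := (fZ, f0, fD, scale1_mull, scale1_mulr, pS, lS, dS, eS, ps, ls, ds, es, scaler0, oppr0,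
  mul0r, mulr0, addr0, add0r, subr0, sub0r).
Let sgE := (sgN, sgM, sgZ, sgD, sgx, sgy, sgz, sg0, sg1).

Lemma prelie_zero : prelie_system 0 0 0 0.
Proof. by split; split; rewrite !simp ?sg0. Qed.

Let yz_z : y * z - z * (y + z) = - (z * z).
Proof. by rewrite mulrDr yz opprD addrA subrr add0r. Qed.

Lemma prelie_right : prelie_system 0 0 S 0.
Proof.
split; split; rewrite !simp ?sg0 //; first by rewrite yz_z !sgE.
by rewrite scalerDr opprD addrA subrr add0r !sgE.
Qed.

Lemma prelie_right_left : prelie_system 0 (t *: 1) S (t *: 1).
Proof.
split; split; rewrite !simp ?sg0 ?subrr ?sg0 //.
- by rewrite !sgE.
- by rewrite yz_z !sgE.
- by rewrite scalerDr opprD addrA subrr sub0r !sgE.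
- by rewrite -scalerDr subrr sg0.
- by rewrite -scalerDr subrr sg0.
Qed.

Lemma prelie_coproduct : prelie_system S 0 (S + s1) 0.
Proof.
have yxz : y * (z + (x + y)) - (z + y) * (y + z + x) = - (z * (x + y + z)).
  rewrite [z + _]addrC (addrC (y + z)) addrA.
  by rewrite mulrDl opprD addrCA subrr addr0.
have sub_z : y + x - (y + z + x) = - z.
  by rewrite (addrAC y z x) opprD addrA subrr add0r.
split; split; rewrite !simp ?sg0 //.
- by rewrite sgZ sgz.
- by rewrite yxz !sgE (addrC y).
- rewrite -!scalerBr sgZ; congr (_ *: _).
  by rewrite sub_z sgN sgz opprD addrCA subrr addr0.
- have -> : (y + x) * z = z * (y + x) by rewrite mulrDl mulrDr yz xz.
  by rewrite -mulrBr sub_z mulrN yz_z !sgE.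
Qed.

End Solutions.
End System.

(** * The coefficients of e2: B and D *)

Lemma ox0l (K : fieldType) (V W : lmodType K) (w : W) : (0 : V) \ox w = 0.
Proof. exact: pure0l. Qed.
Lemma ox0r (K : fieldType) (V W : lmodType K) (v : V) : v \ox (0 : W) = 0.
Proof. exact: pure0r. Qed.
Lemma oxNl (K : fieldType) (V W : lmodType K) (v : V) (w : W) : (- v) \ox w = - (v \ox w).
Proof. exact: pureNl. Qed.
Lemma oxNr (K : fieldType) (V W : lmodType K) (v : V) (w : W) : v \ox (- w) = - (v \ox w).
Proof. exact: pureNr. Qed.

Section Solve.
Variables (K : fieldType) (L : finDimLieAlgType K).
Local Notation H := 'U(L).
Implicit Types (w : UU L) (b d h : H).

Let nzd2 : no_zero_divisors (UU L). Proof. exact: nzd_tensor (@nzd_env K L). Qed.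

Lemma swapK_eq0 w : (swapK w == 0) = (w == 0).
Proof. by apply/eqP/eqP => [w0|->]; [rewrite -(swapKK w) w0|]; rewrite linear0. Qed.

Lemma rot3_swap_ox_1l w : rot3 (swap12 (ox_1l w)) = swapK w \ox 1.
Proof.
move: w; apply: ox_ext => [u w|u w|f g]; first by rewrite !rmorphD.
  by rewrite rmorphD oxDl.
by rewrite ox_1l_ox swap12_ox rot3_ox swapK_ox.
Qed.

Lemma rot3_swap_ox_1r w : rot3 (swap12 (ox_1r w)) = zmap (@tens_inr K H H) (swapK w).
Proof. by rewrite swap12_ox_1r rot3_ox_1r. Qed.

Lemma zdeg_rot3_swap_ox_1r w : zdeg (rot3 (swap12 (ox_1r w))) = zdeg (swapK w).
Proof. by rewrite swap12_ox_1r zdeg_rot3_ox_1r. Qed.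

(** Before the flip, the middle degree of the product is the degree of [w] in the
first factor plus the middle degree of [(id (x) Delta) w]; after the flip it is
the degree of [w] in the first factor alone. So [(id (x) Delta) w] has middle
degree [0], and [w] has degree [0] in the last factor. *)
Lemma B_first_slot w : swap12 (ox_1l w * id_Delta w) = ox_1l w * id_Delta w -> exists b, w = b \ox 1.
Proof.
have [-> _|w0 /(congr1 (@rot3 K L))] := eqVneq w 0; first by exists 0; rewrite ox0l.
rewrite swap12M !rot3M rot3_id_Delta rot3_swap_ox_1l => E.
have P0 : rot3 (ox_1l w) != 0 by rewrite -zdeg_eq0 zdeg_rot3_ox_1l zdeg_eq0 swapK_eq0.
apply: zdeg_leq1; rewrite -(zmap_rot3_id_Delta w).
apply: leq_trans (zdeg_zmap _ _) _; apply: (zdeg_cancell nzd2 P0) => //.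
rewrite -E zdeg_rot3_ox_1l addnC.
exact: zdegM_le2 (zdeg_ox1 L _) (zdeg_zmap _ _).
Qed.

Lemma zdegZ_leq (A : algType K) (a : K) (P : A \OX H) : (zdeg (a *: P) <= zdeg P)%N.
Proof.
have -> : a *: P = ((a *: 1) \ox 1) * P by rewrite oxZl ox1 -scalerAl mul1r.
by apply: leq_trans (zdegM_le2 (zdeg_ox1 L _) (leqnn _)) _; rewrite add1n.
Qed.

Lemma zmap_ox_1l w : zmap (@counitl K L) (ox_1l w) = w.
Proof.
move: w; apply: ox_ext => [u w|//|f g]; first by rewrite !rmorphD.
by rewrite ox_1l_ox zmap_ox /= counitl_ox rmorph1 scale1r.
Qed.

Lemma ox_1l_inj : injective (@ox_1l K L).
Proof. exact: can_inj zmap_ox_1l. Qed.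

Lemma id_Delta_ox1 b : id_Delta (b \ox 1) = (b \ox 1) \ox 1 :> UUU L.
Proof. by rewrite id_Delta_ox rmorph1 -ox1 assocK_ox. Qed.

Lemma id_Delta_1ox d : id_Delta (1 \ox d) = ox_1l (Delta d) :> UUU L.
Proof. exact: id_Delta_ox. Qed.

Lemma Delta_id_1ox d : Delta_id (1 \ox d) = 1 \ox d :> UUU L.
Proof. by rewrite Delta_id_ox rmorph1. Qed.

Lemma swap12_slot3 h : swap12 ((1 : UU L) \ox h) = 1 \ox h.
Proof. by rewrite -ox1 swap12_ox. Qed.

Lemma ox_1l_slot3 h : ox_1l (1 \ox h) = 1 \ox h :> UUU L.
Proof. by rewrite ox_1l_ox. Qed.

Lemma scale1_mull (a : K) (P : UUU L) : (a *: 1) * P = a *: P.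
Proof. by rewrite -scalerAl mul1r. Qed.
Lemma scale1_mulr (a : K) (P : UUU L) : P * (a *: 1) = a *: P.
Proof. by rewrite -scalerAr mulr1. Qed.

Lemma ox_1r_scale1 (a : K) : ox_1r (a *: 1) = a *: 1 :> UUU L.
Proof. by rewrite ox_1rZ [ox_1r 1]rmorph1. Qed.
Lemma ox_1l_scale1 (a : K) : ox_1l (a *: 1) = a *: 1 :> UUU L.
Proof. by rewrite ox_1lZ [ox_1l 1]rmorph1. Qed.
Lemma Delta_id_scale1 (a : K) : Delta_id (a *: 1) = a *: 1 :> UUU L.
Proof. by rewrite Delta_idZ [Delta_id 1]rmorph1. Qed.
Lemma id_Delta_scale1 (a : K) : id_Delta (a *: 1) = a *: 1 :> UUU L.
Proof. by rewrite id_DeltaZ [id_Delta 1]rmorph1. Qed.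
Lemma ox_1r0 : ox_1r 0 = 0 :> UUU L. Proof. exact: raddf0. Qed.
Lemma ox_1l0 : ox_1l 0 = 0 :> UUU L. Proof. exact: raddf0. Qed.
Lemma swap120 : swap12 0 = 0 :> UUU L. Proof. exact: raddf0. Qed.

Variable t : K.

(** Let [k] be the degree of [w] in the first factor. All terms other than the flip
of [w_12 (Delta (x) id) w] have middle degree at most [k], and the flip of
[w_12] has middle degree [k]. So [(Delta (x) id) w] has middle degree [0],
whence [k = 0]. *)
Lemma D_last_slot b w :
  ox_1r (b \ox 1) * Delta_id w - ox_1l w * id_Delta (b \ox 1)
    = swap12 (ox_1r w * Delta_id w - (t *: 1) * id_Delta w) -> exists d, w = 1 \ox d.
Proof.
rewrite scale1_mull.
have [-> _|w0 /(congr1 (@rot3 K L))] := eqVneq w 0; first by exists 0; rewrite ox0r.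
rewrite id_Delta_ox1 swap12B swap12M !rot3B !rot3M swap12_Delta_id.
rewrite -[(b \ox 1) \ox 1]/(ox_1r (b \ox 1)) rot3_ox_1r zmap_ox rot3_Delta_id.
set w' := swapK w => E.
have w'0 : w' != 0 by rewrite swapK_eq0.
have P0 : rot3 (swap12 (ox_1r w)) != 0.
  by rewrite -zdeg_eq0 zdeg_rot3_swap_ox_1r zdeg_eq0.
have zP := zdeg_rot3_swap_ox_1r w; rewrite -/w' in zP.
have Qw' : (zdeg (id_Delta w') <= 1)%N.
  apply: (zdeg_cancell nzd2 P0) => //.
  have -> : rot3 (swap12 (ox_1r w)) * id_Delta w'
     = tens_inr H b \ox 1 * id_Delta w' - rot3 (ox_1l w) * (tens_inr H b \ox 1)
       + rot3 (swap12 (t *: id_Delta w)).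
    exact: (canRL (subrK _) (esym E)).
  rewrite zP addn1 /=; apply: zdegD_leq; first apply: zdegB_leq.
  - exact: zdegM_le2 (zdeg_ox1 L _) (zdeg_id_Delta w').
  - rewrite -[zdeg w']/((zdeg w').+1.-1) -addn1.
    by apply: zdegM_le2 (zdeg_ox1 L _); rewrite zdeg_rot3_ox_1l.
  - rewrite swap12Z rot3Z rot3_id_Delta -/w'.
    exact: leq_trans (zdegZ_leq _ _) (zdeg_zmap _ _).
have : (zdeg w' <= 1)%N.
  by rewrite -(zmap_id_Delta w') (leq_trans (zdeg_zmap _ _)).
case/zdeg_leq1 => d w'E; exists d.
by rewrite -[w]swapKK -/w' w'E swapK_ox.
Qed.

(** The equation is [d \ox d = t Delta d]. So [(d - t) \ox d] is [t] times
[Delta d - 1 \ox d], whose degree in the last factor is less than that of [d]. *)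
Lemma D_scalar b d :
  ox_1r (b \ox 1) * Delta_id (1 \ox d) - ox_1l (1 \ox d) * id_Delta (b \ox 1)
    = swap12 (ox_1r (1 \ox d) * Delta_id (1 \ox d) - (t *: 1) * id_Delta (1 \ox d)) ->
  d = 0 \/ d = t *: 1.
Proof.
rewrite scale1_mull id_Delta_ox1 Delta_id_1ox id_Delta_1ox ox_1l_ox /ox_1r !oxM !mulr1 !mul1r subrr.
rewrite -[0]swap12K rmorph0 => /(can_inj (@swap12K K L))/esym/eqP.
rewrite subr_eq0 -ox_1l_ox -ox_1lZ => /eqP/ox_1l_inj E.
have [->|d0] := eqVneq d 0; [by left|right].
apply/eqP; rewrite -subr_eq0; apply/negPn/negP => dt0.
have := zdeg_ox_eq d dt0.
have -> : (d - t *: 1) \ox d = t *: (Delta d - 1 \ox d).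
  by rewrite oxDl oxNl oxZl E scalerBr.
have := leq_trans (zdegZ_leq t _) (zdeg_Delta_lead d).
by rewrite -symb_eq0 in d0; move=> le1 e1; rewrite e1 in le1; lia.
Qed.

End Solve.

(** * The equations left when B and D are known *)

Lemma zmod_cancel_common (V : zmodType) (v p q r x y : V) :
  v - p - q = v + x - y - (q + r) -> y = x + p - r.
Proof.
rewrite opprD [RHS]addrA [RHS]addrAC => /addIr.
rewrite -!addrA => /addrI E; apply: (addIr (- p)).
by rewrite {1}E addrCA addNKr -[RHS]addrA [p - r + _]addrAC subrr add0r.
Qed.

Section Solve.
Variables (K : fieldType) (L : finDimLieAlgType K).
Local Notation H := 'U(L).
Implicit Types (w A C : UU L) (a b d h : H).
Variables (S : H) (t : K).
Hypotheses (t_neq0 : t != 0) (S_eps : counit S = 0).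
Local Notation y := ((1 \ox S) \ox 1 : UUU L).
Local Notation z := ((1 : UU L) \ox S).

Lemma counitr_ox_1r w : counitr (ox_1r w) = w.
Proof. exact: tens_inlK. Qed.

Lemma counitr_ox1 (A : algType K) (a : A) : counitr (a \ox (1 : H)) = a.
Proof. exact: tens_inlK. Qed.

Lemma zmap_counitr_ox_1r w : zmap (@counitr K L H) (ox_1r w) = counitr w \ox 1.
Proof. exact: zmap_ox. Qed.

Lemma counitr_S (A : algType K) (a : A) : counitr (a \ox S) = 0.
Proof. by rewrite counitr_ox S_eps scale0r. Qed.

Lemma zmap_counitr_swap_ox_1l w : zmap (@counitr K L H) (swap12 (ox_1l w)) = w.
Proof.
move: w; apply: ox_ext => [u w|//|f g]; first by rewrite ox_1lD !raddfD.
by rewrite ox_1l_ox swap12_ox zmap_ox /= counitr_ox rmorph1 scale1r.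
Qed.

Lemma counitr_swap_ox_1l w : counitr (swap12 (ox_1l w)) = counitr w \ox 1.
Proof.
move: w; apply: ox_ext => [u w|u w|f g]; first by rewrite ox_1lD !raddfD.
  by rewrite raddfD oxDl.
by rewrite ox_1l_ox swap12_ox !counitr_ox oxZl.
Qed.

(** After simplification the only term whose third factor is neither [1] nor [s] is
[A_13]. Applying the counit to the third factor gives the second relation;
putting it back and applying the counit to the second factor gives the first. *)
Lemma A_C_from_B A C b (dl : K) (B := b \ox 1 : UU L) (D := dl *: 1 : UU L) :
  ox_1r A * Delta_id B + ox_1r B * z - z * id_Delta B
    = swap12 (ox_1r C * Delta_id B + ox_1r D * z - ox_1l A * id_Delta D - ox_1l B * (y + z)) ->
  dl *: A = dl *: (1 \ox S) + dl *: (counitr A \ox 1) - b \ox S /\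
  A * Delta b = swapK C * Delta b - dl *: (counitr A \ox 1) - (b * S) \ox 1.
Proof.
have lhs : ox_1r A * Delta_id B + ox_1r B * z - z * id_Delta B = ox_1r (A * Delta b).
  rewrite /B id_Delta_ox1 Delta_id_ox -[Delta b \ox 1]/(ox_1r (Delta b)) -ox_1rM.
  have -> : ox_1r (b \ox 1) * z = (b \ox 1) \ox S by rewrite /ox_1r oxM mulr1 mul1r.
  by rewrite oxM mulr1 mul1r addrK.
have rhs : swap12 (ox_1r C * Delta_id B + ox_1r D * z - ox_1l A * id_Delta D - ox_1l B * (y + z))
   = ox_1r (swapK C * Delta b) + dl *: z - dl *: swap12 (ox_1l A)
     - (ox_1r ((b * S) \ox 1) + (b \ox 1) \ox S).
  have -> : ox_1l B * (y + z) = (1 \ox (b * S)) \ox 1 + (1 \ox b) \ox S.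
    by rewrite /B ox_1l_ox mulrDr !oxM !mulr1 !mul1r.
  have -> : ox_1r C * Delta_id B = ox_1r (C * Delta b).
    by rewrite /B Delta_id_ox ox_1rM.
  have -> : ox_1r D * z = dl *: z by rewrite /D ox_1r_scale1 scale1_mull.
  have -> : ox_1l A * id_Delta D = dl *: ox_1l A by rewrite /D id_Delta_scale1 scale1_mulr.
  rewrite !swap12B !swap12D !swap12Z swap12_ox_1r.
  rewrite swap12_slot3.
  rewrite !swap12_ox.
  by rewrite rmorphM /= swapK_Delta.
rewrite lhs {}rhs => E.
have E1 : A * Delta b = swapK C * Delta b - dl *: (counitr A \ox 1) - (b * S) \ox 1.
  have := congr1 (@counitr K L (UU L)) E; rewrite counitr_ox_1r => ->.
  rewrite !counitrB !counitrD !counitrZ !counitr_ox_1r !counitr_S counitr_swap_ox_1l.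
  by rewrite scaler0 !addr0.
split=> //.
have := congr1 (zmap (@counitr K L H)) E; rewrite E1 zmap_counitr_ox_1r.
rewrite !zmapB !zmapD !zmapZ !zmap_counitr_ox_1r zmap_counitr_swap_ox_1l.
have -> : zmap (@counitr K L H) z = 1 \ox S by rewrite zmap_ox rmorph1.
have -> : zmap (@counitr K L H) ((b \ox 1) \ox S) = b \ox S.
  by rewrite zmap_ox /= counitr_ox1.
rewrite !counitrB !counitrZ !counitr_ox1 !oxDl !oxNl oxZl.
exact: zmod_cancel_common.
Qed.

(** [w_23] does not involve the first factor, so its flip does not involve the
second. *)
Lemma fixed_ox_1l w : swap12 (ox_1l w) = ox_1l w -> w = 1 \ox counitl w.
Proof.
move=> /(congr1 (zmap (@counitr K L H))); rewrite zmap_counitr_swap_ox_1l => E.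
rewrite [LHS]E; move: w {E}; apply: ox_ext => [u w|u w|f g].
- by rewrite ox_1lD zmapD.
- by rewrite raddfD oxDr.
by rewrite ox_1l_ox zmap_ox counitl_ox /= counitr_ox oxZl oxZr.
Qed.

Lemma counitr_id_Delta w : counitr (id_Delta w) = w.
Proof.
move: w; apply: ox_ext => [u w|//|f g]; first by rewrite id_DeltaD counitrD.
rewrite id_Delta_ox -[in RHS](counitr_Delta g); move: (Delta g).
apply: ox_ext => [u w|u w|x1 x2].
- by rewrite oxDr rmorphD counitrD.
- by rewrite counitrD oxDr.
by rewrite assocK_ox !counitr_ox oxZr.
Qed.

(** The equation for [C] alone says that [(id (x) Delta) C] is
[C_12 + C_13 - a_1]. So [c = C - a \ox 1] is primitive in its last factor, and
by this the remaining equation lives in the factors two and three only. *)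
Lemma D0_shape a C (A := 1 \ox a : UU L) :
  (t *: 1) * ox_1r A - (t *: 1) * ox_1l C = swap12 ((t *: 1) * ox_1r C - (t *: 1) * id_Delta C) ->
  ox_1r A * Delta_id A - z * id_Delta A
    = swap12 (ox_1r C * Delta_id A - ox_1l A * id_Delta C) ->
  exists c, [/\ C = a \ox 1 + c, counitr c = 0,
    id_Delta c = ox_1r c + swap12 (ox_1l c)
    & a \ox a + (1 \ox a) * c = (1 \ox S) * Delta a].
Proof.
rewrite !scale1_mull -scalerBr -[in X in _ = X]scalerBr swap12Z => /(scalerI t_neq0).
move/(congr1 (@swap12 K L)); rewrite swap12K swap12B swap12_ox_1r swapK_ox => E5 E7.
have dC : id_Delta C = ox_1r C + swap12 (ox_1l C) - ox_1r (a \ox 1).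
  by rewrite -[RHS]addrA -[_ - ox_1r (a \ox 1)]opprB E5 opprB addrC subrK.
have aC : counitr C = a.
  have := congr1 (@counitr K L (UU L)) dC.
  rewrite counitr_id_Delta counitrB counitrD !counitr_ox_1r counitr_swap_ox_1l.
  rewrite -[LHS]addr0 -addrA => /addrI/esym/eqP; rewrite subr_eq0 => /eqP.
  by move/(congr1 (@counitr K L H)); rewrite !counitr_ox1.
pose c := C - a \ox 1.
have iC : id_Delta (a \ox 1) = ox_1r (a \ox 1) :> UUU L by exact: id_Delta_ox1.
have sC : swap12 (ox_1l (a \ox 1)) = ox_1r (a \ox 1) :> UUU L.
  by rewrite ox_1l_ox swap12_ox.
have dc : id_Delta c = ox_1r c + swap12 (ox_1l c).
  rewrite /c id_DeltaB dC ox_1rB ox_1lB swap12B iC sC.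
  by rewrite [RHS]addrACA -[LHS]addrA.
exists c; split=> //.
- by rewrite /c addrC subrK.
- by rewrite /c counitrB counitr_ox1 aC subrr.
have sc : ox_1r C - id_Delta C = - swap12 (ox_1l c).
  by rewrite /c dC ox_1lB swap12B sC -(addrA (ox_1r C)) opprD addrA subrr add0r.
have za (P : UU L) : ox_1r P * (1 \ox a) = (1 \ox a) * ox_1r P.
  by rewrite /ox_1r !oxM !mulr1 !mul1r.
have Ea := ox_1l_slot3 a.
move: E7; rewrite /A Delta_id_1ox id_Delta_1ox Ea (za C) -mulrBr sc mulrN swap12N swap12M swap12K.
have -> : swap12 (1 \ox a) = ox_1l (1 \ox a) :> UUU L by rewrite Ea; exact: swap12_slot3.
have -> : z = ox_1l (1 \ox S) by rewrite ox_1l_ox.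
have -> : ox_1r (1 \ox a) * (1 \ox a) = ox_1l (a \ox a) by rewrite /ox_1r oxM mulr1 mul1r ox_1l_ox.
rewrite -!ox_1lM -ox_1lB -ox_1lN => /ox_1l_inj E.
by apply/eqP; rewrite -subr_eq0 addrAC E addrC subrr.
Qed.

End Solve.

(** * The case D = 0 *)

Lemma zmod_rearrange (V : zmodType) (p u a b m : V) :
  p - u = (a - b + (b - u)) - (a - (p + m) + m).
Proof.
have -> : a - (p + m) + m = a - p by rewrite opprD addrA subrK.
by rewrite addrA subrK opprB [RHS]addrC addrA subrK.
Qed.

Section Solve.
Variables (K : fieldType) (L : finDimLieAlgType K).
Local Notation H := 'U(L).
Implicit Types (w A C c : UU L) (a b d h : H).
Variables (s : L) (s_neq0 : s != 0).
Local Notation S := (env_gen s : H).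
Local Notation y := ((1 \ox S) \ox 1 : UUU L).
Local Notation z := ((1 : UU L) \ox S).

Let nzd1 : no_zero_divisors H. Proof. exact: nzd_env. Qed.
Let nzd2 : no_zero_divisors (UU L). Proof. exact: nzd_tensor (@nzd_env K L). Qed.

Lemma env_gen0 : env_gen 0 = 0 :> H.
Proof. by rewrite -(scale0r (0 : L)) env_genZ scale0r. Qed.

Lemma env_gen_neq0 : S != 0.
Proof. by apply: contraNneq s_neq0; rewrite -env_gen0 => /env_gen_injective ->. Qed.

Lemma zdeg_1ox a : zdeg (1 \ox a : UU L) = msize (symb a).
Proof. by rewrite zdeg_ox_eq ?oner_neq0. Qed.

Lemma zdeg_1ox_leq1 a : (zdeg (1 \ox a : UU L) <= 1)%N -> a = (counit a : K) *: 1.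
Proof.
case/zdeg_leq1 => h /(congr1 (@swapK K H H)); rewrite !swapK_ox => E.
have aE : a = (counit h : K) *: 1.
  by have := congr1 (@counitr K L H) E; rewrite counitr_ox1 counitr_ox.
suff -> : counit a = counit h by [].
by rewrite aE linearZ rmorph1 /= -[LHS]/(_ * 1) mulr1.
Qed.

(** In the form
[(1 \ox a) (c - 1 \ox s)
 = (1 \ox s) (Delta a - 1 \ox a) + (1 \ox s a - 1 \ox a s) - a \ox a],
the equation has a right-hand side of at most the degree of [a] in the last
factor, so [c - 1 \ox s] has degree [0] there, and the counit makes it vanish.
Exchanging factors, what is left is
[(a - s) \ox a = (s \ox 1) (Delta a - 1 \ox a) - a s \ox 1]. If
[a <> s], comparing degrees shows that [a] is a scalar, and for a scalar the
equation says that [a \ox a = 0]. *)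
Lemma D0_A_neq0 a c : a != 0 -> counitr c = 0 ->
  a \ox a + (1 \ox a) * c = (1 \ox S) * Delta a -> c = 1 \ox S /\ a = S.
Proof.
move=> a0 c0 E.
have ka : (0 < msize (symb a))%N by rewrite lt0n symb_eq0.
have oneA : 1 \ox a != 0 :> UU L by rewrite -zdeg_eq0 zdeg_1ox symb_eq0.
have cS : c = 1 \ox S.
  apply/eqP; rewrite -subr_eq0; apply/eqP; apply: zdeg_leq1_eq0; last first.
    by rewrite counitrB c0 counitr_ox counit_gen scale0r subrr.
  apply: (zdeg_cancell nzd1 oneA) => //; rewrite addn1 /=.
  have -> : (1 \ox a) * (c - 1 \ox S) = (1 \ox S) * (Delta a - 1 \ox a)
      + ((1 \ox S) * (1 \ox a) - (1 \ox a) * (1 \ox S)) - a \ox a.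
    rewrite !mulrBr addrA subrK -E addrAC; congr (_ - _).
    by rewrite [RHS]addrAC subrr add0r.
  rewrite zdeg_1ox; apply: zdegB_leq; last exact: zdeg_ox.
  apply: zdegD_leq.
    apply: leq_trans (zdegM_le2 (zdeg_oxgen _ s) (zdeg_Delta_lead a)) _.
    by lia.
  by rewrite -zdeg_1ox; exact: zdeg_comm.
split=> //; apply/eqP; rewrite -subr_eq0; apply/negPn/negP => aS0.
have E2 : (a - S) \ox a = (S \ox 1) * (Delta a - 1 \ox a) - (a * S) \ox 1.
  have := congr1 (@swapK K H H) E.
  rewrite cS raddfD !rmorphM /= !swapK_ox swapK_Delta oxM mulr1 => {}E.
  rewrite mulrBr -E oxM mulr1 mul1r oxDl oxNl.
  by rewrite swapK_ox [RHS]addrAC addrK.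
have za := zdeg_ox_eq a aS0; rewrite {}E2 in za.
have a1 : (zdeg (1 \ox a : UU L) <= 1)%N.
  rewrite zdeg_1ox leqNgt; apply/negP => a_gt1.
  suff : (msize (symb a) <= (msize (symb a)).-1)%N by lia.
  rewrite -{1}za; apply: zdegB_leq.
    apply: leq_trans (zdegM_le2 (zdeg_ox1 L _) (zdeg_Delta_lead a)) _.
    by rewrite add1n.
  by apply: leq_trans (zdeg_ox1 L _) _; lia.
have aE := zdeg_1ox_leq1 a1.
have Da : Delta a = 1 \ox a by rewrite aE linearZ rmorph1 oxZr.
have aS : a * S = S * a by rewrite aE -scalerAl -scalerAr mul1r mulr1.
move: E; rewrite cS Da !oxM !mul1r aS -[X in _ = X]add0r => /addIr.
by case/ox_eq0 => /eqP; rewrite (negbTE a0).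
Qed.

(** Apart from [c_23 (c - 1 \ox s)_12] every term of the equation has at most the
degree of [c] in the first factor as its middle degree. So, if [c <> 0],
[c - 1 \ox s] has degree [0] in the last factor, and the counit makes it
vanish. *)
Lemma D0_A_eq0 c : counitr c = 0 -> id_Delta c = ox_1r c + swap12 (ox_1l c) ->
  swap12 (y * Delta_id c - ox_1l c * id_Delta c) = y * Delta_id c - ox_1l c * id_Delta c ->
  c = 0 \/ c = 1 \ox S.
Proof.
move=> c0 dc; have [->|cn0 E] := eqVneq c 0; [by left|right; move: E].
pose x : UUU L := (S \ox 1) \ox 1.
have yE : y = ox_1r (1 \ox S) by [].
have swy : swap12 y = x by rewrite swap12_ox.
rewrite dc swap12B !swap12M swy swap12_Delta_id swap12D swap12K !mulrDr => E.
have P0 : rot3 (ox_1l c) != 0 by rewrite -zdeg_eq0 zdeg_rot3_ox_1l zdeg_eq0 swapK_eq0.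
have E2 : ox_1l c * ox_1r (c - 1 \ox S)
    = (y * (Delta_id c - ox_1l c) + (y * ox_1l c - ox_1l c * y))
      - (x * Delta_id c - (swap12 (ox_1l c) * swap12 (ox_1r c) + swap12 (ox_1l c) * ox_1l c)
         + ox_1l c * swap12 (ox_1l c)).
  rewrite E ox_1rB -yE !mulrBr.
  exact: zmod_rearrange.
apply/eqP; rewrite -subr_eq0; apply/eqP; apply: zdeg_leq1_eq0; last first.
  by rewrite counitrB c0 counitr_ox counit_gen scale0r subrr.
rewrite -zdeg_rot3_ox_1r; apply: (zdeg_cancell nzd2 P0) => //.
rewrite addn1 /= zdeg_rot3_ox_1l -rot3M {}E2 !(rot3D, rot3N, rot3M).
rewrite rot3_swap_ox_1l rot3_swap_ox_1r rot3_Delta_id rot3_ox_1l.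
set c' := swapK c; have c'0 : (0 < zdeg c')%N by rewrite lt0n zdeg_eq0 swapK_eq0.
have ry : rot3 y = 1 \ox S by rewrite rot3_ox.
have rx : rot3 x = (1 \ox S) \ox 1 by rewrite rot3_ox.
rewrite {}ry {}rx.
have z1 (u : UU L) (P : UUU L) : (zdeg P <= zdeg c')%N -> (zdeg ((u \ox 1) * P)%R <= zdeg c')%N.
  by move=> Pc; apply: leq_trans (zdegM_le2 (zdeg_ox1 L _) Pc) _; rewrite add1n.
have z1r (u : UU L) (P : UUU L) : (zdeg P <= zdeg c')%N -> (zdeg (P * (u \ox 1))%R <= zdeg c')%N.
  by move=> Pc; apply: leq_trans (zdegM_le2 Pc (zdeg_ox1 L _)) _; rewrite addn1.
apply: zdegB_leq; first apply: zdegD_leq.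
- apply: leq_trans (zdegM_le2 (zdeg_oxgen _ s) (zdeg_id_Delta_lead c')) _.
  by rewrite add2n /= prednK.
- exact: leq_trans (zdeg_comm _ _) (zdeg_zmap _ _).
apply: zdegD_leq; first apply: zdegB_leq; last first.
- by apply: z1r; exact: zdeg_zmap.
- by apply: zdegD_leq; apply: z1; exact: zdeg_zmap.
- by apply: z1; exact: zdeg_id_Delta.
Qed.

End Solve.

(** * The case D = t *)

Lemma zmod_isolate (V : zmodType) (x c3 z0 y0 D : V) :
  x - c3 - (x + z0) = y0 + c3 - D -> D = y0 + c3 + (c3 + z0).
Proof.
have -> : x - c3 - (x + z0) = - (c3 + z0).
  by rewrite opprD addrA [x - c3]addrC addrK [RHS]opprD.
by move=> E; rewrite -[c3 + z0]opprK E opprB addrC subrK.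
Qed.

Lemma zmod_double (V : zmodType) (p p' q : V) :
  - p' - (p' + q) = - p - (p + q) -> (p - p') + (p - p') = 0.
Proof.
rewrite !opprD [LHS]addrA [RHS]addrA => /addIr E.
by rewrite addrACA E addrACA subrr addr0.
Qed.

Lemma zmod_sub3 (V : zmodType) (a b c : V) : a - (a + b) - c = - b - c.
Proof. by rewrite opprD addrA subrr sub0r. Qed.

Lemma fixed_sub3 (V : zmodType) (f : {additive V -> V}) (a b c : V) :
  f b = b -> f (a - (a + b) - c) = a - (a + b) - c -> f c = c.
Proof. by rewrite zmod_sub3 => fb; rewrite raddfB raddfN /= fb => /addrI/oppr_inj. Qed.

Section Solve.
Variables (K : fieldType) (L : finDimLieAlgType K).
Local Notation H := 'U(L).
Implicit Types (w A C c : UU L) (a b d h : H).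
Variables (s : L) (t : K).
Hypotheses (K2 : 2%:R != 0 :> K) (t_neq0 : t != 0) (s_neq0 : s != 0).
Local Notation S := (env_gen s : H).
Local Notation y := ((1 \ox S) \ox 1 : UUU L).
Local Notation z := ((1 : UU L) \ox S).

Let S0 : S != 0. Proof. exact: env_gen_neq0. Qed.
Let eS (A : algType K) (a : A) : counitr (a \ox S) = 0.
Proof. by apply: counitr_S; exact: counit_gen. Qed.

Lemma addrr_eq0 (V : lmodType K) (v : V) : v + v = 0 -> v = 0.
Proof.
by move/eqP; rewrite -mulr2n -scaler_nat scaler_eq0 (negbTE K2) => /eqP.
Qed.

Lemma id_Delta_1S : id_Delta (1 \ox S) = y + z :> UUU L.
Proof. by rewrite id_Delta_1ox Delta_gen ox_1lD !ox_1l_ox. Qed.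

(** The first equation says that [Delta c = c \ox 1 + 2 (1 \ox c) + 1 \ox s].
The counits turn this into [c = - s], and the second equation then says that
[2 (1 \ox s - s \ox 1) \ox s = 0]. *)
Lemma Dt_B0_absurd (c : H) :
  (t *: 1) * y - (t *: 1) * ox_1l (1 \ox c) - (t *: 1) * (y + z)
    = swap12 ((t *: 1) * ox_1r (1 \ox c) + (t *: 1) * (1 \ox c) - (t *: 1) * ox_1l (Delta c)) ->
  swap12 (y * (1 \ox c) - ox_1l (1 \ox c) * ox_1l (Delta c))
    = y * (1 \ox c) - ox_1l (1 \ox c) * ox_1l (Delta c) ->
  False.
Proof.
move=> E Q3; move: E; rewrite !scale1_mull -!scalerBr -scalerDr -scalerBr swap12Z.
move/(scalerI t_neq0)/(congr1 (@swap12 K L)).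
rewrite swap12K !swap12B swap12D !ox_1l_slot3 !swap12_slot3 => E.
have D1 : Delta c = c \ox 1 + 1 \ox c + (1 \ox c + 1 \ox S).
  apply: ox_1l_inj; rewrite !ox_1lD !ox_1l_slot3 ox_1l_ox.
  exact: zmod_isolate E.
pose u : H := (counit c : K) *: 1.
have e1 : c = u + c + (c + S).
  have := congr1 (@counitl K L) D1; rewrite counitl_Delta !raddfD /= !counitl_ox.
  by rewrite rmorph1 !scale1r.
have e2 : c = c + u + (u + 0).
  have := congr1 (@counitr K L H) D1; rewrite counitr_Delta !counitrD.
  by rewrite !counitr_ox rmorph1 !scale1r counit_gen scale0r.
have u0 : u = 0.
  by apply: addrr_eq0; move: e2; rewrite addr0 -[LHS]addr0 -addrA => /addrI.
have cE : c = - S.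
  move: e1; rewrite u0 add0r -[LHS]addr0 => /addrI/esym/eqP.
  by rewrite addr_eq0 => /eqP.
have vE : y * (1 \ox c) - ox_1l (1 \ox c) * ox_1l (Delta c)
    = - ((1 \ox S) \ox S) - ((1 \ox S) \ox S + 1 \ox (S * S)) :> UUU L.
  have DN : Delta (- S) = - Delta S by exact: raddfN.
  rewrite ox_1l_slot3 cE DN !oxNr mulrN ox_1lN mulNr mulrN opprK.
  by rewrite Delta_gen ox_1lD !ox_1l_ox mulrDr !oxM !mulr1 !mul1r.
move: Q3; rewrite vE swap12B swap12D swap12N swap12_slot3 !swap12_ox => /zmod_double/addrr_eq0.
rewrite -oxNl -oxDl => /ox_eq0[|/eqP]; last by rewrite (negbTE S0).
move/(congr1 (@counitr K L H)); rewrite counitrD counitrN eS counitr_ox1 raddf0 add0r.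
by move/eqP; rewrite oppr_eq0 (negbTE S0).
Qed.

(** The first equation makes [c] primitive, the second leaves [c = 0] or [c = s].
In the former case the third equation says that [a \ox 1 \ox s = 0], in
the latter [2 a = 0]. *)
Lemma Dt_Bt_A0 (a c : H) : c = S + (a + a) ->
  (t *: 1) * ox_1r (a \ox 1) + (t *: 1) * (1 \ox c) - (t *: 1) * ox_1l (1 \ox c)
      - (t *: 1) * ox_1r (a \ox 1)
    = swap12 ((t *: 1) * ox_1r (1 \ox c) + (t *: 1) * (1 \ox c) - (t *: 1) * ox_1l (Delta c)) ->
  swap12 (y * (1 \ox c) - ox_1l (1 \ox c) * ox_1l (Delta c))
    = y * (1 \ox c) - ox_1l (1 \ox c) * ox_1l (Delta c) ->
  ox_1r (a \ox 1) * ox_1r (Delta a) - z * ox_1r (a \ox 1)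
    = swap12 (ox_1r (1 \ox c) * ox_1r (Delta a) - ox_1l (a \ox 1) * ox_1l (Delta c)) ->
  a = 0.
Proof.
move=> cE; rewrite !scale1_mull => Q5 Q3 Q7.
have prim : Delta c = c \ox 1 + 1 \ox c.
  apply: ox_1l_inj; rewrite ox_1lD ox_1l_slot3 ox_1l_ox.
  have : ox_1r (1 \ox c) + 1 \ox c - ox_1l (Delta c) = 0.
    apply: (scalerI t_neq0); apply: (can_inj (@swap12K K L)).
    by rewrite scaler0 scalerBr scalerDr -Q5 ox_1l_slot3 addrK subrr swap120.
  by move/eqP; rewrite subr_eq0 => /eqP.
have c0 : (counit c : K) *: 1 = 0 :> H.
  have := congr1 (@counitr K L H) prim; rewrite counitr_Delta counitrD counitr_ox1 counitr_ox.
  by rewrite -[LHS]addr0 => /addrI.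
have [cz|cS] : c = 0 \/ c = S.
  have vE : y * (1 \ox c) - ox_1l (1 \ox c) * ox_1l (Delta c)
      = (1 \ox S) \ox c - ((1 \ox c) \ox c + 1 \ox (c * c)) :> UUU L.
    rewrite prim ox_1lD !ox_1l_ox mulrDr !oxM.
    by rewrite !mulr1 !mul1r.
  move: Q3; rewrite vE swap12B swap12D swap12_slot3 !swap12_ox.
  rewrite !opprD [LHS]addrA [RHS]addrA => /addIr/eqP; rewrite -subr_eq0 => /eqP E.
  have : (S \ox 1 - c \ox 1 - (1 \ox S - 1 \ox c)) \ox c = 0 :> UUU L.
    by rewrite [LHS]oxDl oxNl !oxDl !oxNl.
  case/ox_eq0 => [/(congr1 (@counitr K L H)) E1|->]; [right; move: E1|by left].
  rewrite !counitrB !counitr_ox1 eS counitr_ox c0 subrr subr0 raddf0.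
  by move/eqP; rewrite subr_eq0 => /eqP.
- have zA : z * ox_1r (a \ox 1) = (a \ox 1) \ox S by rewrite /ox_1r oxM mulr1 mul1r.
  move: Q7; rewrite cz ox0r ox_1r0 raddf0 ox_1l0 mul0r mulr0 subrr swap120.
  rewrite -ox_1rM zA => E.
  have := congr1 (@counitr K L (UU L)) E; rewrite counitrB counitr_ox_1r eS subr0 raddf0 => E0.
  move: E; rewrite E0 ox_1r0 sub0r => /eqP; rewrite oppr_eq0 => /eqP.
  case/ox_eq0 => [/(congr1 (@counitr K L H))|/eqP]; last by rewrite (negbTE S0).
  by rewrite counitr_ox1 raddf0.
apply: addrr_eq0; move: cE; rewrite cS -[LHS]addr0 => /addrI/esym; exact.
Qed.

(** The relations of [A_C_from_B] give [b = 0] or [b = t]: since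
[(swap C - A) Delta b] has degree [0] in the last factor, so has [swap C - A]
when [b <> 0]; with [C = 1 \ox c] this bounds [A], whereas [A] contains
[(t - b) \ox s]. *)
Lemma Dt_solution A C b :
  t *: A = t *: (1 \ox S) + t *: (counitr A \ox 1) - b \ox S ->
  A * Delta b = swapK C * Delta b - t *: (counitr A \ox 1) - (b * S) \ox 1 ->
  swap12 (y * Delta_id C - ox_1l C * id_Delta C) = y * Delta_id C - ox_1l C * id_Delta C ->
  swap12 (y * (t *: 1) - (t *: 1) * (y + z) - ox_1l C * (t *: 1))
    = y * (t *: 1) - (t *: 1) * (y + z) - ox_1l C * (t *: 1) ->
  (t *: 1) * ox_1r A + ox_1r (b \ox 1) * Delta_id C - (t *: 1) * ox_1l C - (t *: 1) * id_Delta A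
    = swap12 ((t *: 1) * ox_1r C + (t *: 1) * Delta_id C - (t *: 1) * id_Delta C) ->
  ox_1r A * Delta_id A - z * id_Delta A = swap12 (ox_1r C * Delta_id A - ox_1l A * id_Delta C) ->
  [/\ A = 0, b = t *: 1 & C = 1 \ox S].
Proof.
move=> A_E AD Q3 Q4 Q5 Q7.
have [c CE] : exists c : H, C = 1 \ox c.
  exists (counitl C); apply: fixed_ox_1l; move: Q4.
  rewrite scale1_mull !scale1_mulr -!scalerBr swap12Z => /(scalerI t_neq0).
  apply: fixed_sub3; exact: swap12_slot3.
move: A_E AD; move aE : (counitr A) => a A_E AD.
have bcases : b = 0 \/ b = t *: 1.
  have [->|b0] := eqVneq b 0; [by left|right].
  have Db0 : Delta b != 0.
    by apply: contraNneq b0 => Db; rewrite -(counitr_Delta b) Db raddf0.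
  have le1 : (zdeg (swapK C - A)%R <= 1)%N.
    apply: (zdeg_cancelr (@nzd_env K L) Db0).
    have -> : (swapK C - A) * Delta b = (t *: a + b * S) \ox 1.
      by rewrite mulrBl AD oxDl oxZl -addrA -opprD opprB addrC subrK.
    exact: zdeg_ox1.
  have bS : (t *: 1 - b) \ox S = t *: A - (t *: a) \ox 1.
    by rewrite A_E oxDl oxNl !oxZl addrAC addrK.
  have := @zdeg_leq1_eq0 K L H ((t *: 1 - b) \ox S).
  case/(_ _ (eS _))/ox_eq0.
  - rewrite bS; apply: zdegB_leq; last exact: zdeg_ox1.
    apply: leq_trans (zdegZ_leq _ _) _.
    rewrite -[A](subKr (swapK C)); apply: zdegB_leq => //.
    by rewrite CE swapK_ox; exact: zdeg_ox1.
  - by move/eqP; rewrite subr_eq0 => /eqP.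
  - by move/eqP; rewrite (negbTE S0).
subst C; rewrite Delta_id_1ox id_Delta_1ox in Q3 Q5 Q7.
case: bcases => bE.
- exfalso; have a0 : a = 0.
    move: AD; rewrite bE raddf0 !mulr0 mul0r ox0l subr0 sub0r => /esym/eqP.
    rewrite oppr_eq0 scaler_eq0 (negbTE t_neq0) /= => /eqP/(congr1 (@counitr K L H)).
    by rewrite counitr_ox1 raddf0.
  have AE : A = 1 \ox S.
    by apply: (scalerI t_neq0); rewrite A_E a0 bE !ox0l scaler0 addr0 subr0.
  rewrite AE bE ox0l ox_1r0 mul0r addr0 id_Delta_1S in Q5.
  exact: Dt_B0_absurd Q5 Q3.
have AE : A = a \ox 1.
  by apply: (scalerI t_neq0); rewrite A_E bE oxZl addrAC addrN add0r.
have cE : c = S + (a + a).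
  move: AD; rewrite bE linearZ rmorph1 -!scalerAr !mulr1 swapK_ox AE.
  rewrite -scalerAl mul1r -scalerBr oxZl -scalerBr => /(scalerI t_neq0).
  move/(congr1 (@counitr K L H)); rewrite !counitrB !counitr_ox1 => aE'.
  have -> : c = a + S + a by rewrite {1}aE' !subrK.
  by rewrite [a + S]addrC addrA.
have a0 : a = 0.
  clear aE A_E AD Q4; subst A; rewrite Delta_id_ox -[Delta a \ox 1]/(ox_1r (Delta a)) in Q7.
  have iA : id_Delta (a \ox 1) = ox_1r (a \ox 1) by exact: id_Delta_ox1.
  rewrite iA in Q5 Q7; rewrite bE oxZl ox_1r_scale1 in Q5.
  exact: (Dt_Bt_A0 cE Q5 Q3 Q7).
by split=> //; [rewrite AE a0 ox0l|rewrite cE a0 !addr0].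
Qed.

End Solve.

(** * The classification *)

Section Solutions.
Variables (K : fieldType) (L : finDimLieAlgType K).
Local Notation H := 'U(L).
Variables (s : L) (t : K).
Local Notation S := (env_gen s : H).

Local Notation y := ((1 \ox S) \ox 1 : UUU L).
Local Notation z := ((1 : UU L) \ox S).

Definition env_prelie_system (A B C D : UU L) : Prop :=
  prelie_system (@ox_1r K L : {lrmorphism UU L -> UUU L})
    (@ox_1l K L : {lrmorphism UU L -> UUU L}) (@Delta_id K L : {lrmorphism UU L -> UUU L})
    (@id_Delta K L : {lrmorphism UU L -> UUU L}) (@swap12 K L : {lrmorphism UUU L -> UUU L})
    y z t A B C D.

Let eS : id_Delta (1 \ox S) = y + z :> UUU L. Proof. exact: id_Delta_1S. Qed.
Let yz : y * z = z * y. Proof. by rewrite !oxM !mulr1 !mul1r. Qed.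
Let lS : ox_1l (1 \ox S) = z :> UUU L. Proof. exact: ox_1l_slot3. Qed.
Let dS : Delta_id (1 \ox S) = z :> UUU L. Proof. exact: Delta_id_1ox. Qed.

Lemma env_prelie_systemP A B C D :
  (forall i j k n, assoc_coef (structure_constants (1 \ox S) t A B C D) i j k n
    = swap12 (assoc_coef (structure_constants (1 \ox S) t A B C D) j i k n))
  <-> env_prelie_system A B C D.
Proof.
apply: prelie_systemP => //; first exact: swap12K.
exact: swap12_Delta_id.
Qed.

Lemma env_prelie_right : env_prelie_system 0 0 (1 \ox S) 0.
Proof. by apply: prelie_right => //; exact: swap12_Delta_id. Qed.

Lemma env_prelie_right_left : env_prelie_system 0 (t *: 1) (1 \ox S) (t *: 1).
Proof. by apply: prelie_right_left => //; exact: swap12_Delta_id. Qed.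

Lemma env_prelie_coproduct : env_prelie_system (1 \ox S) 0 (1 \ox S + S \ox 1) 0.
Proof.
apply: (@prelie_coproduct _ _ _ _ _ _ _ _ _ _ _ _ _ _ _ _ _ _ _ _ (ox_1r (S \ox 1))) => //.
- exact: swap12K.
- exact: swap12_Delta_id.
- by rewrite /= ox_1l_ox.
- by rewrite /= Delta_id_ox Delta_gen oxDl.
- exact: id_Delta_ox1.
- by rewrite /= swap12_ox_1r swapK_ox.
- by rewrite /ox_1r !oxM !mulr1 !mul1r.
Qed.

Hypotheses (K2 : 2%:R != 0 :> K) (t_neq0 : t != 0) (s_neq0 : s != 0).

Lemma prelie_system_solutions (A B C D : UU L) :
  swap12 (ox_1l B * id_Delta B) = ox_1l B * id_Delta B ->
  swap12 ((t *: 1) * ox_1l A + ox_1l B * id_Delta A) = (t *: 1) * ox_1l A + ox_1l B * id_Delta A ->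
  swap12 (y * Delta_id C - ox_1l C * id_Delta C) = y * Delta_id C - ox_1l C * id_Delta C ->
  swap12 (y * Delta_id D - ox_1l D * (y + z) - ox_1l C * id_Delta D)
    = y * Delta_id D - ox_1l D * (y + z) - ox_1l C * id_Delta D ->
  (t *: 1) * ox_1r A + ox_1r B * Delta_id C - (t *: 1) * ox_1l C - ox_1l D * id_Delta A
    = swap12 ((t *: 1) * ox_1r C + ox_1r D * Delta_id C - (t *: 1) * id_Delta C) ->
  ox_1r B * Delta_id D - ox_1l D * id_Delta B
    = swap12 (ox_1r D * Delta_id D - (t *: 1) * id_Delta D) ->
  ox_1r A * Delta_id A - z * id_Delta A = swap12 (ox_1r C * Delta_id A - ox_1l A * id_Delta C) ->
  ox_1r A * Delta_id B + ox_1r B * z - z * id_Delta B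
    = swap12 (ox_1r C * Delta_id B + ox_1r D * z - ox_1l A * id_Delta D - ox_1l B * (y + z)) ->
  [\/ [/\ A = 0, B = 0, C = 0 & D = 0],
      [/\ A = 0, B = 0, C = 1 \ox S & D = 0],
      [/\ A = 0, B = t *: 1, C = 1 \ox S & D = t *: 1]
    | [/\ A = 1 \ox S, B = 0, C = 1 \ox S + S \ox 1 :> UU L & D = 0]].
Proof.
move=> Q1 Q2 Q3 Q4 Q5 Q6 Q7 Q8.
have [b BE] := B_first_slot Q1; rewrite BE in Q6 Q8.
have [d DE] := D_last_slot Q6; rewrite DE in Q6.
have [d0|dt] := D_scalar Q6; last first.
  have {}DE : D = t *: 1 by rewrite DE dt oxZr.
  subst B D; have [A_E AD] := A_C_from_B (counit_gen s) Q8.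
  rewrite ox_1l_scale1 ox_1r_scale1 Delta_id_scale1 id_Delta_scale1 in Q4 Q5.
  have [A0 bt CS] := Dt_solution K2 t_neq0 s_neq0 A_E AD Q3 Q4 Q5 Q7.
  by constructor 3; split=> //; rewrite bt oxZl.
have {}DE : D = 0 by rewrite DE d0 ox0r.
have D0 : D = 0 *: 1 by rewrite scale0r.
rewrite D0 in Q8; have [E _] := A_C_from_B (counit_gen s) Q8.
have {E} B0 : B = 0.
  move: E; rewrite !scale0r addr0 sub0r BE => /esym/eqP; rewrite oppr_eq0 => /eqP/ox_eq0.
  by case=> [->|/eqP]; [rewrite ox0l|rewrite (negbTE (env_gen_neq0 s_neq0))].
rewrite B0 ox_1l0 mul0r addr0 scale1_mull swap12Z in Q2.
have AE := fixed_ox_1l (scalerI t_neq0 Q2).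
rewrite B0 DE ox_1r0 ox_1l0 !mul0r !addr0 subr0 in Q5.
rewrite AE in Q5 Q7.
have [c [CE c0 dc ac]] := D0_shape t_neq0 Q5 Q7.
have [a0|a0] := eqVneq (counitl A) 0; last first.
  have [cS aS] := D0_A_neq0 s_neq0 a0 c0 ac.
  by constructor 4; split=> //; [rewrite AE aS|rewrite CE cS aS addrC].
rewrite a0 ox0r in AE; rewrite a0 ox0l add0r in CE.
rewrite CE in Q3; rewrite CE.
by case: (D0_A_eq0 c0 dc Q3) => ->; [constructor 1|constructor 2].
Qed.

End Solutions.

Theorem theorem3p15 (K : closedFieldType) (K_char0 : [pchar K] =i pred0)
    (delta : finDimLieAlgType K) (P : lmodType 'U(delta)) (e1 e2 : P)
    (e_basis : free_basis2 e1 e2) (star : pseudoproduct P)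
    (s : delta) (t : K) (s_neq0 : s != 0) (t_neq0 : t != 0)
    (star11 : star e1 e1 = t%:A \ox 1 \oxH e1)
    (star22 : star e2 e2 = 1 \ox env_gen s \oxH e2) :
  left_prelie star <->
  [\/ star e1 e2 = 0 /\ star e2 e1 = 0,
      star e1 e2 = 0 /\ star e2 e1 = 1 \ox env_gen s \oxH e1,
      star e1 e2 = t%:A \ox 1 \oxH e2 /\
        star e2 e1 = 1 \ox env_gen s \oxH e1 + t%:A \ox 1 \oxH e2
    | star e1 e2 = 1 \ox env_gen s \oxH e1 /\
        star e2 e1 = (1 \ox env_gen s + env_gen s \ox 1) \oxH e1].
Proof.
have K2 : 2%:R != 0 :> K.
  by apply/negP => K2; have := K_char0 2%N; rewrite !inE /= K2.
set S := env_gen s; have tE : t%:A \ox (1 : 'U(delta)) = t *: 1 :> UU delta by rewrite oxZl.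
have [A [B AB]] : exists A B, star e1 e2 = A \oxH e1 + B \oxH e2.
  exact: free_tensH_ex.
have [C [D CD]] : exists C D, star e2 e1 = C \oxH e1 + D \oxH e2.
  exact: free_tensH_ex.
have H0 (x : P) : 0 \oxH x = 0 by exact: pure0l.
have star_e i j : star (if i then e2 else e1) (if j then e2 else e1)
    = structure_constants (1 \ox S) t A B C D i j false \oxH e1
      + structure_constants (1 \ox S) t A B C D i j true \oxH e2.
  by case: i j => [] [] /=; rewrite ?H0 ?addr0 ?add0r // star11 tE.
have systemP : left_prelie star <-> env_prelie_system s t A B C D.
  by rewrite (left_prelie_coef e_basis star_e); exact: env_prelie_systemP.
have coords u v w u' v' : w = u \oxH e1 + v \oxH e2 -> w = u' \oxH e1 + v' \oxH e2 ->
    u = u' /\ v = v'.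
  by move=> -> /(free_tensH_inj e_basis).
split=> [/systemP[[Q1 Q2 Q3 Q4] [Q5 Q6 Q7 Q8]]|cases]; last first.
  apply/systemP.
  have e1' (u : UU delta) : u \oxH e1 = u \oxH e1 + 0 \oxH e2 by rewrite H0 addr0.
  have e2' (u : UU delta) : u \oxH e2 = 0 \oxH e1 + u \oxH e2 by rewrite H0 add0r.
  have e0' : 0 = 0 \oxH e1 + 0 \oxH e2 :> UU_tens P by rewrite !H0 addr0.
  case: cases => -[E12 E21].
  - have [-> ->] := coords _ _ _ _ _ AB (etrans E12 e0').
    have [-> ->] := coords _ _ _ _ _ CD (etrans E21 e0').
    exact: prelie_zero.
  - have [-> ->] := coords _ _ _ _ _ AB (etrans E12 e0').
    have [-> ->] := coords _ _ _ _ _ CD (etrans E21 (e1' _)).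
    exact: env_prelie_right.
  - have [-> ->] := coords _ _ _ _ _ AB (etrans E12 (e2' _)).
    have [-> ->] := coords _ _ _ _ _ CD E21.
    rewrite tE; exact: env_prelie_right_left.
  - have [-> ->] := coords _ _ _ _ _ AB (etrans E12 (e1' _)).
    have [-> ->] := coords _ _ _ _ _ CD (etrans E21 (e1' _)).
    exact: env_prelie_coproduct.
pose y : UUU delta := (1 \ox S) \ox 1; pose z : UUU delta := 1 \ox S.
(* The equations again, with the maps of the general system replaced by the
   concrete ones. *)
have Q2' : swap12 ((t *: 1) * ox_1l A + ox_1l B * id_Delta A) = (t *: 1) * ox_1l A + ox_1l B * id_Delta A := Q2.
have Q5' : (t *: 1) * ox_1r A + ox_1r B * Delta_id C - (t *: 1) * ox_1l C - ox_1l D * id_Delta A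
    = swap12 ((t *: 1) * ox_1r C + ox_1r D * Delta_id C - (t *: 1) * id_Delta C) := Q5.
have Q6' : ox_1r B * Delta_id D - ox_1l D * id_Delta B
    = swap12 (ox_1r D * Delta_id D - (t *: 1) * id_Delta D) := Q6.
have Q1' : swap12 (ox_1l B * id_Delta B) = ox_1l B * id_Delta B := Q1.
have Q3' : swap12 (y * Delta_id C - ox_1l C * id_Delta C) = y * Delta_id C - ox_1l C * id_Delta C := Q3.
have Q4' : swap12 (y * Delta_id D - ox_1l D * (y + z) - ox_1l C * id_Delta D)
    = y * Delta_id D - ox_1l D * (y + z) - ox_1l C * id_Delta D := Q4.
have Q7' : ox_1r A * Delta_id A - z * id_Delta A = swap12 (ox_1r C * Delta_id A - ox_1l A * id_Delta C) := Q7.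
have Q8' : ox_1r A * Delta_id B + ox_1r B * z - z * id_Delta B
    = swap12 (ox_1r C * Delta_id B + ox_1r D * z - ox_1l A * id_Delta D - ox_1l B * (y + z)) := Q8.
have := prelie_system_solutions K2 t_neq0 s_neq0 Q1' Q2' Q3' Q4' Q5' Q6' Q7' Q8'.
rewrite AB CD tE; case=> -[-> -> -> ->].
- by constructor 1; rewrite !H0 addr0.
- by constructor 2; rewrite !H0 !addr0.
- by constructor 3; rewrite !H0 add0r.
- by constructor 4; rewrite !H0 !addr0.
Qed.
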